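(* Let $C\subset\mathbb{C}^\times$ be a finite non-empty subset all of whose elements have the same argument $\arg C$, and let $\theta_0:=-\tfrac12\arg C$, where $\tfrac12\arg C$ is chosen so that $\theta_0\in[-\tfrac{\pi}{2},\tfrac{\pi}{2})$ (this is a generic direction for $C$). Let $\mathrm{r}=(r_c)_{c\in C}$ be a family of positive integers, and let $\sigma=(\sigma_k)_{k\in\mathbb{Z}/4\mathbb{Z}}$ be a family of four complex block matrices, with block structure given by the $r_c$ ordered according to the numbering of $C$ with respect to $\theta_0$, such that $\sigma_k$ is upper block-triangular for $k$ odd, lower block-triangular for $k$ even, and $\sigma_4\sigma_3\sigma_2\sigma_1=\mathbb{1}$. Set $\widehat C:=\{-\tfrac1c\mid c\in C\}$, $\widehat\theta_0:=\pi-\theta_0$ and $\widehat{\mathrm{r}}:=(r_{-1/\widehat c})_{\widehat c\in\widehat C}$. Then there is an isomorphism in $\mathrm{D}^{\mathrm b}(\mathbf{k}_{\mathbb{C}_w\times\mathbb{R}})$ $${}^{\mathcal L}\mathcal{F}_\sigma^{C,\theta_0,\mathrm{r}}\simeq\mathcal{F}_\sigma^{\widehat C,\widehat\theta_0,\widehat{\mathrm{r}}}.$$ In particular, the gluing matrices $\sigma=(\sigma_k)_{k\in\mathbb{Z}/4\mathbb{Z}}$ remain the same.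
   Context: $\mathbf{k}=\mathbb{C}$. For a complex manifold $X$, $\pi\colon X\times\mathbb{R}\to X$ is the projection and $t$ the coordinate on $\mathbb{R}$. For $Z\subseteq X$ locally closed and $\varphi\colon X\to\mathbb{R}$ continuous, $\mathsf{E}^{\varphi}_{Z|X}:=\pi^{-1}\mathbf{k}_Z\otimes\mathbf{k}_{\{t+\varphi\ge0\}}\in\mathrm{D}^{\mathrm b}(\mathbf{k}_{X\times\mathbb{R}})$. For a sheaf $\mathcal F$ on $X\times\mathbb{R}$, $\mathcal F_Z:=\mathcal F\otimes\mathbf{k}_{Z\times\mathbb{R}}$. Convolution on $\mathrm{D}^{\mathrm b}(\mathbf{k}_{X\times\mathbb{R}})$: $\mathcal F\overset{*}{\otimes}\mathcal G:=\mathsf{R}\mu_!(q_1^{-1}\mathcal F\otimes q_2^{-1}\mathcal G)$ with $\mu,q_1,q_2\colon X\times\mathbb{R}^2\to X\times\mathbb{R}$, $\mu(x,t_1,t_2)=(x,t_1+t_2)$, $q_i(x,t_1,t_2)=(x,t_i)$. Generic directions and numbering: for a finite $C\subset\mathbb{C}^\times$, a direction $\theta\in\mathbb{R}/2\pi\mathbb{Z}$ is generic if for all distinct $c,d\in C$ one has $\operatorname{Re}(\frac c2z^2)\ne\operatorname{Re}(\frac d2z^2)$ for $z\neq0$ with $\arg z=\theta$. Given a generic $\theta_0$, number $C=\{c_{(1)},\dots,c_{(n)}\}$ so that $\operatorname{Re}(\frac{c_{(1)}}2z^2)<\dots<\operatorname{Re}(\frac{c_{(n)}}2z^2)$ for $z\ne0$,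 $\arg z=\theta_0$. The sheaf $\mathcal F_\sigma^{C,\theta_0,\mathrm r}$: given $C$, a generic $\theta_0$, positive integers $\mathrm r=(r_c)_{c\in C}$, $r=\sum_c r_c$, and $r\times r$ block matrices $\sigma=(\sigma_k)_{k\in\mathbb{Z}/4\mathbb{Z}}$ ($j$-th diagonal block of size $r_{c_{(j)}}$) with $\sigma_1,\sigma_3$ upper and $\sigma_2,\sigma_4$ lower block-triangular and $\sigma_4\sigma_3\sigma_2\sigma_1=\mathbb 1$, let $S_k=\{z\in\mathbb{C}\mid \arg z\in[\theta_0+(k-1)\frac\pi2,\theta_0+k\frac\pi2]\text{ if }z\ne0\}$ and $S_{k,k+1}=S_k\cap S_{k+1}$. Then $\mathcal F_\sigma^{C,\theta_0,\mathrm r}$ is the sheaf on $\mathbb{C}\times\mathbb{R}$, unique up to unique isomorphism, equipped with isomorphisms $\alpha_k\colon(\mathcal F_\sigma)_{S_k}\to\bigoplus_{c\in C}\big(\mathsf E^{-\operatorname{Re}(\frac c2z^2)}_{S_k|\mathbb{C}}\big)^{r_c}$ such that over $S_{k,k+1}$ the transition isomorphism $\alpha_{k+1}\circ\alpha_k^{-1}$ is given by the matrix $\sigma_k$ (summands ordered by the numbering of $C$, matrix entries acting by scalar multiplication). Enhanced Fourier–Sato transform: with the projections $\widetilde p\colon\mathbb{C}_z\times\mathbb{C}_w\times\mathbb{R}\to\mathbb{C}_z\times\mathbb{R}$ and $\widetilde q\colon\mathbb{C}_z\times\mathbb{C}_w\times\mathbb{R}\to\mathbb{C}_w\times\mathbb{R}$,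 for $\mathcal F\in\mathrm{D}^{\mathrm b}(\mathbf k_{\mathbb{C}_z\times\mathbb{R}})$ set ${}^{\mathcal L}\mathcal F:=\mathsf R\widetilde q_!\big(\mathsf E^{-\operatorname{Re}(zw)}_{\mathbb{C}_z\times\mathbb{C}_w|\mathbb{C}_z\times\mathbb{C}_w}\overset{*}{\otimes}\widetilde p^{\,-1}\mathcal F\big)[1]\in\mathrm{D}^{\mathrm b}(\mathbf k_{\mathbb{C}_w\times\mathbb{R}})$. *)

(* Defs.v *)
(* The complex numbers are R[i], for an arbitrary R : realType; the alias R[i]^o
   carries their metric topology. *)
From HB Require Import structures.
From mathcomp Require Import all_boot all_order all_algebra.
From mathcomp Require Import generic_quotient complex finmap.
From mathcomp Require Import all_classical all_reals all_analysis.
From mathcomp Require Import ring lra.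

Set Implicit Arguments.
Unset Strict Implicit.
Unset Printing Implicit Defensive.

Import Order.TTheory GRing.Theory Num.Theory.
Import numFieldTopology.Exports numFieldNormedType.Exports.
Local Open Scope classical_set_scope.
Local Open Scope ring_scope.

Section Dprod.
Variables (K : fieldType) (I : Type) (V : I -> lmodType K).

Definition dprod := forall i, V i.

HB.instance Definition _ := gen_eqMixin dprod.
HB.instance Definition _ := gen_choiceMixin dprod.

Let dadd (f g : dprod) : dprod := fun i => f i + g i.
Let dopp (f : dprod) : dprod := fun i => - f i.
Let dzero : dprod := fun=> 0.
Let dscale (a : K) (f : dprod) : dprod := fun i => a *: f i.

Fact dprod_addA : associative dadd.
Proof. by move=> f g h; apply: functional_extensionality_dep => i; exact: addrA. Qed.
Fact dprod_addC : commutative dadd.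
Proof. by move=> f g; apply: functional_extensionality_dep => i; exact: addrC. Qed.
Fact dprod_add0 : left_id dzero dadd.
Proof. by move=> f; apply: functional_extensionality_dep => i; exact: add0r. Qed.
Fact dprod_addN : left_inverse dzero dopp dadd.
Proof. by move=> f; apply: functional_extensionality_dep => i; exact: addNr. Qed.
HB.instance Definition _ :=
  GRing.isZmodule.Build dprod dprod_addA dprod_addC dprod_add0 dprod_addN.

Fact dprod_scaleA a b (f : dprod) : dscale a (dscale b f) = dscale (a * b) f.
Proof. by apply: functional_extensionality_dep => i; exact: scalerA. Qed.
Fact dprod_scale1 : left_id 1 dscale.
Proof. by move=> f; apply: functional_extensionality_dep => i; exact: scale1r. Qed.
Fact dprod_scaleDr : right_distributive dscale +%R.
Proof. by move=> a f g; apply: functional_extensionality_dep => i; exact: scalerDr. Qed.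
Fact dprod_scaleDl (f : dprod) : {morph dscale^~ f : a b / a + b}.
Proof. by move=> a b; apply: functional_extensionality_dep => i; exact: scalerDl. Qed.
HB.instance Definition _ := GRing.Zmodule_isLmodule.Build K dprod
  dprod_scaleA dprod_scale1 dprod_scaleDr dprod_scaleDl.

End Dprod.

Section Subspace.
Variables (K : fieldType) (V : lmodType K).

Record subspace := Subspace {
  insub_space :> V -> Prop;
  subspace0 : insub_space 0;
  subspaceP : forall a u v, insub_space u -> insub_space v ->
    insub_space (a *: u + v)
}.

Variable S : subspace.

Record subsp := Subsp { subsp_val : V; subsp_valP : S subsp_val }.

HB.instance Definition _ := gen_eqMixin subsp.
HB.instance Definition _ := gen_choiceMixin subsp.

Lemma subsp_inj : injective subsp_val.
Proof.
move=> [u uS] [v vS] /= uv; subst v; congr Subsp; exact: Prop_irrelevance.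
Qed.

Fact subspZ a u : S u -> S (a *: u).
Proof. by move=> uS; rewrite -[_ *: _]addr0; apply: subspaceP => //; exact: subspace0. Qed.
Fact subspD u v : S u -> S v -> S (u + v).
Proof. by move=> uS vS; rewrite -[u]scale1r; exact: subspaceP. Qed.
Fact subspN u : S u -> S (- u).
Proof. by rewrite -scaleN1r; exact: subspZ. Qed.

Let sadd (u v : subsp) := Subsp (subspD (subsp_valP u) (subsp_valP v)).
Let sopp (u : subsp) := Subsp (subspN (subsp_valP u)).
Let szero := Subsp (subspace0 S).
Let sscale (a : K) (u : subsp) := Subsp (subspZ a (subsp_valP u)).

Fact subsp_addA : associative sadd.
Proof. by move=> *; apply: subsp_inj; exact: addrA. Qed.
Fact subsp_addC : commutative sadd.
Proof. by move=> *; apply: subsp_inj; exact: addrC. Qed.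
Fact subsp_add0 : left_id szero sadd.
Proof. by move=> *; apply: subsp_inj; exact: add0r. Qed.
Fact subsp_addN : left_inverse szero sopp sadd.
Proof. by move=> *; apply: subsp_inj; exact: addNr. Qed.
HB.instance Definition _ :=
  GRing.isZmodule.Build subsp subsp_addA subsp_addC subsp_add0 subsp_addN.

Fact subsp_scaleA a b u : sscale a (sscale b u) = sscale (a * b) u.
Proof. by apply: subsp_inj; exact: scalerA. Qed.
Fact subsp_scale1 : left_id 1 sscale.
Proof. by move=> *; apply: subsp_inj; exact: scale1r. Qed.
Fact subsp_scaleDr : right_distributive sscale +%R.
Proof. by move=> *; apply: subsp_inj; exact: scalerDr. Qed.
Fact subsp_scaleDl u : {morph sscale^~ u : a b / a + b}.
Proof. by move=> *; apply: subsp_inj; exact: scalerDl. Qed.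
HB.instance Definition _ := GRing.Zmodule_isLmodule.Build K subsp
  subsp_scaleA subsp_scale1 subsp_scaleDr subsp_scaleDl.

Lemma subsp_val_lin a (u v : subsp) :
  subsp_val (a *: u + v) = a *: subsp_val u + subsp_val v.
Proof. by []. Qed.

End Subspace.

Section Tensor.
Variables (K : fieldType) (V W : lmodType K).

(* V (x) W is the set of finite formal sums of pairs (v, w), as sequences,
   modulo the congruence generated by reordering and the bilinear relations. *)
Inductive teq : seq (V * W) -> seq (V * W) -> Prop :=
| teq_perm l m of perm_eq l m : teq l m
| teq_sym l m of teq l m : teq m l
| teq_trans l m n of teq l m & teq m n : teq l n
| teq_cons p l m of teq l m : teq (p :: l) (p :: m)
| teq_Dl v v' w l : teq ((v + v', w) :: l) [:: (v, w), (v', w) & l]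
| teq_Dr v w w' l : teq ((v, w + w') :: l) [:: (v, w), (v, w') & l]
| teq_Z a v w l : teq ((a *: v, w) :: l) ((v, a *: w) :: l)
| teq_0 w l : teq ((0, w) :: l) l.

Lemma teq_refl l : teq l l. Proof. exact: teq_perm. Qed.

Definition teqb l m := `[< teq l m >].

Fact teqb_refl : reflexive teqb.
Proof. by move=> l; apply/asboolP; exact: teq_refl. Qed.
Fact teqb_sym : symmetric teqb.
Proof. by move=> l m; apply/asboolP/asboolP; exact: teq_sym. Qed.
Fact teqb_trans : transitive teqb.
Proof. by move=> m l n /asboolP lm /asboolP mn; apply/asboolP; exact: teq_trans lm mn. Qed.

Canonical teq_equiv := EquivRel teqb teqb_refl teqb_sym teqb_trans.

Definition tens := {eq_quot teq_equiv}%qT.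

HB.instance Definition _ := Choice.on tens.

Definition tcl (l : seq (V * W)) : tens := (\pi_tens l)%qT.

Lemma tclP l m : tcl l = tcl m <-> teq l m.
Proof.
split; first by move/eqmodP/asboolP.
by move=> lm; apply/eqmodP/asboolP.
Qed.

Lemma tcl_repr u : tcl (repr u) = u. Proof. exact: reprK. Qed.

Lemma teq_cat l m l' m' : teq l m -> teq l' m' -> teq (l ++ l') (m ++ m').
Proof.
have catl n a b : teq a b -> teq (n ++ a) (n ++ b).
  by move=> ab; elim: n => //= p n; exact: teq_cons.
move=> lm lm'; apply: (teq_trans (catl l _ _ lm')).
apply: (teq_trans (teq_perm _)); first by rewrite perm_catC.
apply: (teq_trans (catl m' _ _ lm)).
by apply: teq_perm; rewrite perm_catC.
Qed.

Definition mapl (f : V -> V) : seq (V * W) -> seq (V * W) :=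
  map (fun p => (f p.1, p.2)).

Lemma teq_mapl a l m : teq l m -> teq (mapl ( *:%R a) l) (mapl ( *:%R a) m).
Proof.
elim=> {l m} /=.
- by move=> l m lm; apply: teq_perm; exact: perm_map.
- by move=> l m _; exact: teq_sym.
- by move=> l m n _ lm _; exact: teq_trans.
- by move=> p l m _; exact: teq_cons.
- by move=> v v' w l; rewrite scalerDr; exact: teq_Dl.
- by move=> v w w' l; exact: teq_Dr.
- by move=> b v w l; rewrite scalerA mulrC -scalerA; exact: teq_Z.
- by move=> w l; rewrite scaler0; exact: teq_0.
Qed.

Let tadd (u v : tens) := tcl (repr u ++ repr v).
Let tscale (a : K) (u : tens) := tcl (mapl ( *:%R a) (repr u)).
Let tzero := tcl [::].
Let topp (u : tens) := tscale (-1) u.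

Lemma teq_repr l : teq (repr (tcl l)) l.
Proof. by apply/tclP; rewrite tcl_repr. Qed.

Let taddE l m : tadd (tcl l) (tcl m) = tcl (l ++ m).
Proof. by apply/tclP/teq_cat; exact: teq_repr. Qed.

Let tscaleE a l : tscale a (tcl l) = tcl (mapl ( *:%R a) l).
Proof. by apply/tclP/teq_mapl; exact: teq_repr. Qed.

Lemma tensW (P : tens -> Prop) : (forall l, P (tcl l)) -> forall u, P u.
Proof. by move=> Pl u; rewrite -[u]tcl_repr. Qed.

Fact tens_addA : associative tadd.
Proof.
elim/tensW=> l; elim/tensW=> m; elim/tensW=> n.
by rewrite !taddE catA.
Qed.
Fact tens_addC : commutative tadd.
Proof.
elim/tensW=> l; elim/tensW=> m; rewrite !taddE.
by apply/tclP/teq_perm; rewrite perm_catC.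
Qed.
Fact tens_add0 : left_id tzero tadd.
Proof. by elim/tensW=> l; rewrite taddE. Qed.
Fact tens_scaleDl u a b : tscale (a + b) u = tadd (tscale a u) (tscale b u).
Proof.
elim/tensW: u => l; rewrite !tscaleE taddE; apply/tclP.
elim: l => [|[v w] l IH] /=; first exact: teq_refl.
rewrite scalerDl; apply: (teq_trans (teq_Dl _ _ _ _)); apply: teq_cons.
apply: (teq_trans (teq_cons _ IH)); apply: teq_perm.
by rewrite -[X in perm_eq X _]cat1s -[X in perm_eq _ (_ ++ X)]cat1s perm_catCA.
Qed.
Fact tens_scale0 u : tscale 0 u = tzero.
Proof.
elim/tensW: u => l; rewrite tscaleE; apply/tclP.
elim: l => [|[v w] l IH] /=; first exact: teq_refl.
by rewrite scale0r; exact: (teq_trans (teq_0 _ _)).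
Qed.
Fact tens_scale1 : left_id 1 tscale.
Proof.
elim/tensW=> l; rewrite tscaleE /mapl; congr tcl.
by rewrite -[RHS]map_id; apply: eq_map => -[v w] /=; rewrite scale1r.
Qed.
Fact tens_addN : left_inverse tzero topp tadd.
Proof. by move=> u; rewrite -{2}[u]tens_scale1 -tens_scaleDl addNr tens_scale0. Qed.
HB.instance Definition _ :=
  GRing.isZmodule.Build tens tens_addA tens_addC tens_add0 tens_addN.

Fact tens_scaleA a b u : tscale a (tscale b u) = tscale (a * b) u.
Proof.
elim/tensW: u => l; rewrite !tscaleE /mapl -map_comp; congr tcl.
by apply: eq_map => -[v w] /=; rewrite scalerA.
Qed.
Fact tens_scaleDr : right_distributive tscale +%R.
Proof.
move=> a; elim/tensW=> l; elim/tensW=> m.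
have addE u v : u + v = tadd u v by [].
by rewrite !addE taddE !tscaleE taddE /mapl map_cat.
Qed.
HB.instance Definition _ := GRing.Zmodule_isLmodule.Build K tens
  tens_scaleA tens_scale1 tens_scaleDr (fun u a b => tens_scaleDl u a b).

Definition pure (v : V) (w : W) : tens := tcl [:: (v, w)].

Lemma tclE l : tcl l = \sum_(p <- l) pure p.1 p.2.
Proof.
elim: l => [|[v w] l IH]; first by rewrite big_nil.
rewrite big_cons -IH /pure -[RHS]/(tadd _ _) taddE.
by [].
Qed.

Lemma scale_tcl a l : a *: tcl l = tcl (mapl ( *:%R a) l).
Proof. exact: tscaleE. Qed.

Lemma pureZl a v w : pure (a *: v) w = a *: pure v w.
Proof. by rewrite scale_tcl. Qed.

End Tensor.

(* A sheaf of K-modules as an etale space: the family of its stalks, together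
   with the predicate [regular s x], "the (possibly discontinuous) family of
   germs s is a section of the sheaf on some neighbourhood of x".  The sections
   over an open U are the families regular at every point of U, identified when
   they agree on U.  [regular_germ]: every germ comes from a local section;
   [regular_sep]: two sections with the same germ at x agree near x. *)
Record sheaf (K : fieldType) (X : topologicalType) := Sheaf {
  stalk :> X -> lmodType K;
  regular : (forall x, stalk x) -> X -> Prop;
  regular_near : forall s x, regular s x -> \forall y \near x, regular s y;
  regular_local : forall s t x,
    (\forall y \near x, s y = t y) -> regular s x -> regular t x;
  regular_lin : forall a s t x, regular s x -> regular t x ->
    regular (fun y => a *: s y + t y) x;
  regular_germ : forall x v, exists2 s, regular s x & s x = v;
  regular_sep : forall s t x, regular s x -> regular t x -> s x = t x ->
    \forall y \near x, s y = t y
}.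

Section SheafTheory.
Variables (K : fieldType) (X : topologicalType) (F : sheaf K X).

Lemma regular_cst0 x : regular (fun y => 0 : F y) x.
Proof.
have [s sx _] := regular_germ (0 : F x).
apply: regular_local (regular_lin (-1) sx sx).
by apply: nearW => y; rewrite scaleN1r addNr.
Qed.

Lemma regularZ a (s : forall x, F x) x :
  regular s x -> regular (fun y => a *: s y) x.
Proof.
move=> sx; apply: regular_local (regular_lin a sx (regular_cst0 x)).
by apply: nearW => y; rewrite addr0.
Qed.

Lemma regularD (s t : forall x, F x) x :
  regular s x -> regular t x -> regular (fun y => s y + t y) x.
Proof.
move=> sx tx; apply: regular_local (regular_lin 1 sx tx).
by apply: nearW => y; rewrite scale1r.
Qed.

End SheafTheory.

(* A morphism of sheaves is a family of linear maps on stalks that sends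
   sections to sections; it is a mono/isomorphism iff it is so on stalks. *)
Record hom (K : fieldType) (X : topologicalType) (F G : sheaf K X) := Hom {
  hom_fun :> forall x, F x -> G x;
  hom_lin : forall x, linear (@hom_fun x);
  hom_reg : forall (s : forall x, F x) x,
    regular s x -> regular (fun y => hom_fun (s y)) x
}.
Arguments hom_fun {K X F G} _ x _.

Section HomTheory.
Variables (K : fieldType) (X : topologicalType) (F G : sheaf K X).

Lemma hom0 (f : hom F G) x : f x 0 = 0.
Proof. by have := hom_lin f (-1) 0 (0 : F x); rewrite !scaleN1r oppr0 addr0 addNr. Qed.

Fact zero_hom_lin x : linear (fun _ : F x => 0 : G x).
Proof. by move=> a u v; rewrite scaler0 addr0. Qed.
Definition zero_hom : hom F G :=
  Hom zero_hom_lin (fun _ x _ => regular_cst0 G x).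

Fact opp_hom_lin (f : hom F G) x : linear (fun v => - f x v).
Proof. by move=> a u v; rewrite hom_lin opprD scalerN. Qed.
Fact opp_hom_reg (f : hom F G) (s : forall x, F x) x :
  regular s x -> regular (fun y => - f y (s y)) x.
Proof.
move=> /(hom_reg f)/(regularZ (-1)); apply: regular_local.
by apply: nearW => y; rewrite scaleN1r.
Qed.
Definition opp_hom (f : hom F G) : hom F G :=
  Hom (opp_hom_lin f) (@opp_hom_reg f).

Definition is_mono (f : hom F G) := forall x, injective (f x).
Definition is_iso (f : hom F G) := forall x, bijective (f x).

End HomTheory.

Definition locally_closed (X : topologicalType) (Z : set X) :=
  exists U C, [/\ open U, closed C & Z = U `&` C].

(* k_Z for a locally closed Z, extended by zero: the stalk is K on Z and 0
   outside.  Near a point x outside Z, [cst_regular] says that s vanishes. *)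
Section ConstantSheaf.
Variables (K : fieldType) (X : topologicalType) (Z : set X).
Hypothesis lcZ : locally_closed Z.

Fact cst_space0 x : ~ Z x -> (0 : K^o) = 0. Proof. by []. Qed.
Fact cst_spaceP x a (u v : K^o) : (~ Z x -> u = 0) -> (~ Z x -> v = 0) ->
  ~ Z x -> a *: u + v = 0.
Proof. by move=> + + nZ => -> // -> //; rewrite scaler0 addr0. Qed.
Definition cst_space x : subspace K^o := Subspace (@cst_space0 x) (@cst_spaceP x).
Definition cst_stalk x := subsp (cst_space x).

Definition cst_regular (s : forall x, cst_stalk x) x :=
  \forall y \near x, Z y -> subsp_val (s y) = subsp_val (s x).

Fact cst_near s x : cst_regular s x -> \forall y \near x, cst_regular s y.
Proof.
have [U [C [oU cC ZE]]] := lcZ.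
have ZP z : Z z <-> U z /\ C z by rewrite [in Z z]ZE.
move=> sx; have [Zx|nZx] := pselect (Z x).
  have Ux : nbhs x U by apply: open_nbhs_nbhs; split=> //; case/ZP: Zx.
  near=> y; have [Zy|nZy] := pselect (Z y).
    have sy : subsp_val (s y) = subsp_val (s x) by move: Zy; near: y.
    have : nbhs y [set z | Z z -> subsp_val (s z) = subsp_val (s x)].
      by near: y; exact: nbhs_interior.
    by apply: filterS => z /= + Zz; rewrite sy; exact.
  have Uy : U y by near: y.
  have nCy : nbhs y (~` C).
    apply: open_nbhs_nbhs; split; first exact: closed_openC.
    by move=> Cy; apply/nZy/ZP.
  by apply: filterS nCy => z nCz /ZP[].
have s0 y : ~ Z y -> subsp_val (s y) = 0 by move=> nZ; exact: (subsp_valP (s y) nZ).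
near=> y.
have sy : subsp_val (s y) = 0.
  have [Zy|/s0//] := pselect (Z y).
  by rewrite -(s0 _ nZx); move: Zy; near: y.
have : nbhs y [set z | Z z -> subsp_val (s z) = subsp_val (s x)].
  by near: y; exact: nbhs_interior.
by apply: filterS => z /= + Zz; rewrite sy -(s0 _ nZx); exact.
Unshelve. all: by end_near. Qed.

Fact cst_local s t x : (\forall y \near x, s y = t y) ->
  cst_regular s x -> cst_regular t x.
Proof.
move=> st; rewrite /cst_regular -(nbhs_singleton st) => sx.
by near=> y => Zy; rewrite -(near st y)//; move: Zy; near: y.
Unshelve. all: by end_near. Qed.

Fact cst_lin a s t x : cst_regular s x -> cst_regular t x ->
  cst_regular (fun y => a *: s y + t y) x.
Proof. by apply: filterS2 => y sy ty Zy /=; rewrite sy // ty. Qed.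

Fact cst_fill_subproof (c : K^o) y : ~ Z y -> (if `[< Z y >] then c else 0) = 0.
Proof. by move=> /asboolPn/negbTE ->. Qed.
Definition cst_fill (c : K^o) y : cst_stalk y :=
  @Subsp _ _ (cst_space y) _ (@cst_fill_subproof c y).

Fact cst_germ x v : exists2 s, cst_regular s x & s x = v.
Proof.
exists (cst_fill (subsp_val v)).
  have [Zx|nZx] := pselect (Z x).
    by apply: nearW => y Zy /=; rewrite !asboolT.
  by apply: nearW => y Zy /=; rewrite [subsp_val v](subsp_valP v nZx) !if_same.
apply: subsp_inj => /=; have [Zx|nZx] := pselect (Z x).
  by rewrite asboolT.
by rewrite asboolF // [RHS](subsp_valP v nZx).
Qed.

Fact cst_sep s t x : cst_regular s x -> cst_regular t x -> s x = t x ->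
  \forall y \near x, s y = t y.
Proof.
move=> + + st; apply: filterS2 => y sy ty; apply: subsp_inj.
have [Zy|nZy] := pselect (Z y); first by rewrite sy // ty // st.
by rewrite [LHS](subsp_valP (s y) nZy) [RHS](subsp_valP (t y) nZy).
Qed.

Definition cst_sheaf : sheaf K X :=
  Sheaf cst_near cst_local cst_lin cst_germ cst_sep.

End ConstantSheaf.

Section InverseImage.
Variables (K : fieldType) (X Y : topologicalType) (f : X -> Y).
Hypothesis cf : continuous f.
Variable F : sheaf K Y.

Definition inv_regular (s : forall x, F (f x)) x :=
  exists2 t : forall y, F y, regular t (f x) & \forall x' \near x, s x' = t (f x').

Fact inv_near s x : inv_regular s x -> \forall y \near x, inv_regular s y.
Proof.
case=> t tx st; near=> y; exists t.
  by near: y; apply: cf; exact: regular_near.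
by near: y; exact: nbhs_interior.
Unshelve. all: by end_near. Qed.

Fact inv_local s t x : (\forall y \near x, s y = t y) ->
  inv_regular s x -> inv_regular t x.
Proof.
move=> st [u ux su]; exists u => //.
by apply: filterS2 st su => y ->.
Qed.

Fact inv_lin a s t x : inv_regular s x -> inv_regular t x ->
  inv_regular (fun y => a *: s y + t y) x.
Proof.
move=> [u ux su] [v vx tv]; exists (fun y => a *: u y + v y); first exact: regular_lin.
by apply: filterS2 su tv => y -> ->.
Qed.

Fact inv_germ x v : exists2 s, inv_regular s x & s x = v.
Proof.
have [t tx <-] := regular_germ v; exists (fun x => t (f x)) => //.
by exists t => //; exact: nearW.
Qed.

Fact inv_sep s t x : inv_regular s x -> inv_regular t x -> s x = t x ->
  \forall y \near x, s y = t y.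
Proof.
move=> [u ux su] [v vx tv].
rewrite (nbhs_singleton su) (nbhs_singleton tv) => uv.
have := cf (regular_sep ux vx uv).
by apply: filterS3 su tv => y -> ->.
Qed.

Definition inv_sheaf : sheaf K X :=
  @Sheaf K X (fun x => F (f x)) inv_regular inv_near inv_local inv_lin inv_germ inv_sep.

End InverseImage.

Section DirectSum.
Variables (K : fieldType) (X : topologicalType) (n : nat).
Variable F : 'I_n -> sheaf K X.

Definition sum_stalk x := dprod (fun i => F i x).
Definition sum_regular (s : forall x, sum_stalk x) x :=
  forall i, regular (fun y => s y i) x.

Fact sum_near s x : sum_regular s x -> \forall y \near x, sum_regular s y.
Proof.
move=> sx.
have : \forall y \near x, forall i, regular (fun y => s y i) y.
  by apply: filter_forall => i; apply: filterS (regular_near (sx i)).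
by apply: filterS => y + i; exact.
Qed.

Fact sum_local s t x : (\forall y \near x, s y = t y) ->
  sum_regular s x -> sum_regular t x.
Proof. by move=> st sx i; apply: regular_local (sx i); apply: filterS st => y ->. Qed.

Fact sum_lin a s t x : sum_regular s x -> sum_regular t x ->
  sum_regular (fun y => a *: s y + t y) x.
Proof. by move=> sx tx i; exact: (regular_lin a (sx i) (tx i)). Qed.

Fact sum_germ x v : exists2 s, sum_regular s x & s x = v.
Proof.
have sP i : {s : forall y, F i y | regular s x /\ s x = v i}.
  apply: cid; by have [s] := regular_germ (v i); exists s.
exists (fun y i => projT1 (sP i) y); first by move=> i; case: (projT2 (sP i)).
by apply: functional_extensionality_dep => i; case: (projT2 (sP i)).
Qed.

Fact sum_sep s t x : sum_regular s x -> sum_regular t x -> s x = t x ->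
  \forall y \near x, s y = t y.
Proof.
move=> sx tx st.
have : \forall y \near x, forall i, s y i = t y i.
  by apply: filter_forall => i; apply: filterS (regular_sep (sx i) (tx i) _) => //; rewrite st.
by apply: filterS => y sty; apply: functional_extensionality_dep => i; exact: sty.
Qed.

Definition sum_sheaf : sheaf K X :=
  @Sheaf K X sum_stalk sum_regular sum_near sum_local sum_lin sum_germ sum_sep.

End DirectSum.

Section TensorSheaf.
Variables (K : fieldType) (X : topologicalType) (F G : sheaf K X).

Let sections := (dprod F * dprod G)%type.

Definition tens_stalk x := tens (F x) (G x).

Definition tens_regular (s : forall x, tens_stalk x) x :=
  exists2 L : seq (dprod F * dprod G),
    forall p, p \in L -> regular p.1 x /\ regular p.2 x
    & \forall y \near x, s y = \sum_(p <- L) pure (p.1 y) (p.2 y).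

Let regs (L : seq sections) x :=
  forall p, p \in L -> regular p.1 x /\ regular p.2 x.
Let ev y (L : seq sections) := [seq (p.1 y, p.2 y) | p <- L].

Let evE y L : \sum_(p <- L) pure (p.1 y) (p.2 y) = tcl (ev y L).
Proof. by rewrite tclE big_map. Qed.

Let regs_cons p L x : regs (p :: L) x ->
  [/\ regular p.1 x, regular p.2 x & regs L x].
Proof.
move=> pL; have [] := pL p; rewrite ?mem_head // => p1 p2; split=> // q qL.
by apply: pL; rewrite inE qL orbT.
Qed.

Let cons_regs p L x : regular p.1 x -> regular p.2 x -> regs L x -> regs (p :: L) x.
Proof. by move=> p1 p2 Lx q; rewrite inE => /orP[/eqP->//|/Lx]. Qed.

Let cat_regs L M x : regs L x -> regs M x -> regs (L ++ M) x.
Proof. by move=> Lx Mx q; rewrite mem_cat => /orP[/Lx|/Mx]. Qed.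

Let lift x (l : seq (F x * G x)) : exists2 L, regs L x & ev x L = l.
Proof.
elim: l => [|[v w] l [L Lx <-]]; first by exists [::].
have [s sx <-] := regular_germ v; have [t tx <-] := regular_germ w.
by exists ((s, t) :: L) => //; exact: cons_regs.
Qed.

Let ev_near x L M : regs L x -> regs M x -> ev x L = ev x M ->
  \forall y \near x, ev y L = ev y M.
Proof.
elim: L M => [|p L IH] [|q M] //=; first by move=> *; exact: nearW.
move=> /regs_cons[p1 p2 Lx] /regs_cons[q1 q2 Mx] [e1 e2 /(IH _ Lx Mx)].
apply: filterS3 (regular_sep p1 q1 e1) (regular_sep p2 q2 e2).
by move=> y -> -> ->.
Qed.

Let teq_near x (l m : seq (F x * G x)) : teq l m ->
  forall L M, regs L x -> regs M x -> ev x L = l -> ev x M = m ->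
  \forall y \near x, teq (ev y L) (ev y M).
Proof.
elim=> {l m}.
- move=> l m lm L M Lx Mx; case: M Mx => [|p0 M] Mx el em.
    move: lm; rewrite -em => /perm_nilP l0; move: el; rewrite l0.
    by case: L Lx => // _ _; apply: nearW => y; exact: teq_refl.
  set M0 := p0 :: M in Mx em *.
  move: lm; rewrite -em -el => /(perm_iotaP (p0.1 x, p0.2 x))[I PI eI].
  rewrite size_map in PI.
  pose M' := map (nth p0 M0) I.
  have PM : perm_eq M' M0.
    by rewrite (perm_trans (perm_map _ PI))// map_nth_iota0// take_size.
  have M'x : regs M' x by move=> q; rewrite (perm_mem PM); exact: Mx.
  have e : ev x L = ev x M'.
    rewrite eI /M' /ev -map_comp; apply/eq_in_map => i iI /=.
    have iM : (i < size M0)%N by move: iI; rewrite (perm_mem PI) mem_iota.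
    exact: (nth_map p0 (p0.1 x, p0.2 x) (fun p : sections => (p.1 x, p.2 x)) iM).
  apply: filterS (ev_near Lx M'x e) => y ->.
  by apply: teq_perm; exact: perm_map.
- move=> l m _ IH L M Lx Mx el em.
  by apply: filterS (IH M L Mx Lx em el) => y; exact: teq_sym.
- move=> l m n _ IHl _ IHm L N Lx Nx el en.
  have [M Mx em] := lift m.
  apply: filterS2 (IHl L M Lx Mx el em) (IHm M N Mx Nx em en) => y.
  exact: teq_trans.
- move=> p0 l m _ IH [|p L]// [|q M]// /regs_cons[p1 p2 Lx].
  move=> /regs_cons[q1 q2 Mx] [<- el] [e1 e2 em].
  apply: filterS3 (regular_sep q1 p1 e1) (regular_sep q2 p2 e2) (IH L M Lx Mx el em).
  by move=> y /= -> -> ?; exact: teq_cons.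
- move=> v v' w l [|p L]// [|q [|q' M]]// /regs_cons[p1 p2 Lx].
  move=> /regs_cons[q1 q2 /regs_cons[q1' q2' Mx]] [e1 e2 el] [d1 d2 d1' d2' em].
  have := ev_near Lx Mx; rewrite el em => /(_ erefl) nLM.
  have n1 : \forall y \near x, p.1 y = q.1 y + q'.1 y.
    by apply: (regular_sep p1 (regularD q1 q1')); rewrite e1 d1 d1'.
  have n2 : \forall y \near x, p.2 y = q.2 y /\ q'.2 y = q.2 y.
    have epq : p.2 x = q.2 x by rewrite e2 d2.
    have eqq : q'.2 x = q.2 x by rewrite d2' d2.
    apply: filterS2 (regular_sep p2 q2 epq) (regular_sep q2' q2 eqq).
    by move=> y -> ->.
  apply: filterS3 n1 n2 nLM => y /= -> [-> ->] ->.
  exact: teq_Dl.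
- move=> v w w' l [|p L]// [|q [|q' M]]// /regs_cons[p1 p2 Lx].
  move=> /regs_cons[q1 q2 /regs_cons[q1' q2' Mx]] [e1 e2 el] [d1 d2 d1' d2' em].
  have := ev_near Lx Mx; rewrite el em => /(_ erefl) nLM.
  have n1 : \forall y \near x, p.2 y = q.2 y + q'.2 y.
    by apply: (regular_sep p2 (regularD q2 q2')); rewrite e2 d2 d2'.
  have n2 : \forall y \near x, p.1 y = q.1 y /\ q'.1 y = q.1 y.
    have epq : p.1 x = q.1 x by rewrite e1 d1.
    have eqq : q'.1 x = q.1 x by rewrite d1' d1.
    apply: filterS2 (regular_sep p1 q1 epq) (regular_sep q1' q1 eqq).
    by move=> y -> ->.
  apply: filterS3 n1 n2 nLM => y /= -> [-> ->] ->.
  exact: teq_Dr.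
- move=> a v w l [|p L]// [|q M]// /regs_cons[p1 p2 Lx].
  move=> /regs_cons[q1 q2 Mx] [e1 e2 el] [d1 d2 em].
  have := ev_near Lx Mx; rewrite el em => /(_ erefl) nLM.
  have n1 : \forall y \near x, p.1 y = a *: q.1 y.
    by apply: (regular_sep p1 (regularZ a q1)); rewrite e1 d1.
  have n2 : \forall y \near x, q.2 y = a *: p.2 y.
    by apply: (regular_sep q2 (regularZ a p2)); rewrite e2 d2.
  apply: filterS3 n1 n2 nLM => y /= -> -> ->.
  exact: teq_Z.
- move=> w l [|p L]// M /regs_cons[p1 p2 Lx] Mx [e1 e2 el] em.
  have := ev_near Lx Mx; rewrite el em => /(_ erefl).
  apply: filterS2 (regular_sep p1 (regular_cst0 F x) e1) => y /= -> ->.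
  exact: teq_0.
Qed.

Fact tens_near s x : tens_regular s x -> \forall y \near x, tens_regular s y.
Proof.
case=> L Lx sL.
have nL : \forall y \near x, regs L y.
  elim: L Lx {sL} => [|p L IH]; first by move=> _; exact: nearW.
  move=> /regs_cons[p1 p2 /IH].
  apply: filterS3 (regular_near p1) (regular_near p2) => y.
  exact: cons_regs.
near=> y; exists L; first by near: y.
by near: y; exact: nbhs_interior.
Unshelve. all: by end_near. Qed.

Fact tens_local s t x : (\forall y \near x, s y = t y) ->
  tens_regular s x -> tens_regular t x.
Proof.
by move=> st [L Lx sL]; exists L => //; apply: filterS2 st sL => y ->.
Qed.

Fact tens_lin a s t x : tens_regular s x -> tens_regular t x ->
  tens_regular (fun y => a *: s y + t y) x.
Proof.
move=> [L Lx sL] [M Mx tM].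
pose aL := [seq ((a *: p.1 : dprod F), p.2) | p <- L].
exists (aL ++ M).
  apply: cat_regs => // _ /mapP[p /Lx[p1 p2] ->]; split=> //.
  exact: regularZ.
apply: filterS2 sL tM => y -> ->.
rewrite big_cat big_map scaler_sumr; congr (_ + _).
by apply: eq_bigr => p _; rewrite -pureZl.
Qed.

Fact tens_germ x v : exists2 s, tens_regular s x & s x = v.
Proof.
elim/tensW: v => l; have [L Lx <-] := lift l.
exists (fun y => tcl (ev y L)) => //; exists L => //.
by apply: nearW => y; rewrite evE.
Qed.

Fact tens_sep s t x : tens_regular s x -> tens_regular t x -> s x = t x ->
  \forall y \near x, s y = t y.
Proof.
move=> [L Lx sL] [M Mx tM].
rewrite (nbhs_singleton sL) (nbhs_singleton tM) !evE => /tclP LM.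
apply: filterS3 sL tM (teq_near LM Lx Mx erefl erefl) => y -> ->.
by rewrite !evE => /tclP.
Qed.

Definition tens_sheaf : sheaf K X :=
  @Sheaf K X tens_stalk tens_regular tens_near tens_local tens_lin tens_germ tens_sep.

End TensorSheaf.

Section ProperOver.
Variables (X Y : topologicalType) (f : X -> Y).

(* The restriction B -> V of f is proper, i.e. closed with compact fibres, for
   B contained in f^-1(V). *)
Definition proper_over (V : set Y) (B : set X) :=
  (forall A, closed A -> forall y, V y -> ~ (f @` (A `&` B)) y ->
     \forall y' \near y, V y' -> ~ (f @` (A `&` B)) y') /\
  (forall y, V y -> compact (B `&` f @^-1` [set y])).

Lemma proper_over_sub (V V' : set Y) (B C D : set X) :
  open V' -> V' `<=` V -> proper_over V B -> proper_over V C ->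
  (forall x, D x -> V' (f x) /\ (B `|` C) x) ->
  (forall x, V' (f x) -> ~ D x -> \forall x' \near x, ~ D x') ->
  proper_over V' D.
Proof.
move=> oV' V'V [Bcl Bco] [Ccl Cco] DBC clD; split.
  move=> A cA y V'y nADy.
  have sub E : proper_over V E ->
      \forall y' \near y, V y' -> ~ (f @` (closure (A `&` D `&` E) `&` E)) y'.
    move=> [Ecl _]; apply: Ecl; [exact: closed_closure|exact: V'V|].
    move=> [x [cx Ex] fxy]; apply: nADy; exists x => //.
    have Ax : A x by apply: cA; move: cx; apply: closureS => z [[]].
    split=> //; apply: contrapT => nDx.
    have V'x : V' (f x) by rewrite fxy.
    have [z [[[_ Dz] _] nDz]] := cx _ (clD _ V'x nDx).
    exact: nDz.
  have nB := sub B (conj Bcl Bco); have nC := sub C (conj Ccl Cco).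
  apply: filterS2 nB nC => y' nB nC V'y' [x [Ax Dx] fx].
  have [_ [Bx|Cx]] := DBC _ Dx.
  - apply: (nB (V'V _ V'y')); exists x => //; split=> //.
    exact: subset_closure.
  - apply: (nC (V'V _ V'y')); exists x => //; split=> //.
    exact: subset_closure.
move=> y V'y G PG GD.
have Vy := V'V _ V'y.
have : compact ((B `&` f @^-1` [set y]) `|` (C `&` f @^-1` [set y])).
  by apply: compactU; [exact: Bco|exact: Cco].
move=> /(_ G PG)[|x [BCx Gx]].
  by apply: filterS GD => x [/DBC[_ [Bx|Cx]] fx]; [left|right].
have fx : f x = y by case: BCx => -[].
exists x; split=> //; split=> //; apply: contrapT => nDx.
have V'x : V' (f x) by rewrite fx.
by have [z [[Dz _] nDz]] := Gx _ _ GD (clD _ V'x nDx).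
Qed.

End ProperOver.

Section ShriekSheaf.
Variables (K : fieldType) (X Y : topologicalType) (f : X -> Y).

(* s is a section of F over f^-1(V) whose support is proper over V.  As the
   support of a section is the set where its germ is nonzero, no closure is
   needed. *)
Definition proper_section (F : sheaf K X) (V : set Y) (s : dprod F) :=
  (forall x, V (f x) -> regular s x) /\
  proper_over f V [set x | V (f x) /\ s x <> 0].

Lemma proper_section_sub (F G : sheaf K X) (V V' : set Y)
    (s t : dprod F) (u : dprod G) :
  open V' -> V' `<=` V -> proper_section V s -> proper_section V t ->
  (forall x, V' (f x) -> regular u x) ->
  (forall x, V' (f x) -> s x = 0 -> t x = 0 -> u x = 0) ->
  proper_section V' u.
Proof.
move=> oV' V'V [sr sp] [tr tp] ur stu; split=> //.
apply: (proper_over_sub oV' V'V sp tp) => x.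
  move=> [V'x ux]; split=> //.
  have [sx|sx] := pselect (s x = 0); last by left; split=> //; exact: V'V.
  have [tx|tx] := pselect (t x = 0); last by right; split=> //; exact: V'V.
  by case: ux; exact: stu.
move=> V'x nux; have ux : u x = 0 by apply: contrapT => ux; exact: nux.
apply: filterS (regular_sep (ur x V'x) (regular_cst0 G x) ux).
by move=> z uz [].
Qed.

Variable F : sheaf K X.

Lemma proper_section0 V : open V -> proper_section V (0 : dprod F).
Proof.
move=> oV; have E : [set x | V (f x) /\ (0 : dprod F) x <> 0] = set0.
  by apply/seteqP; split=> // x [].
split; first by move=> x _; exact: regular_cst0.
rewrite E; split.
  by move=> A _ y _ _; apply: nearW => y' _; rewrite setI0 image_set0.
by move=> y _; rewrite set0I; exact: compact0.
Qed.

Lemma proper_section_lin V V' a (s t : dprod F) : open V -> open V' ->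
  proper_section V s -> proper_section V' t ->
  proper_section (V `&` V') (a *: s + t).
Proof.
move=> oV oV' sP tP; have oW := openI oV oV'.
have sW : proper_section (V `&` V') s.
  apply: (proper_section_sub oW (@subIsetl _ _ _) sP sP) => // x [Vx _].
  exact: sP.1.
have tW : proper_section (V `&` V') t.
  apply: (proper_section_sub oW (@subIsetr _ _ _) tP tP) => // x [_ Vx].
  exact: tP.1.
apply: (proper_section_sub oW _ sW tW) => // x Wx.
  by apply: regular_lin; [exact: sW.1|exact: tW.1].
move=> sx tx; rewrite -[LHS]/(a *: s x + t x) sx tx.
by rewrite scaler0 addr0.
Qed.

(* The germ at y of a properly supported section s of F is determined by the
   restriction of s to f^-1(y), because supp(s) -> V is closed; so the stalk of
   f_! F at y (the colimit over V of the properly supported sections over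
   f^-1(V)) is realised as the space of these restrictions. *)
Definition on_fiber (s : dprod F) (y : Y) : dprod F :=
  fun x => if `[< f x = y >] then s x else 0.

Definition shriek_in y (u : dprod F) := exists V s,
  [/\ open V, V y, proper_section V s & u = on_fiber s y].

Fact shriek_in0 y : shriek_in y 0.
Proof.
exists setT, 0; split=> //; [exact: openT|exact/proper_section0/openT|].
by apply: functional_extensionality_dep => x; rewrite /on_fiber if_same.
Qed.

Fact shriek_in_lin y a u v : shriek_in y u -> shriek_in y v ->
  shriek_in y (a *: u + v).
Proof.
move=> [V [s [oV Vy sV ->]]] [V' [t [oV' V'y tV' ->]]].
exists (V `&` V'), (a *: s + t); split=> //; first exact: openI.
  exact: proper_section_lin.
apply: functional_extensionality_dep => x.
rewrite /on_fiber -[LHS]/(a *: (if _ then _ else _) + (if _ then _ else _)).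
by case: ifP => // _; rewrite scaler0 addr0.
Qed.

Definition shriek_space y : subspace (dprod F) :=
  Subspace (shriek_in0 y) (@shriek_in_lin y).
Definition shriek_stalk y := subsp (shriek_space y).

Definition shriek_regular (t : forall y, shriek_stalk y) y := exists V s,
  [/\ open V, V y, proper_section V s &
      forall y', V y' -> subsp_val (t y') = on_fiber s y'].

Fact shriek_near t y : shriek_regular t y -> \forall y' \near y, shriek_regular t y'.
Proof.
move=> [V [s [oV Vy sV tV]]].
have : nbhs y V by exact: open_nbhs_nbhs.
by apply: filterS => y' Vy'; exists V, s.
Qed.

Fact shriek_local t t' y : (\forall y' \near y, t y' = t' y') ->
  shriek_regular t y -> shriek_regular t' y.
Proof.
rewrite /prop_near1 nbhsE => -[W [oW Wy] tt'] [V [s [oV Vy sV tV]]].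
have oWV := openI oW oV.
exists (W `&` V), s; split=> //.
  apply: (proper_section_sub oWV (@subIsetr _ _ _) sV sV) => // x [_ Vx].
  exact: sV.1.
by move=> y' [Wy' Vy']; rewrite -tt' // tV.
Qed.

Fact shriek_lin a t t' y : shriek_regular t y -> shriek_regular t' y ->
  shriek_regular (fun y => a *: t y + t' y) y.
Proof.
move=> [V [s [oV Vy sV tV]]] [V' [s' [oV' V'y sV' tV']]].
exists (V `&` V'), (a *: s + s'); split=> //; first exact: openI.
  exact: proper_section_lin.
move=> y' [Vy' V'y'] /=.
rewrite -[LHS]/(a *: subsp_val (t y') + subsp_val (t' y')) tV // tV' //.
apply: functional_extensionality_dep => x.
rewrite /on_fiber -[LHS]/(a *: (if _ then _ else _) + (if _ then _ else _)).
by case: ifP => // _; rewrite scaler0 addr0.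
Qed.

Fact shriek_germ y v : exists2 t, shriek_regular t y & t y = v.
Proof.
have [V [s [oV Vy sV vE]]] := subsp_valP v.
have inV y' : V y' -> shriek_in y' (on_fiber s y') by move=> Vy'; exists V, s.
pose t y' : shriek_stalk y' := match pselect (V y') with
  | left Vy' => @Subsp _ _ (shriek_space y') _ (inV _ Vy')
  | right _ => 0 end.
have tV y' : V y' -> subsp_val (t y') = on_fiber s y'.
  by rewrite /t; case: pselect.
exists t; first by exists V, s.
by apply: subsp_inj; rewrite tV.
Qed.

Fact shriek_sep t t' y : shriek_regular t y -> shriek_regular t' y -> t y = t' y ->
  \forall y' \near y, t y' = t' y'.
Proof.
move=> [V [s [oV Vy sV tV]]] [V' [s' [oV' V'y sV' tV']]] tt'.
have [_ [/(_ setT closedT y (conj V'y Vy)) n _]] :=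
  proper_section_lin (-1) oV' oV sV' sV.
have /n{n} : ~ (f @` (setT `&`
    [set x | (V' `&` V) (f x) /\ (-1 *: s' + s : dprod F) x <> 0])) y.
  move=> [x [_ [[V'x Vx] +]] fxy]; apply.
  have := congr1 (fun u : shriek_stalk y => subsp_val u x) tt'.
  rewrite tV // tV' // /on_fiber asboolT // => ss'.
  by rewrite -[LHS]/(-1 *: s' x + s x) ss' scaleN1r addNr.
have nV : nbhs y V by exact: open_nbhs_nbhs.
have nV' : nbhs y V' by exact: open_nbhs_nbhs.
apply: filterS3 nV nV' => y' Vy' V'y' n; apply: subsp_inj.
rewrite tV // tV' //; apply: functional_extensionality_dep => x.
rewrite /on_fiber; case: asboolP => // fx; apply: contrapT => nss.
apply: n => //; exists x => //; split=> //; split; first by rewrite fx.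
rewrite -[X in X <> _]/(-1 *: s' x + s x) scaleN1r addrC => /eqP.
by rewrite subr_eq0 => /eqP.
Qed.

Definition shriek_sheaf : sheaf K Y :=
  @Sheaf K Y shriek_stalk shriek_regular
    shriek_near shriek_local shriek_lin shriek_germ shriek_sep.

End ShriekSheaf.

Section ShriekHom.
Variables (K : fieldType) (X Y : topologicalType) (f : X -> Y).
Variables (F G : sheaf K X) (h : hom F G).

Definition hom_section (s : dprod F) : dprod G := fun x => h x (s x).

Lemma hom_proper_section V s : open V -> proper_section f V s ->
  proper_section f V (hom_section s).
Proof.
move=> oV sV; apply: (proper_section_sub oV _ sV sV) => // x Vx.
  by apply: hom_reg; exact: sV.1.
by move=> sx _; rewrite /hom_section sx hom0.
Qed.

Lemma hom_on_fiber s y : hom_section (on_fiber f s y) = on_fiber f (hom_section s) y.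
Proof.
apply: functional_extensionality_dep => x; rewrite /hom_section /on_fiber.
by case: ifP => // _; exact: hom0.
Qed.

Fact shriek_hom_in y (u : shriek_sheaf f F y) :
  shriek_space f G y (hom_section (subsp_val u)).
Proof.
have [V [s [oV Vy sV ->]]] := subsp_valP u.
exists V, (hom_section s); split=> //; first exact: hom_proper_section.
exact: hom_on_fiber.
Qed.

Definition shriek_fun y (u : shriek_sheaf f F y) : shriek_sheaf f G y :=
  Subsp (shriek_hom_in u).

Fact shriek_fun_lin y : linear (@shriek_fun y).
Proof.
move=> a u v; apply: subsp_inj; apply: functional_extensionality_dep => x.
exact: hom_lin.
Qed.

Fact shriek_fun_reg (t : forall y, shriek_sheaf f F y) y :
  regular t y -> regular (fun y => shriek_fun (t y)) y.
Proof.
move=> [V [s [oV Vy sV tV]]].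
exists V, (hom_section s); split=> //; first exact: hom_proper_section.
by move=> y' Vy'; rewrite /= tV //; exact: hom_on_fiber.
Qed.

Definition shriek_hom : hom (shriek_sheaf f F) (shriek_sheaf f G) :=
  Hom shriek_fun_lin shriek_fun_reg.

End ShriekHom.

Record cpx (K : fieldType) (X : topologicalType) := Cpx {
  obj :> int -> sheaf K X;
  dif : forall n, hom (obj n) (obj (n + 1));
  dif_dif : forall n x v, dif (n + 1) x (dif n x v) = 0
}.

Record cpx_hom (K : fieldType) (X : topologicalType) (A B : cpx K X) := CpxHom {
  cpx_map :> forall n, hom (A n) (B n);
  cpx_mapP : forall n x v, dif B n x (cpx_map n x v) = cpx_map (n + 1) x (dif A n x v)
}.

Section Derived.
Variables (K : fieldType) (X : topologicalType).
Implicit Types A B : cpx K X.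

(* H^(n+1)(f) is injective and surjective on stalks.  The degrees are written
   n + 1, for all n : int, so that no cast is needed for the incoming map. *)
Definition quasi_iso A B (f : cpx_hom A B) := forall (n : int) (x : X),
  (forall v : A (n + 1) x, dif A (n + 1) x v = 0 ->
     (exists w, f (n + 1) x v = dif B n x w) -> exists u, v = dif A n x u) /\
  (forall w : B (n + 1) x, dif B (n + 1) x w = 0 ->
     exists2 v, dif A (n + 1) x v = 0 & exists u, w = f (n + 1) x v + dif B n x u).

(* A and B are isomorphic in the derived category: they are joined by a roof
   A <- M -> B of quasi-isomorphisms.  D^b is a full subcategory of D. *)
Definition derived_iso A B :=
  exists (M : cpx K X) (f : cpx_hom M A) (g : cpx_hom M B), quasi_iso f /\ quasi_iso g.

Fact shift1_dif_dif A (n : int) x v :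
  opp_hom (dif A (n + 1 + 1)) x (opp_hom (dif A (n + 1)) x v) = 0.
Proof.
rewrite /= -[X in dif A _ _ X]scaleN1r -[X in dif A _ _ X]addr0 hom_lin.
by rewrite dif_dif hom0 scaler0 addr0 oppr0.
Qed.
Definition shift1 A : cpx K X :=
  @Cpx K X (fun n => A (n + 1)) (fun n => opp_hom (dif A (n + 1))) (@shift1_dif_dif A).

Fact locally_closed0 : locally_closed (@set0 X).
Proof.
by exists set0, set0; split; [exact: open0|exact: closed0|rewrite set0I].
Qed.
Definition zero_sheaf : sheaf K X := cst_sheaf K locally_closed0.

Definition deg0_obj (F : sheaf K X) (n : int) := if n == 0 then F else zero_sheaf.
Definition deg0 (F : sheaf K X) : cpx K X :=
  @Cpx K X (deg0_obj F) (fun n => zero_hom (deg0_obj F n) (deg0_obj F (n + 1)))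
    (fun n x v => erefl).

Definition injective_sheaf (J : sheaf K X) :=
  forall (F G : sheaf K X) (i : hom F G), is_mono i ->
  forall h : hom F J, exists h' : hom G J, forall x v, h' x (i x v) = h x v.

Definition injective_resolution A B :=
  [/\ exists m : int, forall n, (n < m)%R -> forall x (v : B n x), v = 0,
      forall n, injective_sheaf (B n)
    & exists f : cpx_hom A B, quasi_iso f].

(* Some injective resolution, picked by choice; the [right] branch is only
   there to make the function total. *)
Definition chosen_resolution A : cpx K X :=
  match pselect (exists B, injective_resolution A B) with
  | left exB => projT1 (cid exB)
  | right _ => A
  end.

End Derived.

Section DerivedShriek.
Variables (K : fieldType) (X Y : topologicalType) (f : X -> Y).

Fact shriek_dif_dif (A : cpx K X) (n : int) y v :
  shriek_hom f (dif A (n + 1)) y (shriek_hom f (dif A n) y v) = 0.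
Proof.
apply: subsp_inj; apply: functional_extensionality_dep => x.
exact: dif_dif.
Qed.
Definition shriek_cpx (A : cpx K X) : cpx K Y :=
  @Cpx K Y (fun n => shriek_sheaf f (A n)) (fun n => shriek_hom f (dif A n))
    (@shriek_dif_dif A).

Definition Rshriek (A : cpx K X) : cpx K Y := shriek_cpx (chosen_resolution A).

End DerivedShriek.

Section LocallyClosed.
Variables (X Y : topologicalType).

Lemma closed_locally_closed (Z : set X) : closed Z -> locally_closed Z.
Proof. by exists setT, Z; split=> //; [exact: openT|rewrite setTI]. Qed.

Lemma locally_closedT : locally_closed (@setT X).
Proof. exact/closed_locally_closed/closedT. Qed.

Lemma locally_closed_preimage (f : X -> Y) (Z : set Y) :
  continuous f -> locally_closed Z -> locally_closed (f @^-1` Z).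
Proof.
move=> cf [U [C [oU cC ->]]]; exists (f @^-1` U), (f @^-1` C); split=> //.
- by apply: open_comp => // x _; exact: cf.
- by move/continuous_closedP: cf; exact.
Qed.

End LocallyClosed.

Lemma continuous_fst (X Y : topologicalType) : continuous (fun p : X * Y => p.1).
Proof. by move=> p; exact: cvg_fst. Qed.

Lemma continuous_snd (X Y : topologicalType) : continuous (fun p : X * Y => p.2).
Proof. by move=> p; exact: cvg_snd. Qed.

Lemma continuous_compo (X Y Z : topologicalType) (f : X -> Y) (g : Y -> Z) :
  continuous f -> continuous g -> continuous (fun x => g (f x)).
Proof. by move=> cf cg x; apply: (@continuous_comp _ _ _ f g x); [exact: cf|exact: cg]. Qed.

Lemma continuous_pair (X Y Z : topologicalType) (f : X -> Y) (g : X -> Z) :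
  continuous f -> continuous g -> continuous (fun x => (f x, g x)).
Proof. by move=> cf cg x; apply: cvg_pair; [exact: cf|exact: cg]. Qed.

Lemma continuous_add (R : realType) (X : topologicalType) (f g : X -> R) :
  continuous f -> continuous g -> continuous (fun x => f x + g x : R).
Proof. by move=> cf cg x; exact: (@cvgD R R^o X _ (nbhs_filter x) f g _ _ (cf x) (cg x)). Qed.

Section Exponential.
Variables (R : realType) (X : topologicalType).
Local Notation k := R[i].

Definition epi (phi : X -> R) : set (X * R) := [set p | 0 <= p.2 + phi p.1].

Lemma locally_closed_epi phi : continuous phi -> locally_closed (epi phi).
Proof.
move=> cphi; apply: closed_locally_closed.
have c : continuous (fun p : X * R => p.2 + phi p.1).
  apply: continuous_add; first exact: continuous_snd.
  exact: (continuous_compo (@continuous_fst X R) cphi).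
by have /continuous_closedP/(_ _ (@closed_ge R 0)) := c.
Qed.

(* E^phi_{Z|X} *)
Definition Esheaf (Z : set X) (lcZ : locally_closed Z) (phi : X -> R)
    (cphi : continuous phi) : sheaf k (X * R)%type :=
  tens_sheaf (inv_sheaf (@continuous_fst X R) (cst_sheaf k lcZ))
             (cst_sheaf k (locally_closed_epi cphi)).

(* F_Z := F (x) k_{Z x R} *)
Definition restr (F : sheaf k (X * R)%type) (Z : set X) (lcZ : locally_closed Z) :
    sheaf k (X * R)%type :=
  tens_sheaf F (cst_sheaf k (locally_closed_preimage (@continuous_fst X R) lcZ)).

Definition conv_q1 (p : X * R * R) : X * R := (p.1.1, p.1.2).
Definition conv_q2 (p : X * R * R) : X * R := (p.1.1, p.2).
Definition conv_mu (p : X * R * R) : X * R := (p.1.1, p.1.2 + p.2).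

Lemma continuous_q1 : continuous conv_q1.
Proof.
apply: continuous_pair; first exact: continuous_compo (@continuous_fst _ _) (@continuous_fst _ _).
exact: continuous_compo (@continuous_fst _ _) (@continuous_snd _ _).
Qed.

Lemma continuous_q2 : continuous conv_q2.
Proof.
apply: continuous_pair; last exact: continuous_snd.
exact: continuous_compo (@continuous_fst _ _) (@continuous_fst _ _).
Qed.

(* Convolution of sheaves placed in degree 0.  Over a field the tensor product
   is exact, and so are inverse images: only the direct image is derived. *)
Definition conv (F G : sheaf k (X * R)%type) : cpx k (X * R)%type :=
  Rshriek conv_mu
    (deg0 (tens_sheaf (inv_sheaf continuous_q1 F) (inv_sheaf continuous_q2 G))).

End Exponential.

Section Bilinear.
Variables (K : fieldType) (V W : lmodType K) (b : V -> W -> K).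

(* The linear form on V (x) W induced by a bilinear b; see [tens_lift_pure]. *)
Definition tens_lift (u : tens V W) : K := \sum_(p <- repr u) b p.1 p.2.

Hypothesis bl : forall a v v' w, b (a *: v + v') w = a * b v w + b v' w.
Hypothesis br : forall a v w w', b v (a *: w + w') = a * b v w + b v w'.

Lemma tens_lift_tcl l : tens_lift (tcl l) = \sum_(p <- l) b p.1 p.2.
Proof.
have b0 w : b 0 w = 0 by have := bl (-1) 0 0 w; rewrite scaler0 addr0 mulN1r addNr.
have b0r v : b v 0 = 0 by have := br (-1) v 0 0; rewrite scaler0 addr0 mulN1r addNr.
rewrite /tens_lift; move: (repr (tcl l)) (teq_repr l) => m; elim=> {l m} //.
- by move=> l m lm; apply: perm_big.
- by move=> l m n _ -> _ ->.
- by move=> p l m _ IH; rewrite !big_cons IH.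
- move=> v v' w l; rewrite !big_cons /= addrA; congr (_ + _).
  by have := bl 1 v v' w; rewrite scale1r mul1r.
- move=> v w w' l; rewrite !big_cons /= addrA; congr (_ + _).
  by have := br 1 v w w'; rewrite scale1r mul1r.
- move=> a v w l; rewrite !big_cons /=; congr (_ + _).
  by have := bl a v 0 w; have := br a v w 0; rewrite !addr0 b0 b0r !addr0 => -> ->.
- by move=> w l; rewrite big_cons /= b0 add0r.
Qed.

Lemma tens_lift_pure v w : tens_lift (pure v w) = b v w.
Proof. by rewrite /pure tens_lift_tcl big_seq1. Qed.

End Bilinear.

Section Gluing.
Variable R : realType.
Local Notation k := R[i].

Definition Cplx : normedModType R[i] := R[i]^o.

Lemma continuous_Re : continuous (fun z : Cplx => complex.Re z : R).
Proof.
move=> z; apply/(@cvgrPdist_lt R R^o Cplx _ (nbhs_filter z)) => e e0.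
have e0' : 0 < (e%:C)%C by rewrite ltcR.
have /(@cvgrPdist_lt _ _ _ _ (nbhs_filter z))/(_ _ e0') :
  (fun x : Cplx => x) @ z --> z by exact: cvg_id.
apply: filterS => w zw.
rewrite -ltcR; apply: le_lt_trans zw.
by have := normc_ge_Re (z - w : R[i]); case: (z : R[i]) (w : R[i]) => [a b] [c d].
Qed.

Lemma continuous_mulC (X : topologicalType) (f g : X -> Cplx) :
  continuous f -> continuous g -> continuous (fun z => (f z : R[i]) * g z : Cplx).
Proof.
move=> cf cg z.
exact: (@cvgM R[i] X _ (nbhs_filter z) f g _ _ (cf z) (cg z)).
Qed.

Lemma continuous_ReM (X : topologicalType) (f g : X -> Cplx) :
  continuous f -> continuous g -> continuous (fun z => complex.Re ((f z : R[i]) * g z) : R).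
Proof.
move=> cf cg.
exact: (@continuous_compo _ _ _ _ (fun z : Cplx => complex.Re z : R)
  (continuous_mulC cf cg) continuous_Re).
Qed.

Lemma continuousNR (X : topologicalType) (f : X -> R) :
  continuous f -> continuous (fun z => - f z : R).
Proof. move=> cf z; exact: (@cvgN R R^o X _ (nbhs_filter z) f _ (cf z)). Qed.

Lemma continuous_idC : continuous (@id Cplx).
Proof. by move=> z; exact: cvg_id. Qed.

Definition qphase (c : R[i]) (z : Cplx) : R := - complex.Re (c / 2 * z ^+ 2).

Lemma continuous_qphase c : continuous (qphase c).
Proof.
apply: continuousNR; apply: (@continuous_ReM Cplx (fun=> c / 2) (fun z => z ^+ 2)).
  exact: cst_continuous.
by apply: (@continuous_mulC Cplx id id); exact: continuous_idC.
Qed.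

Definition cis (t : R) : R[i] := (cos t +i* sin t)%C.

Definition has_arg (z : R[i]) (t : R) := exists2 rho : R, 0 < rho & z = (rho%:C)%C * cis t.

(* S_j.  As [has_arg] only depends on t modulo 2 pi, so does the sector on
   theta0, and it depends on j modulo 4. *)
Definition sector (theta0 : R) (j : nat) : set Cplx :=
  [set z | z = 0 \/ exists2 t, theta0 + (j%:R - 1) * (pi / 2) <= t <= theta0 + j%:R * (pi / 2) & has_arg z t].

Lemma cisD s t : cis (s + t) = cis s * cis t.
Proof. by rewrite /cis cosD sinD; apply/eqP; rewrite eq_complex /= [cos s * sin t + _]addrC !eqxx. Qed.

Lemma cis0 : cis 0 = 1.
Proof. by rewrite /cis cos0 sin0. Qed.

Lemma has_arg0 z : 0 <= complex.Re z -> 0 <= complex.Im z -> z <> 0 ->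
  exists2 t, 0 <= t <= pi / 2 & has_arg z t.
Proof.
case: z => a b /= a0 b0 ab0.
pose n := Num.sqrt (a ^+ 2 + b ^+ 2).
have s0 : 0 < a ^+ 2 + b ^+ 2.
  rewrite lt_neqAle addr_ge0 ?sqr_ge0// andbT eq_sym.
  apply/eqP => /eqP; rewrite paddr_eq0 ?sqr_ge0// !sqrf_eq0 => /andP[/eqP aE /eqP bE].
  by apply: ab0; rewrite aE bE.
have n0 : 0 < n by rewrite sqrtr_gt0.
have nn : n ^+ 2 = a ^+ 2 + b ^+ 2 by rewrite sqr_sqrtr// ltW.
have an : a <= n.
  by rewrite -[n]ger0_norm ?(ltW n0)// -[a]ger0_norm// -ler_sqr ?nnegrE// !real_normK ?num_real// nn lerDl sqr_ge0.
have an0 : 0 <= a / n by rewrite divr_ge0// ltW.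
have an1 : a / n <= 1 by rewrite ler_pdivrMr// mul1r.
have anI : -1 <= a / n <= 1 by rewrite an1 andbT (le_trans _ an0)// lerN10.
have cE : cos (acos (a / n)) = a / n by apply: acosK; rewrite in_itv /=.
exists (acos (a / n)).
  rewrite acos_ge0//= leNgt; apply/negP => lt.
  have : cos (acos (a / n)) < 0.
    apply: lt_le_trans (_ : cos (pi / 2) <= 0); last by rewrite cos_pihalf.
    rewrite ltr_cos ?in_itv//= ?acos_ge0 ?acos_lepi//.
    by rewrite divr_ge0 ?pi_ge0//= ler_pdivrMr// ler_peMr ?pi_ge0// ler1n.
  by rewrite cE ltNge an0.
exists n => //; rewrite /cis cE sin_acos//.
have -> : Num.sqrt (1 - (a / n) ^+ 2) = b / n.
  have -> : 1 - (a / n) ^+ 2 = (b / n) ^+ 2.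
    rewrite !expr_div_n nn; apply/eqP; rewrite subr_eq -mulrDl addrC divff//.
    by rewrite gt_eqF.
  by rewrite sqrtr_sqr ger0_norm// divr_ge0// ltW.
apply/eqP; rewrite eq_complex /= !mul0r subr0 addr0 !(mulrC n) !divfK ?eqxx//.
all: by rewrite gt_eqF.
Qed.

Lemma sectorE theta0 j : sector theta0 j =
  [set z : Cplx | 0 <= complex.Re (cis (- (theta0 + (j%:R - 1) * (pi / 2))) * z)] `&`
  [set z : Cplx | 0 <= complex.Re (cis (- (theta0 + j%:R * (pi / 2))) * z)].
Proof.
set a := theta0 + (j%:R - 1) * (pi / 2); set b := theta0 + j%:R * (pi / 2).
have ba : b = a + pi / 2 by rewrite /a /b mulrBl mul1r addrA addrNK.
have ImE (z : R[i]) : complex.Re (cis (- b) * z) = complex.Im (cis (- a) * z).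
  case: z => x y; rewrite ba /cis !cosN !sinN cosDpihalf sinDpihalf /=.
  by ring.
apply/seteqP; split=> z; rewrite /sector /= -/a -/b ImE.
  move=> [->|[t /andP[at_ tb] [rho rho0 ->]]]; first by rewrite mulr0 /= lexx.
  have e : cis (- a) * ((rho%:C)%C * cis t) = (rho%:C)%C * cis (t - a).
    by rewrite mulrCA -cisD addrC.
  rewrite e /cis /= !mul0r subr0 addr0; split; apply: mulr_ge0; rewrite ?(ltW rho0)//.
    by apply: cos_ge0_pihalf; have := pi_ge0 R; rewrite ba in tb; lra.
  by apply: sin_ge0_pi; have := pi_ge0 R; rewrite ba in tb; lra.
move=> [re im].
have [z0|z0] := pselect ((z : R[i]) = 0); [by left|right].
have aN : cis a * cis (- a) = 1 by rewrite -cisD subrr cis0.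
have w0 : cis (- a) * z <> 0.
  by move=> w0; apply: z0; rewrite -[LHS]mul1r -aN -mulrA w0 mulr0.
have [t /andP[t0 t1] [rho rho0 e]] := has_arg0 re im w0.
exists (a + t); first by rewrite ba; lra.
by exists rho => //; rewrite cisD mulrCA -e mulrA aN mul1r.
Qed.

Lemma locally_closed_sector theta0 j : locally_closed (sector theta0 j).
Proof.
apply: closed_locally_closed; rewrite sectorE.
have cl (w : R[i]) : closed [set z : Cplx | 0 <= complex.Re (w * z)].
  have c : continuous (fun z : Cplx => complex.Re (w * (z : R[i])) : R).
    apply: (@continuous_ReM Cplx (fun=> w) id); first exact: cst_continuous.
    exact: continuous_idC.
  by have /continuous_closedP/(_ _ (@closed_ge R 0)) := c.
exact: closedI.
Qed.

End Gluing.

Section FourierSato.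
Variable R : realType.
Local Notation k := R[i].
Local Notation Cplx := (Cplx R).

Definition laplace_p (x : Cplx * Cplx * R) : Cplx * R := (x.1.1, x.2).
Definition laplace_q (x : Cplx * Cplx * R) : Cplx * R := (x.1.2, x.2).

Lemma continuous_laplace_p : continuous laplace_p.
Proof.
apply: continuous_pair; last exact: continuous_snd.
exact: continuous_compo (@continuous_fst _ _) (@continuous_fst _ _).
Qed.

Definition laplace_phase (x : Cplx * Cplx) : R :=
  - complex.Re ((x.1 : R[i]) * x.2).

Lemma continuous_laplace_phase : continuous laplace_phase.
Proof.
apply: continuousNR.
exact: (@continuous_ReM _ _ fst snd (@continuous_fst _ _) (@continuous_snd _ _)).
Qed.

Definition laplace (F : sheaf k (Cplx * R)%type) : cpx k (Cplx * R)%type :=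
  shift1 (Rshriek laplace_q
    (conv (Esheaf (@locally_closedT (Cplx * Cplx)%type) continuous_laplace_phase)
          (inv_sheaf continuous_laplace_p F))).

End FourierSato.

Section StokesGluing.
Variable R : realType.
Local Notation k := R[i].
Local Notation Cplx := (Cplx R).

Definition generic (C : {fset R[i]}) (theta : R) :=
  forall c d, c \in C -> d \in C -> c != d ->
  forall z : R[i], has_arg z theta ->
    complex.Re (c / 2 * z ^+ 2) <> complex.Re (d / 2 * z ^+ 2).

(* c_(1), ..., c_(n).  The order is tested at the unit vector of argument
   theta; [numbering_sorted] gives the strict order at all z of argument theta. *)
Definition numbering (C : {fset R[i]}) (theta : R) : seq R[i] :=
  sort (fun c d => complex.Re (c / 2 * cis theta ^+ 2)
                   <= complex.Re (d / 2 * cis theta ^+ 2)) C.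

Lemma perm_numbering C theta : perm_eq (numbering C theta) C.
Proof. by rewrite /numbering perm_sort. Qed.

Lemma numbering_sorted C theta z : generic C theta -> has_arg z theta ->
  sorted (fun c d => complex.Re (c / 2 * z ^+ 2) < complex.Re (d / 2 * z ^+ 2))
    (numbering C theta).
Proof.
move=> gC zt; have [rho rho0 zE] := zt.
have scale c : complex.Re (c / 2 * z ^+ 2)
    = rho ^+ 2 * complex.Re (c / 2 * cis theta ^+ 2).
  rewrite zE exprMn mulrCA -rmorphXn /=.
  by case: (c / 2 * _) => a b /=; rewrite mul0r subr0.
set s := numbering C theta.
have us : uniq s by rewrite (perm_uniq (perm_numbering C theta)) fset_uniq.
have sC : {subset s <= C} by move=> c; rewrite (perm_mem (perm_numbering C theta)).
have : sorted (fun c d => complex.Re (c / 2 * z ^+ 2)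
                   <= complex.Re (d / 2 * z ^+ 2)) s.
  apply: (sub_sorted _ (sort_sorted _ C)) => [c d|c d]; last exact: le_total.
  by rewrite !scale ler_pM2l// exprn_gt0.
elim: s us sC => // c [//|d s] IH /andP[cs us] sC /= /andP[cd ds].
apply/andP; split; last by apply: IH => // e es; apply: sC; rewrite inE es orbT.
rewrite lt_neqAle cd andbT; apply/eqP; apply: gC zt.
- by apply: sC; rewrite mem_head.
- by apply: sC; rewrite !inE eqxx orbT.
- by apply: contraNneq cs => ->; rewrite mem_head.
Qed.

(* The diagonal blocks have sizes r c_(1), ..., r c_(n): the first r c_(1) rows
   are attached to c_(1), the next r c_(2) rows to c_(2), and so on. *)
Definition row_exponents (C : {fset R[i]}) (theta : R) (r : R[i] -> nat) : seq R[i] :=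
  flatten [seq nseq (r c) c | c <- numbering C theta].

Definition row_exponent C theta r (i : nat) : R[i] := (row_exponents C theta r)`_i.

Definition block_index C theta r (i : nat) : nat :=
  index (row_exponent C theta r i) (numbering C theta).

Lemma size_row_exponents C theta r :
  size (row_exponents C theta r) = (\sum_(c <- C) r c)%N.
Proof.
rewrite size_flatten /shape -map_comp sumnE big_map.
rewrite (perm_big _ (perm_numbering C theta)) /=.
by apply: eq_bigr => c _; rewrite size_nseq.
Qed.

(* Indices live in Z/4, so sigma 4%:R is sigma 0. *)
Record gluing_data (C : {fset R[i]}) (theta0 : R) (r : R[i] -> nat) (N : nat)
    (sigma : 'Z_4 -> 'M[R[i]]_N) : Prop := GluingData {
  gluing_pos : forall c, c \in C -> (0 < r c)%N;
  gluing_size : N = (\sum_(c <- C) r c)%N;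
  gluing_upper : forall (j : 'Z_4) (a b : 'I_N), odd j ->
    (block_index C theta0 r b < block_index C theta0 r a)%N -> sigma j a b = 0;
  gluing_lower : forall (j : 'Z_4) (a b : 'I_N), ~~ odd j ->
    (block_index C theta0 r a < block_index C theta0 r b)%N -> sigma j a b = 0;
  gluing_monodromy :
    sigma 4%:R *m sigma 3%:R *m sigma 2%:R *m sigma 1%:R = 1%:M
}.

(* v |-> v (x) 1, the identification F_x = (F_Z)_x for x over Z. *)
Definition germ_restr (F : sheaf k (Cplx * R)%type) (Z : set Cplx)
    (lcZ : locally_closed Z) (x : Cplx * R) (v : F x) : restr F lcZ x :=
  pure v (cst_fill _ 1 x).

(* The identification of a nonzero stalk k (x) k of E^phi_{Z|X} with k. *)
Definition Ecoord (Z : set Cplx) (lcZ : locally_closed Z) (phi : Cplx -> R)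
    (cphi : continuous phi) (x : Cplx * R) (u : Esheaf lcZ cphi x) : R[i] :=
  tens_lift (fun (a : cst_stalk k Z x.1) (b : cst_stalk k (epi phi) x) =>
    (subsp_val a : R[i]) * subsp_val b) u.

Lemma Ecoord_pure (Z : set Cplx) (lcZ : locally_closed Z) (phi : Cplx -> R)
    (cphi : continuous phi) (x : Cplx * R)
    (a : cst_stalk k Z x.1) (b : cst_stalk k (epi phi) x) :
  Ecoord (lcZ := lcZ) (cphi := cphi) (pure a b)
    = (subsp_val a : R[i]) * subsp_val b.
Proof.
rewrite /Ecoord tens_lift_pure // => [c u v w|c u v w]; rewrite subsp_val_lin.
  by rewrite mulrDl mulrA.
by rewrite mulrDr mulrCA.
Qed.

(* The direct sum of the (E^{phi_c}_{S_j|C})^{r_c}, in the order of the rows. *)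
Definition local_model (C : {fset R[i]}) (theta0 : R) (r : R[i] -> nat) (N : nat)
    (j : 'Z_4) : sheaf k (Cplx * R)%type :=
  sum_sheaf (fun a : 'I_N => Esheaf (locally_closed_sector theta0 j)
    (@continuous_qphase R (row_exponent C theta0 r a))).

(* F, together with suitable alpha_j, is the sheaf glued by sigma.  The matrix
   condition is read on stalks at the points x = (z, t) over S_j and S_(j+1):
   with phi_c(z) = - Re(c/2 z^2), the stalk at x of E^{phi_c} is k if
   t + phi_c(z) >= 0 and 0 otherwise, and a scalar acts between two of these
   through the restriction k_A -> k_B, which is the identity of k on the
   smaller of the two supports. *)
Definition is_gluing (C : {fset R[i]}) (theta0 : R) (r : R[i] -> nat) (N : nat)
    (sigma : 'Z_4 -> 'M[R[i]]_N) (F : sheaf k (Cplx * R)%type) :=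
  exists alpha : forall j : 'Z_4,
    hom (restr F (locally_closed_sector theta0 j)) (local_model C theta0 r N j),
  (forall j, is_iso (alpha j)) /\
  forall (j : 'Z_4) (x : Cplx * R),
    sector theta0 j x.1 -> sector theta0 (j + 1 : 'Z_4)%R x.1 ->
    forall (v : F x) (a : 'I_N),
      Ecoord (alpha (j + 1) x (germ_restr _ v) a) =
      if 0 <= x.2 + qphase (row_exponent C theta0 r a) x.1
      then \sum_(b < N) sigma j a b * Ecoord (alpha j x (germ_restr _ v) b)
      else 0.

End StokesGluing.

(* Main.v *)
(* As the monodromy is trivial, a glued sheaf is a quotient of the constant
   sheaf V = k^N: over S_j the vector v reads g_j v, with g_1 = 1 and
   g_(j+1) = sigma_j g_j, and the stalk at x is V/K_x, where K_x consists of the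
   v whose coordinates (g_j v)_a vanish for all rows a alive at x.  The
   transform is computed by three successive direct images along lines,
   keeping track only of these subspaces.

   Turn the coordinates so that c is a positive real and Re (z w) becomes
   - (x w1 - y w2).  The convolution replaces K_(z,t) by K_(z, s - Re (z w)).
   Along the direction of x the supports are intervals, so the direct image
   sits in degree 0 and is the quotient of V by the intersection of the K.
   Along the direction of y the supports are complements of intervals, so the
   direct image sits in degree 1 and is the quotient of V by the sum of the K;
   the shift [1] brings it to degree 0.  The critical point w'/c lies in the
   same quadrant as w', whence this sum is the subspace of the glued sheaf of
   the transformed exponents, with the same charts g_j.

   Direct images are computed on germs: a closed section is integrated by
   sweeping along the fibre, and the obstruction to closing up the primitive
   on the right is the class of the section in V modulo the sum of the K. *)
Require Import Defs.
From mathcomp Require Import all_boot all_order all_algebra.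
From mathcomp Require Import complex finmap.
From mathcomp Require Import all_classical all_reals all_analysis.
From mathcomp Require Import ring lra zify.
Import Defs.

Set Implicit Arguments.
Unset Strict Implicit.
Unset Printing Implicit Defensive.

Import Order.TTheory GRing.Theory Num.Theory.
Import numFieldTopology.Exports numFieldNormedType.Exports.
Local Open Scope classical_set_scope.
Local Open Scope ring_scope.

(** * Solving differential equations along the fibres of a line fibration *)

(** The definition of [Rshriek] shapes everything: its resolution is picked by choice, and for the
    inner complex [conv] of the transform no injective resolution is ever exhibited; failing one,
    [chosen_resolution] is the complex itself. Only two facts that hold in either case are therefore
    retained: the terms are soft, which direct images preserve, and the cohomology is the one
    recorded by [resolves], which quasi-isomorphisms preserve. Softness is used through
    [germ_extendable]: a local discrepancy d u can be absorbed by a section of bounded support.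

    Lines are preferred to the planes that are the fibres of [laplace_q] because two solutions on
    adjacent segments meet in one point of the fibre: a single germ has to be corrected, and no
    covering argument arises. Opposite conditions on the subspaces govern the lines of x and of y:
    [ker_split] makes every class of degree 0 constant, [ker_cap] makes it vanish. Both hold across
    the axes because the triangularity of the sigma_k follows the order in which the exponents
    become alive there. *)

Section Sheaves.
Variables (K : fieldType) (X : topologicalType).

Lemma regularB (F : sheaf K X) (s t : forall x, F x) x :
  regular s x -> regular t x -> regular (fun y => s y - t y) x.
Proof.
move=> sx tx; apply: regular_local (regular_lin (-1) tx sx).
by apply: nearW => y; rewrite scaleN1r addrC.
Qed.

Lemma homD (F G : sheaf K X) (f : hom F G) x (u v : F x) :
  f x (u + v) = f x u + f x v.
Proof. by have := hom_lin f 1 u v; rewrite !scale1r. Qed.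

Lemma homN (F G : sheaf K X) (f : hom F G) x (u : F x) : f x (- u) = - f x u.
Proof. by have := hom_lin f (-1) u 0; rewrite hom0 !addr0 !scaleN1r. Qed.

Lemma homB (F G : sheaf K X) (f : hom F G) x (u v : F x) :
  f x (u - v) = f x u - f x v.
Proof. by rewrite homD homN. Qed.

Variable R : realType.

(** Where [g x = c] both families are sections, and equal germs at [x] force equality near [x];
    there the pasted family is simply [s]. *)
Lemma regular_paste (F : sheaf K X) (g : X -> R) (c : R) (s t : dprod F) x :
  continuous g -> (g x <= c -> regular s x) -> (c <= g x -> regular t x) ->
  (g x = c -> s x = t x) ->
  regular (fun y => if g y <= c then s y else t y) x.
Proof.
move=> cg sr tr st; have [lt|gt|e] := ltgtP (g x) c.
- apply: regular_local (sr (ltW lt)).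
  have : \forall y \near x, g y < c by exact: (@cvgr_lt R X (nbhs x) _ g (g x) (cg x)).
  by apply: filterS => y lty; rewrite (ltW lty).
- apply: regular_local (tr (ltW gt)).
  have : \forall y \near x, c < g y by exact: (@cvgr_gt R X (nbhs x) _ g (g x) (cg x)).
  by apply: filterS => y lty; rewrite leNgt lty.
- have sx : regular s x by apply: sr; rewrite e.
  have tx : regular t x by apply: tr; rewrite e.
  apply: (regular_local _ sx); apply: filterS (regular_sep sx tx (st e)).
  by move=> y ->; rewrite if_same.
Qed.

End Sheaves.

Section Cousin.
Variable R : realType.

(** Induction along a segment: the supremum of the points reachable from [a] has a neighbourhood of
    its own on which [P] holds, so it is reachable and can only be [b]. It replaces every
    subdivision argument below. *)
Lemma cousin (P : R -> R -> Prop) (a b : R) : a <= b ->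
  (forall c, a <= c <= b -> exists2 e, 0 < e &
     forall s t, c - e < s -> s <= c -> c <= t -> t < c + e -> P s t) ->
  (forall r s t, r <= s -> s <= t -> P r s -> P s t -> P r t) -> P a b.
Proof.
move=> ab loc glue.
pose S := [set c | a <= c <= b /\ P a c].
have Pr c : a <= c <= b -> P c c.
  by move=> /loc[e e0]; apply; lra.
have Sa : S a by split; [rewrite lexx ab|apply: Pr; rewrite lexx ab].
have ubS : has_ubound S by exists b => c [/andP[]].
have supS : has_sup S by split=> //; exists a.
pose m := sup S.
have am : a <= m by apply: ub_le_sup.
have mb : m <= b by apply: ge_sup; [exists a|move=> c [/andP[]]].
have [e e0 le] := loc m (introT andP (conj am mb)).
have [c [/andP[ac cb] Pac] mc] := sup_adherent e0 supS.
have cm : c <= m by apply: ub_le_sup => //; split=> //; rewrite ac cb.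
have Pt t : m <= t -> t < m + e -> P a t.
  move=> mt te; apply: (glue a c t) => //; first exact: le_trans mt.
  exact: le.
have [bt|bt] := ltP b (m + e); first exact: Pt.
have Smt : S (m + e / 2).
  by split; [lra|apply: Pt; lra].
have : m + e / 2 <= m by apply: ub_le_sup.
by lra.
Qed.

End Cousin.

(** A homeomorphism of [X] with R x W given by explicit coordinates, so that each fibration is
    treated in place, without transporting sheaves. *)
Record is_line (R : realType) (X W : topologicalType) (f : X -> W) (g : X -> R)
    (h : R * W -> X) : Prop := IsLine {
  line_f : continuous f;
  line_g : continuous g;
  line_h : continuous h;
  line_fh : forall p, f (h p) = p.2;
  line_gh : forall p, g (h p) = p.1;
  line_hK : forall x, h (g x, f x) = x
}.

(** The form in which softness is used: an exact correction needed at one point of a fibre extends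
    globally and disappears far out along the fibre. *)
Definition germ_extendable (R : realType) (K : fieldType) (X : topologicalType)
    (g : X -> R) (F : sheaf K X) := forall x0 (a : F x0),
  exists s : dprod F, [/\ forall x, regular s x,
    exists M : R, forall x, M <= `|g x| -> s x = 0 & s x0 = a].

Section Line.
Variables (R : realType) (K : fieldType) (X W : topologicalType).
Variables (f : X -> W) (g : X -> R) (h : R * W -> X).
Hypothesis L : is_line f g h.

Let fh t w : f (h (t, w)) = w. Proof. exact: (line_fh L). Qed.
Let gh t w : g (h (t, w)) = t. Proof. exact: (line_gh L). Qed.
Let hE x w : f x = w -> x = h (g x, w). Proof. by move=> <-; rewrite (line_hK L). Qed.

(** Compactness of [a, b] turns neighbourhoods of the points of a segment of the fibre into a
    neighbourhood of [w0]. *)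
Lemma tube (P : X -> Prop) (a b : R) (w0 : W) :
  (forall x, f x = w0 -> a <= g x <= b -> \forall y \near x, P y) ->
  \forall w \near w0, forall x, f x = w -> a <= g x <= b -> P x.
Proof.
move=> nP.
have /compact_near_coveringP cov := @segment_compact R a b.
have : \forall w \near w0, `[a, b]%classic `<=` (fun t => P (h (t, w))).
  apply: cov => t; rewrite /= in_itv /= => tab.
  have := nP (h (t, w0)) (fh _ _); rewrite gh => /(_ tab).
  by move=> /(line_h L)[[A B] /= [At Bw] AB]; exists (A, B) => // -[t1 w1] AB1; exact: (AB (t1, w1)).
by apply: filterS => w wP x xw xab; rewrite (hE xw); apply: wP; rewrite /= in_itv.
Qed.

Lemma continuous_slice w : continuous (fun t => h (t, w)).
Proof.
apply: (@continuous_compo _ _ _ (fun t => (t, w)) h); last exact: (line_h L).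
by apply: continuous_pair => t; [exact: cvg_id|exact: cvg_cst].
Qed.

Lemma near_fiber (P : X -> Prop) t w : (\forall y \near h (t, w), P y) ->
  exists2 e, 0 < e & forall s, t - e < s -> s < t + e -> P (h (s, w)).
Proof.
move=> /(@continuous_slice w t) /nbhs_ballP[e /= e0 eP]; exists e => // s s1 s2; apply: eP.
by rewrite /ball /= ltr_distlC; lra.
Qed.

(** The support over [z] is compact, so [c] is bounded on it by some M + 1. The part of the support
    where |c| >= M + 2 is then closed and misses the fibre of [z], hence misses all nearby
    fibres. *)
Lemma bounded_of_proper (Y Z : topologicalType) (p : Y -> Z) (F : sheaf K Y)
    (V : set Z) (s : dprod F) (c : Y -> R) : continuous c -> open V ->
  proper_section p V s -> forall z, V z ->
  exists M : R, \forall z' \near z, forall y, p y = z' -> M <= `|c y| -> s y = 0.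
Proof.
move=> cc oV [sr [scl sco]] z Vz.
set S := [set y | _] in scl sco.
have /compact_bounded bc : compact ((c : Y -> R^o) @` (S `&` p @^-1` [set z])).
  apply: continuous_compact; last exact: sco.
  by apply: continuous_subspaceT => y; exact: cc.
have [M [_ /(_ (M + 1))MP]] := bc.
have {}MP y : S y -> p y = z -> `|c y| <= M + 1.
  by move=> Sy yz; apply: MP; [rewrite ltrDl|exists y].
pose A := [set y | M + 2 <= `|c y|].
have cA : closed A.
  have cn : continuous (fun y => `|c y|) := continuous_compo cc (@norm_continuous R R^o).
  by have /continuous_closedP/(_ _ (@closed_ge R (M + 2))) := cn.
have nA : ~ (p @` (A `&` S)) z.
  by move=> [y [Ay Sy] yz]; have := MP y Sy yz; rewrite /A /= in Ay; lra.
exists (M + 2); apply: filterS2 (scl A cA z Vz nA) (open_nbhs_nbhs (conj oV Vz)).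
move=> z' n Vz' y yz' My; apply: contrapT => sy; apply: n => //.
by exists y => //; split=> //; split=> //; rewrite yz'.
Qed.

(** A converse to [bounded_of_proper] along a line: a bounded piece of a fibre lies in the
    continuous image of a segment, which gives compactness, and [tube] gives closedness. Properness
    can thus be handled as boundedness of [g] on the support. *)
Lemma proper_of_bounded (F : sheaf K X) (V : set W) (s : dprod F) : open V ->
  (forall x, V (f x) -> regular s x) ->
  (forall w, V w -> exists M : R, \forall w' \near w, forall x, f x = w' ->
     M <= `|g x| -> s x = 0) ->
  proper_section f V s.
Proof.
move=> oV sr bd; split=> //.
have ncl x : V (f x) -> s x = 0 -> \forall y \near x, s y = 0.
  move=> Vx s0; exact: (regular_sep (sr x Vx) (regular_cst0 F x) s0).
split.
  move=> A cA w Vw nw; have [M nM] := bd w Vw.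
  have T : \forall w' \near w, forall x, f x = w' -> - M <= g x <= M ->
      ~ (A `&` [set x | V (f x) /\ s x <> 0]) x.
    apply: tube => x xw _; have [Ax|nAx] := pselect (A x).
      have s0 : s x = 0.
        by apply: contrapT => sx; apply: nw; exists x => //; split=> //; split=> //; rewrite xw.
      have Vx : V (f x) by rewrite xw.
      by apply: filterS (ncl x Vx s0) => y sy [_ [_]].
    have : nbhs x (~` A) by apply: open_nbhs_nbhs; split=> //; exact: closed_openC.
    by apply: filterS => y nAy [].
  apply: filterS2 nM T => w' bw tw Vw' [x AS xw'].
  apply: (tw x xw' _ AS); rewrite -ler_norml leNgt; apply/negP => /ltW Mx.
  by have [_ [_]] := AS; apply; exact: (bw x xw' Mx).
move=> w Vw; have [M /nbhs_singleton bM] := bd w Vw.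
have cpt : compact ((fun t => h (t, w)) @` `[- M, M]%classic).
  apply: continuous_compact; last exact: segment_compact.
  by apply: continuous_subspaceT; exact: continuous_slice.
set S := [set x | _].
have sub : S `&` f @^-1` [set w] `<=` (fun t => h (t, w)) @` `[- M, M]%classic.
  move=> x [[Vx sx] xw]; exists (g x); last by rewrite -(hE xw).
  rewrite /= in_itv /= -ler_norml leNgt; apply/negP => /ltW Mx.
  by apply: sx; exact: (bM x xw Mx).
move=> G PG GS; have GC : G ((fun t => h (t, w)) @` `[- M, M]%classic) by exact: filterS GS.
have [x [[t _ tx] Gx]] := cpt G PG GC.
exists x; split=> //.
have xw : f x = w by rewrite -tx fh.
have Vx : V (f x) by rewrite xw.
split=> //; split=> // s0.
by have [y [[[_ sy] _] s0y]] := Gx _ _ GS (ncl x Vx s0).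
Qed.

(** Regularity is asked on the fibre only, but the bound holds on all of [X]; the latter can always
    be achieved by [cut] and makes the support proper over a neighbourhood of [w]. *)
Definition fiber_section (F : sheaf K X) w (s : dprod F) :=
  (forall x, f x = w -> regular s x) /\ exists M : R, forall x, M <= `|g x| -> s x = 0.

Lemma fiber_section_proper (F : sheaf K X) w (s : dprod F) : fiber_section w s ->
  exists V, [/\ open V, V w & proper_section f V s].
Proof.
move=> [sr [M sM]].
have : \forall w' \near w, forall x, f x = w' -> - (M + 1) <= g x <= M + 1 ->
    regular s x.
  by apply: tube => x xw _; apply: regular_near; exact: sr.
rewrite /prop_near1 nbhsE => -[V [oV Vw] VP]; exists V; split=> //.
apply: proper_of_bounded => // [x Vx|w' _].
  have [le|gt] := leP `|g x| (M + 1).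
    by apply: (VP (f x)) => //; rewrite -ler_norml.
  have gt' : M < `|g x| by lra.
  apply: regular_local (regular_cst0 F x).
  have cn : continuous (fun y => `|g y|) :=
    continuous_compo (line_g L) (@norm_continuous R R^o).
  have : \forall y \near x, M < `|g y|.
    exact: (@cvgr_gt R X (nbhs x) _ (fun y => `|g y|) `|g x| (cn x)).
  by apply: filterS => y My; rewrite sM // ltW.
by exists M; apply: nearW => z x _; exact: sM.
Qed.

Definition cut (F : sheaf K X) (a b : R) (s : dprod F) : dprod F :=
  fun x => if g x <= b then (if g x <= a then 0 else s x) else 0.

Lemma cut_fiber_section (F : sheaf K X) w (a b : R) (s : dprod F) :
  (forall x, f x = w -> a <= g x <= b -> regular s x) ->
  (forall x, f x = w -> g x = a -> s x = 0) ->
  (forall x, f x = w -> g x = b -> s x = 0) ->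
  fiber_section w (cut a b s).
Proof.
move=> sr sa sb; split.
  move=> x xw; apply: regular_paste; [exact: (line_g L)| |by move=> _; exact: regular_cst0|].
    move=> xb; apply: regular_paste; [exact: (line_g L)|by move=> _; exact: regular_cst0| |].
      by move=> ax; apply: sr => //; rewrite ax.
    by move=> xa; rewrite sa.
  by move=> xb; case: ifP => // _; exact: sb.
exists (`|a| + `|b| + 1) => x le; rewrite /cut.
case: ifP => // xb; case: ifPn => //; rewrite -ltNge => ax; move: le.
have := ler_norm a; have := ler_norm b; have := ler_norm (- a); have := ler_norm (- b).
by rewrite !normrN; case: (ger0P (g x)) => _ *; exfalso; lra.
Qed.

(** Base change for a line: a section along one fibre with bounded support spreads to nearby fibres
    by [tube], so germs of the direct image are exactly such sections. *)
Lemma shriek_inP (F : sheaf K X) w (u : dprod F) :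
  shriek_in f w u <-> exists2 s, fiber_section w s & u = on_fiber f s w.
Proof.
split=> [[V [s [oV Vw sV ->]]]|[s sw ->]]; last first.
  by have [V [oV Vw sV]] := fiber_section_proper sw; exists V, s.
have [M /nbhs_singleton sM] := bounded_of_proper (line_g L) oV sV Vw.
pose N := `|M|.
have sN x : f x = w -> N <= `|g x| -> s x = 0.
  by move=> xw Nx; apply: sM => //; apply: le_trans Nx; exact: ler_norm.
exists (cut (- N) N s).
  apply: cut_fiber_section => [x xw _|x xw xN|x xw xN].
  - by apply: sV.1; rewrite xw.
  - by apply: sN => //; rewrite xN normrN ger0_norm /N.
  - by apply: sN => //; rewrite xN ger0_norm /N.
apply: functional_extensionality_dep => x; rewrite /on_fiber /cut.
case: asboolP => // xw; case: ifPn => [xN|]; first case: ifPn => // xN'.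
- by apply: sN => //; rewrite -normrN; apply: le_trans (ler_norm _); lra.
- by rewrite -ltNge => xN; apply: sN => //; apply: le_trans (ler_norm _); lra.
Qed.

(** Spread the germ [b] to a section [s]: then [d s] and [c] are sections with the same germ at [x],
    so the equation persists near [x]. *)
Lemma germ_section (F G : sheaf K X) (d : hom F G) (c : dprod G) x (b : F x) :
  regular c x -> d x b = c x ->
  exists s : dprod F, \forall y \near x, regular s y /\ d y (s y) = c y.
Proof.
move=> cx dbc; have [s sx sb] := regular_germ b; exists s.
have e : d x (s x) = c x by rewrite sb.
by apply: filterS2 (regular_near sx) (regular_sep (hom_reg d sx) cx e).
Qed.

Section Solve.
Variables (A B C : sheaf K X) (d0 : hom A B) (d1 : hom B C).
Variables (V : Type) (e : V -> dprod B).
Hypothesis er : forall v x, regular (e v) x.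
Hypothesis d1e : forall v x, d1 x (e v x) = 0.
Hypothesis dd : forall x u, d1 x (d0 x u) = 0.
Hypothesis geA : germ_extendable g A.

(* Sweep along the fibre: two local solutions differ at a germ by some
   e v + d0 u, and u extends to a global section. *)
Lemma solve_segment (c : dprod C) w (a b : R) : a <= b ->
  (forall x, f x = w -> forall p, d1 x p = 0 -> exists v u, p = e v x + d0 x u) ->
  (forall x, f x = w -> a <= g x <= b -> regular c x) ->
  (forall x, f x = w -> a <= g x <= b -> exists p, d1 x p = c x) ->
  exists s : dprod B, forall x, f x = w -> a <= g x <= b ->
    regular s x /\ d1 x (s x) = c x.
Proof.
move=> ab ex cr cs.
pose P s t := a <= s -> t <= b -> exists p : dprod B, forall x, f x = w ->
  s <= g x <= t -> regular p x /\ d1 x (p x) = c x.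
have : P a b; last by apply.
apply: cousin => // [t tab|r s t rs st Prs Pst ar tb].
  have [|p pE] := cs (h (t, w)) (fh _ _); first by rewrite gh.
  have [|q qn] := germ_section _ pE; first by apply: cr; rewrite ?fh ?gh.
  have [eps e0 qP] := near_fiber qn; exists eps => // s s' ts st ts' st' as_ sb.
  by exists q => x xw /andP[sx xs']; rewrite (hE xw); apply: qP; lra.
have sb : s <= b by lra. have as_ : a <= s by lra.
have [p pP] := Prs ar sb; have [q qP] := Pst as_ tb.
pose x0 := h (s, w).
have [px dpx] : regular p x0 /\ d1 x0 (p x0) = c x0.
  by apply: pP; rewrite ?fh ?gh //; lra.
have [qx dqx] : regular q x0 /\ d1 x0 (q x0) = c x0.
  by apply: qP; rewrite ?fh ?gh //; lra.
have [|v [u pq]] := ex x0 (fh _ _) (p x0 - q x0).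
  by rewrite homB dpx dqx subrr.
have [u' [u'r _ u'0]] := geA u.
exists (fun x => if g x <= s then p x else q x + (e v x + d0 x (u' x))) => x xw /andP[rx xt].
split.
  apply: regular_paste; first exact: (line_g L).
  - by move=> xs; apply: (pP x xw _).1; rewrite rx.
  - move=> sx; apply: regularD; first by apply: (qP x xw _).1; rewrite sx.
    by apply: regularD; [exact: er|apply: hom_reg; exact: u'r].
  - move=> gx; have -> : x = x0 by rewrite (hE xw) gx.
    by rewrite u'0 -pq addrC subrK.
case: ifPn => [xs|]; first by apply: (pP x xw _).2; rewrite rx.
rewrite -ltNge => /ltW sx; rewrite !homD d1e dd !addr0.
by apply: (qP x xw _).2; rewrite sx.
Qed.

(** At both ends of a long segment [c] vanishes, so the solution is closed there and has the form e
    v + d0 u. The left term is subtracted everywhere, since [e v] and the extension of [u] are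
    global; on the right the constant [e v] that remains is the obstruction to bounded support. *)
Lemma solve_line (c : dprod C) w : fiber_section w c ->
  (forall x, f x = w -> forall p, d1 x p = 0 -> exists v u, p = e v x + d0 x u) ->
  (forall x, f x = w -> exists p, d1 x p = c x) ->
  exists (s : dprod B) (v : V) (M : R),
   [/\ forall x, f x = w -> regular s x,
       forall x, g x <= - M -> s x = 0,
       forall x, M <= g x -> s x = e v x
     & forall x, f x = w -> d1 x (s x) = c x].
Proof.
move=> [cr [M0 cM]] ex cs.
pose M : R := `|M0| + 1.
have M_gt0 : 0 < M by rewrite /M ltr_wpDl.
have M0M : M0 <= M by rewrite /M; have := ler_norm M0; lra.
have {}cM x : M <= `|g x| -> c x = 0 by move=> Mx; apply: cM; lra.
have MM : - M <= M by lra.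
have [s sP] := solve_segment MM ex (fun x xw _ => cr x xw) (fun x xw _ => cs x xw).
pose xl := h (- M, w); pose xr := h (M, w).
have [slr dsl] : regular s xl /\ d1 xl (s xl) = c xl by apply: sP; rewrite ?fh ?gh //; lra.
have [srr dsr] : regular s xr /\ d1 xr (s xr) = c xr by apply: sP; rewrite ?fh ?gh //; lra.
rewrite cM in dsl; last by rewrite gh normrN ger0_norm // ltW.
rewrite cM in dsr; last by rewrite gh ger0_norm // ltW.
have [v [u slE]] := ex xl (fh _ _) _ dsl.
have [u' [u'r _ u'0]] := geA u.
(* This normalisation makes the solution vanish at the left end, so that it can be continued by
   0. *)
pose s1 : dprod B := fun x => s x - (e v x + d0 x (u' x)).
have s1r x : f x = w -> - M <= g x <= M -> regular s1 x.
  move=> xw xM; apply: regularB; first by have [] := sP x xw xM.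
  by apply: regularD; [exact: er|apply: hom_reg; exact: u'r].
have ds1 x : f x = w -> - M <= g x <= M -> d1 x (s1 x) = c x.
  by move=> xw xM; rewrite /s1 homB homD d1e dd addr0 subr0; have [] := sP x xw xM.
have s1l : s1 xl = 0 by rewrite /s1 slE u'0 subrr.
have xrM : - M <= g xr <= M by rewrite gh; lra.
have ds1r : d1 xr (s1 xr) = 0.
  by rewrite ds1 ?fh // cM // gh ger0_norm // ltW.
have [v1 [u1 s1rE]] := ex xr (fh _ _) _ ds1r.
have [u2 [u2r [M2 u2M] u20]] := geA u1.
pose s2 : dprod B := fun x => if g x <= - M then 0 else s1 x.
(* Subtracting the bounded section [d0 u2] makes the germ at the right end exactly [e v1], while far
   to the left nothing changes. *)
pose s3 : dprod B := fun x => if g x <= M then s2 x - d0 x (u2 x) else e v1 x.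
have s2r x : f x = w -> g x <= M -> regular s2 x.
  move=> xw xM; apply: regular_paste; [exact: (line_g L)|by move=> _; exact: regular_cst0| |].
    by move=> Mx; apply: s1r; rewrite ?Mx.
  by move=> gx; have -> : x = xl by rewrite (hE xw) gx.
exists s3, v1, (`|M2| + M + 1); split.
- move=> x xw; apply: regular_paste; [exact: (line_g L)| |by move=> _; exact: er|].
    by move=> xM; apply: regularB; [exact: s2r|apply: hom_reg; exact: u2r].
  move=> gx; have -> : x = xr by rewrite (hE xw) gx.
  rewrite /s2 gh ifN; last by rewrite -ltNge; lra.
  by rewrite u20 s1rE addrK.
- move=> x xM; have := normr_ge0 M2 => ?; rewrite /s3 ifT; last by lra.
  rewrite /s2 ifT; last by lra.
  rewrite u2M ?hom0 ?subrr // -normrN; apply: le_trans (ler_norm _).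
  by have := ler_norm M2; lra.
- by move=> x xM; have := normr_ge0 M2 => ?; rewrite /s3 ifN // -ltNge; lra.
- move=> x xw; rewrite /s3; case: ifPn => [xM|].
    rewrite homB dd subr0 /s2; case: ifPn => [Mx|]; last first.
      by rewrite -ltNge => Mx; apply: ds1 => //; rewrite xM ltW.
    by rewrite hom0 cM // -normrN; apply: le_trans (ler_norm _); lra.
  rewrite -ltNge => Mx; rewrite d1e cM //; apply: le_trans (ler_norm _).
  exact: ltW.
Qed.

End Solve.

End Line.

(** * Resolutions of quotients of constant sheaves *)

Section LineImage.
Variables (R : realType) (K : fieldType) (X W : topologicalType).
Variables (f : X -> W) (g : X -> R) (h : R * W -> X).
Hypothesis L : is_line f g h.

Let fh t w : f (h (t, w)) = w. Proof. exact: (line_fh L). Qed.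
Let gh t w : g (h (t, w)) = t. Proof. exact: (line_gh L). Qed.
Let hE x w : f x = w -> x = h (g x, w). Proof. by move=> <-; rewrite (line_hK L). Qed.

Lemma fiber_bounded_in (F : sheaf K X) w (s : dprod F) :
  (forall x, f x = w -> regular s x) ->
  (exists M : R, forall x, f x = w -> M <= `|g x| -> s x = 0) ->
  shriek_in f w (on_fiber f s w).
Proof.
move=> sr [M sM]; pose N := `|M|.
have sN x : f x = w -> N <= `|g x| -> s x = 0.
  by move=> xw Nx; apply: sM => //; apply: le_trans Nx; exact: ler_norm.
apply/(shriek_inP L); exists (cut g (- N) N s).
  apply: (cut_fiber_section L) => [x xw _|x xw xN|x xw xN]; first exact: sr.
  - by apply: sN => //; rewrite xN normrN ger0_norm /N.
  - by apply: sN => //; rewrite xN ger0_norm /N.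
apply: functional_extensionality_dep => x; rewrite /on_fiber /cut.
case: asboolP => // xw; case: ifPn => [xN|]; first case: ifPn => // xN'.
- by apply: sN => //; rewrite -normrN; apply: le_trans (ler_norm _); lra.
- by rewrite -ltNge => xN; apply: sN => //; apply: le_trans (ler_norm _); lra.
Qed.

(** Without constant classes, that is with [e] equal to 0, the obstruction of [solve_line] is 0 and
    its primitive is bounded on both sides. *)
Lemma solve_compact (A B C : sheaf K X) (d0 : hom A B) (d1 : hom B C)
    (c : dprod C) w :
  (forall x u, d1 x (d0 x u) = 0) -> germ_extendable g A -> fiber_section f g w c ->
  (forall x, f x = w -> forall p, d1 x p = 0 -> exists u, p = d0 x u) ->
  (forall x, f x = w -> exists p, d1 x p = c x) ->
  exists2 s : shriek_sheaf f B w, True &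
    forall x, f x = w -> d1 x (subsp_val s x) = c x.
Proof.
move=> dd geA cw ex sol.
have [|||s [_ [M [sr sl sR sd]]]] := @solve_line R K X W f g h L A B C d0 d1 unit
  (fun _ => (0 : dprod B)) _ _ dd geA c w cw _ sol.
- by move=> _ x; exact: regular_cst0.
- by move=> _ x; exact: hom0.
- by move=> x xw p /(ex x xw)[u ->]; exists tt, u; rewrite add0r.
have sw : shriek_in f w (on_fiber f s w).
  apply: fiber_bounded_in => //; exists M => x _; rewrite ler_normr => /orP[|xM].
    exact: sR.
  by apply: sl; lra.
exists (@Subsp _ _ (shriek_space f B w) _ sw) => // x xw.
by rewrite /= /on_fiber asboolT //; exact: sd.
Qed.

End LineImage.

(* A complex P whose only cohomology is, in degree 0, the quotient of the
   constant sheaf V by the subspaces Ker x; e sends a vector to the constant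
   section that it defines. *)
Record resolves (K : fieldType) (X : topologicalType) (V : lmodType K)
    (Ker : X -> V -> Prop) (P : cpx K X) (e : V -> dprod (P 0)) : Prop := Resolves {
  res_lin : linear e;
  res_reg : forall v x, regular (e v) x;
  res_dif : forall v x, dif P 0 x (e v x) = 0;
  res_ker : forall v x, Ker x v <-> e v x = 0;
  res_im : forall v x u, e v x = dif P (-1) x u -> e v x = 0;
  res_0 : forall x p, dif P 0 x p = 0 -> exists v u, p = e v x + dif P (-1) x u;
  res_n : forall (n : int) x (p : P (n + 1) x), n + 1 <> 0 ->
    dif P (n + 1) x p = 0 -> exists u, p = dif P n x u
}.

(** Writing a degree as a successor gives its terms an incoming differential without any cast. *)
Lemma int_succ_ind (Q : int -> Prop) : (forall m, Q (m + 1)) -> forall n, Q n.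
Proof. by move=> Qs n; rewrite -[n](subrK 1); exact: Qs. Qed.

Section Resolves.
Variables (K : fieldType) (X : topologicalType) (V : lmodType K).
Variables (Ker : X -> V -> Prop) (P : cpx K X) (e : V -> dprod (P 0)).
Hypothesis rP : resolves Ker e.

Lemma res_D u v x : e (u + v) x = e u x + e v x.
Proof. by have := res_lin rP 1 u v; rewrite !scale1r => ->. Qed.

Lemma res_Z a v x : e (a *: v) x = a *: e v x.
Proof.
have e0 : e 0 = 0.
  by have := res_lin rP (-1) 0 0; rewrite scaler0 addr0 scaleN1r addNr.
by have := res_lin rP a v 0; rewrite !addr0 e0 addr0 => ->.
Qed.

Lemma res_00 x : e 0 x = 0.
Proof. by have := res_Z 0 0 x; rewrite !scale0r. Qed.

Lemma res_N v x : e (- v) x = - e v x.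
Proof. by rewrite -scaleN1r res_Z scaleN1r. Qed.

Lemma res_B u v x : e (u - v) x = e u x - e v x.
Proof. by rewrite res_D res_N. Qed.

Lemma ker_eq x v v' (u u' : P (-1) x) :
  e v x + dif P (-1) x u = e v' x + dif P (-1) x u' -> Ker x (v - v').
Proof.
move=> E; apply/(res_ker rP); apply: (res_im rP (u := u' - u)).
move/eqP: E; rewrite -subr_eq => /eqP E.
by rewrite res_B homB -E -addrA opprD addrA subrr add0r opprB.
Qed.

Lemma ker0 x : Ker x 0.
Proof. by apply/(res_ker rP); exact: res_00. Qed.

Lemma kerN x v : Ker x v -> Ker x (- v).
Proof. by rewrite !(res_ker rP) res_N => ->; rewrite oppr0. Qed.

(** The predicate only speaks of cohomology on stalks and of constant sections, and [q] carries
    both; hence the choice of a resolution does not matter. *)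
Lemma res_quasi (Q : cpx K X) (q : cpx_hom P Q) : quasi_iso q ->
  resolves Ker (fun v => (fun x => q 0 x (e v x)) : dprod (Q 0)).
Proof.
move=> qq; split.
- move=> a u v; apply: functional_extensionality_dep => x.
  by rewrite (res_lin rP) /=; exact: hom_lin.
- by move=> v x; apply: hom_reg; exact: (res_reg rP).
- by move=> v x; rewrite cpx_mapP (res_dif rP) hom0.
- move=> v x; rewrite (res_ker rP); split=> [->|qe]; first exact: hom0.
  have [inj _] := qq (-1) x.
  have [|u eu] := inj (e v x) (res_dif rP v x).
    by exists 0; rewrite hom0.
  exact: (res_im rP eu).
- move=> v x u qe; have [inj _] := qq (-1) x.
  have [|u' eu] := inj (e v x) (res_dif rP v x); first by exists u.
  by rewrite (res_im rP eu) hom0.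
- move=> x p dp; have [_ /(_ p dp)[v dv [u ->]]] := qq (-1) x.
  have [v' [u' ->]] := res_0 rP dv; exists v', (q (-1) x u' + u).
  by rewrite !homD addrA; congr (_ + _ + _); rewrite cpx_mapP.
- move=> n x p n0 dp; have [_ /(_ p dp)[v dv [u ->]]] := qq n x.
  have [u' ->] := res_n rP n0 dv; exists (q n x u' + u).
  by rewrite homD cpx_mapP.
Qed.

(** The sum of the subspaces [Ker x] over a possibly infinite index set, inductive so that finite
    sums are built and destroyed one summand at a time. *)
Inductive sum_ker (Q : X -> Prop) : V -> Prop :=
| sum_ker0 : sum_ker Q 0
| sum_kerD x k v of Q x & Ker x k & sum_ker Q v : sum_ker Q (k + v).

Lemma sum_ker_add Q u v : sum_ker Q u -> sum_ker Q v -> sum_ker Q (u + v).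
Proof.
elim=> [|x k u' Qx xk _ IH]; first by rewrite add0r.
by move=> /IH s; rewrite -addrA; exact: sum_kerD xk s.
Qed.

Lemma sum_ker_opp Q v : sum_ker Q v -> sum_ker Q (- v).
Proof.
elim=> [|x k u' Qx xk _ IH]; first by rewrite oppr0; exact: sum_ker0.
by rewrite opprD; apply: sum_kerD (kerN xk) IH.
Qed.

Lemma sum_ker1 (Q : X -> Prop) x k : Q x -> Ker x k -> sum_ker Q k.
Proof. by move=> Qx xk; rewrite -[k]addr0; apply: sum_kerD xk (sum_ker0 _). Qed.

Lemma sum_ker_sub (Q Q' : X -> Prop) v : (forall x, Q x -> Q' x) ->
  sum_ker Q v -> sum_ker Q' v.
Proof.
move=> QQ'; elim=> [|x k u /QQ' Qx xk _ IH]; first exact: sum_ker0.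
exact: sum_kerD xk IH.
Qed.

End Resolves.

Section LineResolves.
Variables (R : realType) (K : fieldType) (X W : topologicalType).
Variables (f : X -> W) (g : X -> R) (h : R * W -> X).
Hypothesis L : is_line f g h.

Let fh t w : f (h (t, w)) = w. Proof. exact: (line_fh L). Qed.
Let gh t w : g (h (t, w)) = t. Proof. exact: (line_gh L). Qed.
Let hE x w : f x = w -> x = h (g x, w). Proof. by move=> <-; rewrite (line_hK L). Qed.

Variables (V : lmodType K) (Ker : X -> V -> Prop) (P : cpx K X).
Variable e : V -> dprod (P 0).
Hypothesis rP : resolves Ker e.
Hypothesis geP : forall n, germ_extendable g (P n).

Lemma fiber_closed n w (p : shriek_cpx f P n w) s : dif (shriek_cpx f P) n w p = 0 ->
  subsp_val p = on_fiber f s w -> forall x, f x = w -> dif P n x (s x) = 0.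
Proof.
move=> /(congr1 (fun u : shriek_stalk f (P (n + 1)) w => subsp_val u)) dp ps x xw.
have := congr1 (fun u : dprod (P (n + 1)) => u x) dp.
by rewrite /= /hom_section ps /on_fiber asboolT.
Qed.

Lemma shriek_eq (F : sheaf K X) w (p q : shriek_sheaf f F w) :
  (forall x, f x = w -> subsp_val p x = subsp_val q x) -> p = q.
Proof.
move=> pq; apply: subsp_inj; apply: functional_extensionality_dep => x.
have [xw|xw] := pselect (f x = w); first exact: pq.
have [_ [sp [_ _ _ ->]]] := subsp_valP p; have [_ [sq [_ _ _ ->]]] := subsp_valP q.
by rewrite /on_fiber asboolF.
Qed.

Lemma shriek_rep (F : sheaf K X) w (p : shriek_sheaf f F w) :
  exists2 s, fiber_section f g w s & subsp_val p = on_fiber f s w.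
Proof. exact/(shriek_inP L)/(subsp_valP p). Qed.

(** Primitives are sought in degree n + 1, where [P] has no cohomology: two of them differ locally
    by an exact term, and [solve_compact] applies. *)
Lemma shriek_exact n : n + 1 <> 0 -> forall w (p : shriek_cpx f P (n + 1 + 1) w) s,
  fiber_section f g w s -> subsp_val p = on_fiber f s w ->
  (forall x, f x = w -> exists q, s x = dif P (n + 1) x q) ->
  exists u, p = dif (shriek_cpx f P) (n + 1) w u.
Proof.
move=> n0 w p s sw ps sol.
have ex x : f x = w -> forall q : P (n + 1) x, dif P (n + 1) x q = 0 ->
    exists u, q = dif P n x u.
  by move=> _ q dq; exact: (res_n rP n0 dq).
have sol' x : f x = w -> exists q, dif P (n + 1) x q = s x.
  by move=> /sol[q ->]; exists q.
have [u _ uE] := solve_compact L (@dif_dif _ _ P n) (@geP n) sw ex sol'.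
exists u; apply: shriek_eq => x xw; rewrite ps /on_fiber asboolT //.
by rewrite /= /hom_section uE.
Qed.

Section ConstantImage.
Hypothesis bounded_ker : forall w : W, exists M : R, \forall w' \near w,
  forall x, f x = w' -> M <= `|g x| -> forall v, Ker x v.
(** The supports along a fibre are intervals: what is dead at [x0] is dead on the whole left or on
    the whole right, up to a decomposition of the vector. *)
Hypothesis ker_split : forall x0 v, Ker x0 v -> exists k1 k2,
  [/\ v = k1 + k2, forall x, f x = f x0 -> g x <= g x0 -> Ker x k1
    & forall x, f x = f x0 -> g x0 <= g x -> Ker x k2].

(** Locally a closed section is constant up to exact terms. Sweeping the fibre, the vectors of
    adjacent segments differ by an element of [Ker] at the junction, which [ker_split] distributes
    between the two sides. *)
Lemma shriek_class w (s : dprod (P 0)) : fiber_section f g w s ->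
  (forall x, f x = w -> dif P 0 x (s x) = 0) ->
  exists v, forall x, f x = w -> exists u, s x = e v x + dif P (-1) x u.
Proof.
move=> [sr [M0 sM]] ds; have [M1 /nbhs_singleton kM] := bounded_ker w.
pose N : R := `|M0| + `|M1|.
have N0 : - N <= N by rewrite /N; have := normr_ge0 M0; have := normr_ge0 M1; lra.
have NM0 : M0 <= N.
  by rewrite /N; have := ler_norm M0; have := normr_ge0 M1; lra.
have NM1 : M1 <= N.
  by rewrite /N; have := ler_norm M1; have := normr_ge0 M0; lra.
pose Q r t := exists v, forall x, f x = w -> r <= g x <= t ->
  exists u, s x = e v x + dif P (-1) x u.
have [v vP] : Q (- N) N.
  apply: cousin => // [c _|r t t' rt tt' [v vP] [v' vP']].
    have [v [u su]] := res_0 rP (ds _ (fh c w)).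
    have cr : regular (fun x => s x - e v x) (h (c, w)).
      by apply: regularB; [apply: sr; exact: fh|exact: (res_reg rP)].
    have due : dif P (-1) (h (c, w)) u = s (h (c, w)) - e v (h (c, w)).
      by rewrite su (addrC (e _ _)) addrK.
    have [a an] := germ_section cr due.
    have [eps e0 aP] := near_fiber L an; exists eps => // r t cr' rc ct tc.
    exists v => x xw /andP[rx xt]; exists (a x); rewrite (hE xw).
    have [||_ ->] := aP (g x); [lra|lra|].
    by rewrite addrC subrK.
  pose x0 := h (t, w).
  have [|u su] := vP x0 (fh _ _); first by rewrite gh; lra.
  have [|u' su'] := vP' x0 (fh _ _); first by rewrite gh; lra.
  have /ker_split[k1 [k2 [kE k1P k2P]]] : Ker x0 (v - v').
    by apply: (ker_eq rP (u := u) (u' := u')); rewrite -su.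
  rewrite fh gh in k1P k2P.
  (* On the left [k1] is dead, so v - k1 still represents [s]; it also equals v' + k2, and [k2] is
     dead on the right. *)
  exists (v - k1) => x xw /andP[rx xt'].
  have [xt|xt] := leP (g x) t.
    have [|u1 ->] := vP x xw; first by lra.
    exists u1; rewrite (res_B rP); congr (_ + _).
    by have /(res_ker rP) -> := k1P x xw xt; rewrite subr0.
  have [|u1 ->] := vP' x xw; first by lra.
  exists u1; congr (_ + _).
  have -> : v - k1 = v' + k2.
    by apply/eqP; rewrite subr_eq -addrA [k2 + _]addrC -kE addrC subrK.
  by rewrite (res_D rP); have /(res_ker rP) -> := k2P x xw (ltW xt); rewrite addr0.
exists v => x xw; have [xN|xN] := leP `|g x| N.
  by apply: vP => //; rewrite -ler_norml.
exists 0; rewrite hom0 addr0 sM; last by lra.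
by have /(res_ker rP) -> : Ker x v by apply: kM => //; lra.
Qed.

(** By [bounded_ker] the constant sections themselves have proper support, so they descend to the
    direct image; such a section dies over [w] exactly when it dies along the whole fibre, whence
    the intersection. *)
Lemma resolves_shriek : exists e' : V -> dprod (shriek_cpx f P 0),
  resolves (fun w v => forall x, f x = w -> Ker x v) e'.
Proof.
have pe v : proper_section f setT (e v).
  apply: (proper_of_bounded L) => [|x _|w _]; first exact: openT.
    exact: (res_reg rP).
  have [M Mn] := bounded_ker w; exists M; apply: filterS Mn => w' H x xw xM.
  by apply/(res_ker rP); exact: H.
have ein v w : shriek_in f w (on_fiber f (e v) w).
  by exists setT, (e v); split=> //; exact: openT.
pose e' v : dprod (shriek_cpx f P 0) :=
  fun w => @Subsp _ _ (shriek_space f (P 0) w) _ (ein v w).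
have e'E v w x : f x = w -> subsp_val (e' v w) x = e v x.
  by move=> xw; rewrite /= /on_fiber asboolT.
exists e'; split.
- move=> a u v; apply: functional_extensionality_dep => w; apply: shriek_eq => x xw.
  rewrite e'E // (res_lin rP).
  by rewrite -[RHS]/(a *: subsp_val (e' u w) x + subsp_val (e' v w) x) !e'E.
- by move=> v w; exists setT, (e v); split=> //; exact: openT.
- move=> v w; apply: shriek_eq => x xw.
  by rewrite -[LHS]/(dif P 0 x (subsp_val (e' v w) x)) e'E // (res_dif rP).
- move=> v w; split=> [kv|e0 x xw].
    by apply: shriek_eq => x xw; rewrite e'E //; apply/(res_ker rP)/kv.
  by apply/(res_ker rP); rewrite -(e'E v w x xw) e0.
- move=> v w u eu; apply: shriek_eq => x xw; rewrite e'E //.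
  apply: (res_im rP (u := subsp_val u x)).
  by rewrite -(e'E v w x xw) eu.
- move=> w p dp; have [s sw ps] := shriek_rep p.
  have ds := fiber_closed dp ps.
  have [v vP] := shriek_class sw ds; exists v.
  pose c := s - e v : dprod (P 0).
  have [sr [M0 sM]] := sw; have [M1 /nbhs_singleton kM] := bounded_ker w.
  have cin : shriek_in f w (on_fiber f c w).
    apply: (fiber_bounded_in L) => [x xw|].
      by apply: regularB; [exact: sr|exact: (res_reg rP)].
    exists (`|M0| + `|M1|) => x xw xM.
    have := ler_norm M0; have := ler_norm M1; have := normr_ge0 M0; have := normr_ge0 M1.
    move=> *; rewrite /c -[LHS]/(s x - e v x) sM; last by lra.
    have /(res_ker rP) ev : Ker x v by apply: kM => //; lra.
    by rewrite ev subr0.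
  have [c' c'w cc'] := (shriek_inP L _ _).1 cin.
  have cx x : f x = w -> c' x = c x.
    move=> xw; have := congr1 (fun u : dprod (P 0) => u x) cc'.
    by rewrite /on_fiber asboolT.
  (* [Negz 1] is -2: the section s - e v has degree 0 and its primitive has degree -1. *)
  have [||u uE] := @shriek_exact (Negz 1) _ w (@Subsp _ _ (shriek_space f (P 0) w) _ cin) c' c'w cc'.
  + by [].
  + move=> x xw; have [u su] := vP x xw; exists u.
    by rewrite cx // -[LHS]/(s x - e v x) su (addrC (e _ _)) addrK.
  exists u; apply: shriek_eq => x xw.
  rewrite -[RHS]/(subsp_val (e' v w) x + subsp_val (dif (shriek_cpx f P) (-1) w u) x).
  rewrite -uE e'E // ps /= /on_fiber asboolT // -[c x]/(s x - e v x).
  by rewrite addrC subrK.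
- move=> n; elim/int_succ_ind: n => n w p n0 dp.
  have [s sw ps] := shriek_rep p; have ds := fiber_closed dp ps.
  have sol x : f x = w -> exists q, s x = dif P (n + 1) x q.
    by move=> xw; exact: (res_n rP n0 (ds x xw)).
  have [n1|] := eqVneq (n + 1) 0; last first.
    by move=> /eqP n1; exact: (shriek_exact n1 sw ps sol).
  (* Here [p] has degree 1. The constant that [solve_line] leaves on the right vanishes far out by
     [bounded_ker], so it is no obstruction to a bounded primitive. *)
  have nE : n = -1 by lia.
  subst n; have [M1 /nbhs_singleton kM] := bounded_ker w.
  have ex x : f x = w -> forall q : P 0 x, dif P 0 x q = 0 ->
      exists v u, q = e v x + dif P (-1) x u by move=> _ q; exact: (res_0 rP).
  have sol' x : f x = w -> exists q, dif P 0 x q = s x.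
    by move=> /sol[q ->]; exists q.
  have [b [v [M [br bl bR bd]]]] := solve_line L (res_reg rP) (res_dif rP)
    (@dif_dif _ _ P (-1)) (@geP (-1)) sw ex sol'.
  have bin : shriek_in f w (on_fiber f b w).
    apply: (fiber_bounded_in L) => //; exists (`|M| + `|M1|) => x xw xM.
    have := ler_norm M; have := ler_norm M1; have := normr_ge0 M; have := normr_ge0 M1.
    move=> *; move: (xM); rewrite ler_normr => /orP[] xM'.
      rewrite bR; last by lra.
      by apply/(res_ker rP); apply: kM => //; lra.
    by apply: bl; lra.
  exists (@Subsp _ _ (shriek_space f (P 0) w) _ bin); apply: shriek_eq => x xw.
  rewrite ps -[RHS]/(dif P 0 x (on_fiber f b w x)) /on_fiber !asboolT //.
  by rewrite bd.
Qed.

End ConstantImage.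

End LineResolves.

(** * Top cohomology along a line, and truncation *)

Section LineTop.
Variables (R : realType) (K : fieldType) (X W : topologicalType).
Variables (f : X -> W) (g : X -> R) (h : R * W -> X).
Hypothesis L : is_line f g h.

Let fh t w : f (h (t, w)) = w. Proof. exact: (line_fh L). Qed.
Let gh t w : g (h (t, w)) = t. Proof. exact: (line_gh L). Qed.
Let hE x w : f x = w -> x = h (g x, w). Proof. by move=> <-; rewrite (line_hK L). Qed.

Variables (V : lmodType K) (Ker : X -> V -> Prop) (P : cpx K X).
Variable e : V -> dprod (P 0).
Hypothesis rP : resolves Ker e.
Hypothesis geP : forall n, germ_extendable g (P n).

(** Near each point [s] is a constant plus an exact term. A vector representing [s] at a point
    differs from the local constant by an element of [Ker] there, and these differences add up along
    the segment. *)
Lemma class_chain w (s : dprod (P 0)) (a b : R) : a <= b ->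
  (forall x, f x = w -> a <= g x <= b -> regular s x) ->
  (forall x, f x = w -> a <= g x <= b -> dif P 0 x (s x) = 0) ->
  forall v v', (exists u, s (h (a, w)) = e v (h (a, w)) + dif P (-1) _ u) ->
  (exists u, s (h (b, w)) = e v' (h (b, w)) + dif P (-1) _ u) ->
  sum_ker Ker (fun x => f x = w /\ a <= g x <= b) (v' - v).
Proof.
move=> ab sr ds.
pose Q r t := a <= r -> t <= b ->
  forall v v', (exists u, s (h (r, w)) = e v (h (r, w)) + dif P (-1) _ u) ->
  (exists u, s (h (t, w)) = e v' (h (t, w)) + dif P (-1) _ u) ->
  sum_ker Ker (fun x => f x = w /\ r <= g x <= t) (v' - v).
have : Q a b; last by apply.
apply: cousin => // [c cab|r t t' rt tt' Qrt Qtt' ar t'b v v' Ev Ev'].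
  have cw : f (h (c, w)) = w by exact: fh.
  have cg : a <= g (h (c, w)) <= b by rewrite gh.
  have [v0 [u0 su]] := res_0 rP (ds _ cw cg).
  have cr : regular (fun x => s x - e v0 x) (h (c, w)).
    by apply: regularB; [exact: sr|exact: (res_reg rP)].
  have due : dif P (-1) (h (c, w)) u0 = s (h (c, w)) - e v0 (h (c, w)).
    by rewrite su (addrC (e _ _)) addrK.
  have [z zn] := germ_section cr due.
  have [eps e0 zP] := near_fiber L zn; exists eps => // r t cr' rc ct tc.
  move=> ar tb v v' [u Eu] [u' Eu'].
  have zE x : c - eps < x -> x < c + eps ->
      s (h (x, w)) = e v0 (h (x, w)) + dif P (-1) _ (z (h (x, w))).
    by move=> x1 x2; have [_ ->] := zP x x1 x2; rewrite addrC subrK.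
  have k1 : Ker (h (r, w)) (v0 - v).
    by apply: (ker_eq rP (u := z (h (r, w))) (u' := u)); rewrite -Eu -zE //; lra.
  have k2 : Ker (h (t, w)) (v' - v0).
    by apply: (ker_eq rP (u := u') (u' := z (h (t, w)))); rewrite -Eu' -zE //; lra.
  have -> : v' - v = (v' - v0) + (v0 - v) by rewrite addrA subrK.
  apply: (sum_kerD (x := h (t, w))) => //.
    by rewrite fh gh; split=> //; lra.
  apply: (@sum_ker1 _ _ _ _ _ (h (r, w)) _ _ k1).
  by rewrite fh gh; split=> //; lra.
have tab : a <= g (h (t, w)) <= b by rewrite gh; lra.
have [v0 E0] := res_0 rP (ds _ (fh t w) tab).
have -> : v' - v = (v0 - v) + (v' - v0) by rewrite [RHS]addrC addrA subrK.
apply: sum_ker_add.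
  apply: (@sum_ker_sub _ _ _ _ (fun x => f x = w /\ r <= g x <= t)).
    by move=> x [-> ?]; split=> //; lra.
  by apply: Qrt => //; lra.
apply: (@sum_ker_sub _ _ _ _ (fun x => f x = w /\ t <= g x <= t')).
  by move=> x [-> ?]; split=> //; lra.
by apply: Qtt' => //; lra.
Qed.

Definition fiber_sum w := sum_ker Ker (fun x => f x = w).

(* The class of c in degree 1, read off a primitive s of c that vanishes on the
   left: on the right, s is the closed section defined by v. *)
Definition prim w (c : shriek_cpx f P (0 + 1) w) (v : V) :=
  exists (s : dprod (P 0)) (M : R), [/\ forall x, f x = w -> regular s x,
    forall x, g x <= - M -> s x = 0, forall x, M <= g x -> s x = e v x
    & forall x, f x = w -> dif P 0 x (s x) = subsp_val c x].

Lemma prim_ex w (c : shriek_cpx f P (0 + 1) w) :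
  dif (shriek_cpx f P) (0 + 1) w c = 0 -> exists v, prim c v.
Proof.
move=> dc; have [s sw cs] := shriek_rep L c; have ds := fiber_closed dc cs.
have ex x : f x = w -> forall q : P 0 x, dif P 0 x q = 0 ->
    exists v u, q = e v x + dif P (-1) x u by move=> _ q; exact: (res_0 rP).
have sol x : f x = w -> exists q, dif P 0 x q = s x.
  by move=> xw; have [//|q ->] := res_n rP (n := 0) _ (ds x xw); exists q.
have [b [v [M [br bl bR bd]]]] := solve_line L (res_reg rP) (res_dif rP)
  (@dif_dif _ _ P (-1)) (@geP (-1)) sw ex sol.
exists v, b, M; split=> // x xw.
by rewrite bd // cs /on_fiber asboolT.
Qed.

Lemma prim_lin w a (c c' : shriek_cpx f P (0 + 1) w) v v' :
  prim c v -> prim c' v' -> prim (a *: c + c') (a *: v + v').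
Proof.
move=> [s [M [sr sl sR sd]]] [s' [M' [sr' sl' sR' sd']]].
exists (a *: s + s'), (`|M| + `|M'|).
have := ler_norm M; have := ler_norm M'; have := normr_ge0 M; have := normr_ge0 M'.
move=> M1 M2 M3 M4; split.
- by move=> x xw; apply: regular_lin; [exact: sr|exact: sr'].
- move=> x xM; rewrite -[LHS]/(a *: s x + s' x) sl ?sl' ?scaler0 ?addr0 //; lra.
- move=> x xM; rewrite -[LHS]/(a *: s x + s' x) sR ?sR' ?(res_lin rP) //; lra.
- move=> x xw; rewrite -[LHS]/(dif P 0 x (a *: s x + s' x)) hom_lin sd // sd' //.
Qed.

(** Such an [s] leads from the class 0 on the left to the class [v] on the right, which is the
    situation of [class_chain]. *)
Lemma prim_closed_diff w (s : dprod (P 0)) v (M : R) :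
  (forall x, f x = w -> regular s x) ->
  (forall x, g x <= - M -> s x = 0) -> (forall x, M <= g x -> s x = e v x) ->
  (forall x, f x = w -> dif P 0 x (s x) = 0) -> fiber_sum w v.
Proof.
move=> sr sl sR ds.
have MM : - `|M| <= `|M| by have := normr_ge0 M; lra.
apply: (@sum_ker_sub _ _ _ _ (fun x => f x = w /\ - `|M| <= g x <= `|M|)).
  by move=> x [].
rewrite -[v]subr0; apply: (class_chain (s := s)) => //.
- by move=> x xw _; exact: sr.
- by move=> x xw _; exact: ds.
- exists 0; rewrite hom0 (res_00 rP) addr0 sl // gh.
  by have := ler_norm M; lra.
- by exists 0; rewrite hom0 addr0 sR // gh ler_norm.
Qed.

(** If [c] is the differential of a bounded [b], then s - b is closed and leads from 0 to [e v].
    Conversely, a sum of vectors dying at points of the fibre is realised by a closed section [t]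
    with the same behaviour as [s] at both ends, and s - t is a bounded primitive. *)
Lemma prim_im w (c : shriek_cpx f P (0 + 1) w) v : prim c v ->
  (exists u, c = dif (shriek_cpx f P) 0 w u) <-> fiber_sum w v.
Proof.
move=> [s [M [sr sl sR sd]]]; split=> [[u cu]|].
  have [b [br [N bN]] ub] := shriek_rep L u.
  have := ler_norm M; have := ler_norm N; have := normr_ge0 M; have := normr_ge0 N.
  move=> M1 M2 M3 M4.
  apply: (@prim_closed_diff w (s - b) v (`|M| + `|N|)).
  - by move=> x xw; apply: regularB; [exact: sr|exact: br].
  - move=> x xM; rewrite -[LHS]/(s x - b x) sl ?bN ?subr0 //; last by lra.
    by rewrite -normrN; apply: le_trans (ler_norm _); lra.
  - move=> x xM; rewrite -[LHS]/(s x - b x) sR ?bN ?subr0 //; last by lra.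
    by apply: le_trans (ler_norm _); lra.
  - move=> x xw; rewrite -[LHS]/(dif P 0 x (s x - b x)) homB sd //.
    have -> : subsp_val c x = dif P 0 x (b x); last exact: subrr.
    by rewrite cu -[LHS]/(dif P 0 x (subsp_val u x)) ub /on_fiber asboolT.
move=> vw.
have [t [tr [N [tl tR]] td]] : exists t : dprod (P 0), [/\ forall x, f x = w -> regular t x,
    exists N : R, (forall x, f x = w -> g x <= - N -> t x = 0) /\
      (forall x, f x = w -> N <= g x -> t x = e v x)
    & forall x, dif P 0 x (t x) = 0].
  elim: vw => [|x0 k v0 xw0 xk _ [t [tr [N [tl tR]] td]]].
    exists 0; split=> [x _||x]; [exact: regular_cst0| |exact: hom0].
    by exists 0; split=> // x _ _; rewrite (res_00 rP).
  (* As [e k] vanishes at [x0], it can be switched on there: the step is a closed section, zero on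
     the left and [e k] on the right. *)
  exists (fun x => (if g x <= g x0 then 0 else e k x) + t x); split.
  - move=> x xw; apply: regularD; last exact: tr.
    apply: regular_paste; [exact: (line_g L)|by move=> _; exact: regular_cst0| |].
      by move=> _; exact: (res_reg rP).
    move=> gx; have -> : x = x0 by rewrite (hE xw) gx -(hE xw0).
    by have /(res_ker rP) -> := xk.
  - exists (`|N| + `|g x0|).
    have := ler_norm N; have := ler_norm (g x0); have := ler_norm (- g x0).
    rewrite normrN; have := normr_ge0 N; have := normr_ge0 (g x0) => M1 M2 M3 M4 M5.
    split=> x xw xN.
      by rewrite ifT ?tl ?addr0 //; lra.
    rewrite (res_D rP) tR //; last by lra.
    case: ifPn => // xx0; have -> : x = x0.
      by rewrite (hE xw) (hE xw0); congr (h (_, _)); lra.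
    by have /(res_ker rP) -> := xk.
  - move=> x; rewrite homD td addr0; case: ifP => _; first exact: hom0.
    exact: (res_dif rP).
have bin : shriek_in f w (on_fiber f (s - t) w).
  apply: (fiber_bounded_in L) => [x xw|].
    by apply: regularB; [exact: sr|exact: tr].
  have := ler_norm M; have := ler_norm N; have := normr_ge0 M; have := normr_ge0 N.
  move=> M1 M2 M3 M4; exists (`|M| + `|N|) => x xw.
  rewrite ler_normr -[(s - t) x]/(s x - t x) => /orP[] xM.
    by rewrite sR ?tR ?subrr //; lra.
  by rewrite sl ?tl ?subrr //; lra.
exists (@Subsp _ _ (shriek_space f (P 0) w) _ bin); apply: (shriek_eq) => x xw.
rewrite -[RHS]/(dif P 0 x (on_fiber f (s - t) w x)) /on_fiber asboolT //.
by rewrite -[(s - t) x]/(s x - t x) homB td subr0 sd.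
Qed.

Lemma prim_uniq w (c : shriek_cpx f P (0 + 1) w) v v' :
  prim c v -> prim c v' -> fiber_sum w (v - v').
Proof.
move=> cv cv'; have := prim_lin (-1) cv' cv.
rewrite !scaleN1r ![- _ + _]addrC subrr => c0; apply/(prim_im c0).
by exists 0; rewrite hom0.
Qed.

(** The bounded extension [t] of the germ of [e v] at 0 serves as a cut-off: [t] on the left and
    [e v] on the right paste to a primitive whose differential is bounded. *)
Lemma prim_surj w v : exists2 c, dif (shriek_cpx f P) (0 + 1) w c = 0 & prim c v.
Proof.
pose x0 := h (0 : R, w).
have [t [tr [M tM] t0]] := geP (e v x0).
have M0 := normr_ge0 M.
pose s : dprod (P 0) := fun x => if g x <= 0 then t x else e v x.
have sr x : f x = w -> regular s x.
  move=> xw; apply: regular_paste; [exact: (line_g L)|by move=> _; exact: tr| |].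
    by move=> _; exact: (res_reg rP).
  by move=> gx; have -> : x = x0 by rewrite (hE xw) gx.
pose N : R := `|M| + 1.
have sl x : g x <= - N -> s x = 0.
  rewrite /N => xN; rewrite /s ifT; last by lra.
  by apply: tM; rewrite -normrN; apply: le_trans (ler_norm _); have := ler_norm M; lra.
have sR x : N <= g x -> s x = e v x.
  by rewrite /N => xN; rewrite /s ifF //; apply/negbTE; rewrite -ltNge; lra.
pose c : dprod (P (0 + 1)) := fun x => dif P 0 x (s x).
have cin : shriek_in f w (on_fiber f c w).
  apply: (fiber_bounded_in L) => [x xw|]; first by apply: hom_reg; exact: sr.
  exists N => x xw; rewrite ler_normr /c => /orP[] xN.
    by rewrite sR // (res_dif rP).
  by rewrite sl ?hom0 //; lra.
exists (@Subsp _ _ (shriek_space f (P (0 + 1)) w) _ cin).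
  apply: (shriek_eq) => x xw.
  rewrite -[LHS]/(dif P (0 + 1) x (on_fiber f c w x)) /on_fiber asboolT //.
  exact: dif_dif.
by exists s, N; split=> // x xw; rewrite /= /on_fiber asboolT.
Qed.

(** The same primitive serves nearby fibres: by [tube] on the segment [-B, B], and outside it
    because [s] is 0 or [e v] there while [c] vanishes. So the class is locally constant and defines
    a map of sheaves. *)
Lemma prim_near (t : dprod (shriek_cpx f P (0 + 1))) w0 v : regular t w0 ->
  prim (t w0) v -> \forall w \near w0, prim (t w) v.
Proof.
move=> [U [c [oU Uw cU tU]]] [s [M [sr sl sR sd]]].
have [N cN] := bounded_of_proper (line_g L) oU cU Uw.
pose B : R := `|M| + `|N| + 1.
have := ler_norm M; have := ler_norm N; have := normr_ge0 M; have := normr_ge0 N.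
move=> M1 M2 M3 M4.
have cg : continuous g := line_g L.
have T : \forall w \near w0, forall x, f x = w -> - B <= g x <= B ->
    regular s x /\ dif P 0 x (s x) = c x.
  apply: (tube L) => x xw _; have sx := sr x xw.
  have cx : regular c x by apply: cU.1; rewrite xw.
  have e1 : dif P 0 x (s x) = c x.
    by rewrite sd // tU // /on_fiber asboolT.
  apply: filterS2 (regular_near sx) (regular_sep (hom_reg (dif P 0) sx) cx e1).
  by [].
apply: filterS3 T cN (open_nbhs_nbhs (conj oU Uw)) => w Tw cw Uw'.
exists s, M; split=> // x xw.
  have [xB|xB] := leP `|g x| B.
    by have [] := Tw x xw; rewrite -?ler_norml.
  move: xB; rewrite ltr_normr => /orP[xB|xB].
    apply: (regular_local _ (res_reg rP v x)).
    have Mx : M < g x by rewrite /B in xB; lra.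
    have : \forall y \near x, M < g y.
      exact: (@cvgr_gt R X (nbhs x) _ g (g x) (cg x)).
    by apply: filterS => y /ltW /sR ->.
  apply: (regular_local _ (regular_cst0 _ x)).
  have Mx : g x < - M by rewrite /B in xB; lra.
  have : \forall y \near x, g y < - M.
    exact: (@cvgr_lt R X (nbhs x) _ g (g x) (cg x)).
  by apply: filterS => y /ltW /sl ->.
rewrite tU // /on_fiber asboolT //.
have [xB|xB] := leP `|g x| B.
  by have [] := Tw x xw; rewrite -?ler_norml.
rewrite cw //; last by rewrite /B in xB; lra.
move: xB; rewrite ltr_normr => /orP[xB|xB].
  by rewrite sR ?(res_dif rP) //; rewrite /B in xB; lra.
by rewrite sl ?hom0 //; rewrite /B in xB; lra.
Qed.

(** The counterpart of [ker_split] when the supports are complements of intervals: a vector killed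
    both from the left and from the right is already dead at [x0]. *)
Hypothesis ker_cap : forall x0 v,
  sum_ker Ker (fun x => f x = f x0 /\ g x <= g x0) v ->
  sum_ker Ker (fun x => f x = f x0 /\ g x0 <= g x) v -> Ker x0 v.

(** The one new case is degree 0. A bounded closed section has class 0 at both far ends, so by
    [class_chain] its class at [x] is a sum of elements dying on the left, and likewise on the
    right; [ker_cap] makes the section locally exact. *)
Lemma shriek_exact_off1 n w (p : shriek_cpx f P (n + 1) w) : n + 1 <> 1 ->
  dif (shriek_cpx f P) (n + 1) w p = 0 ->
  exists u, p = dif (shriek_cpx f P) n w u.
Proof.
elim/int_succ_ind: n p => n p n1 dp.
have {}n1 : n + 1 <> 0 by lia.
have [s sw ps] := shriek_rep L p; have ds := fiber_closed dp ps.
have [n2|/eqP n2] := eqVneq (n + 1 + 1) 0; last first.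
  apply: (shriek_exact L rP geP n1 sw ps) => x xw.
  exact: (res_n rP n2 (ds x xw)).
(* [Negz 1] is -2, so [p] has degree 0 and a primitive of degree -1 is sought. *)
have nE : n = Negz 1 by lia.
subst n; apply: (shriek_exact L rP geP n1 sw ps) => x xw.
have [v [u su]] := res_0 rP (ds x xw).
suff /(res_ker rP) ev : Ker x v by exists u; rewrite su ev add0r.
have [sr [M sM]] := sw.
have M0 := ler_norm M; have M1 := ler_norm (g x); have := ler_norm (- g x).
rewrite normrN => M2; have M3 := normr_ge0 M; have M4 := normr_ge0 (g x).
pose B : R := `|M| + `|g x|.
have Bx : - B <= g x by rewrite /B; lra.
have xB : g x <= B by rewrite /B; lra.
have s0 t : `|t| = B -> exists u, s (h (t, w)) = e 0 (h (t, w)) + dif P (-1) _ u.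
  by move=> tB; exists 0; rewrite hom0 addr0 (res_00 rP) sM // gh tB /B; lra.
have sx : exists u, s (h (g x, w)) = e v (h (g x, w)) + dif P (-1) _ u.
  (* [u] lies over [x] and the goal speaks of [h (g x, w)], a point equal to [x] only up to a
     proof. *)
  by exists (ecast y (P (-1) y) (hE xw) u); case: _ / (hE xw).
have sl : sum_ker Ker (fun y => f y = w /\ - B <= g y <= g x) (v - 0).
  apply: (@class_chain w s) => //; [by move=> y yw _; exact: sr|by move=> y yw _; exact: ds|].
  by apply: s0; rewrite normrN ger0_norm // /B; lra.
have sR : sum_ker Ker (fun y => f y = w /\ g x <= g y <= B) (0 - v).
  apply: (@class_chain w s) => //; [by move=> y yw _; exact: sr|by move=> y yw _; exact: ds|].
  by apply: s0; rewrite ger0_norm // /B; lra.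
apply: ker_cap.
  rewrite subr0 in sl; apply: (sum_ker_sub _ sl) => y [yw /andP[]] //.
  by rewrite xw.
have := sum_ker_opp rP sR; rewrite sub0r opprK => {}sR.
by apply: (sum_ker_sub _ sR) => y [yw /andP[]] //; rewrite xw.
Qed.

End LineTop.

Section Truncation.
Variables (K : fieldType) (X : topologicalType).

Section SubSheaf.
Variables (F : sheaf K X) (S : forall x, subspace (F x)).
Hypothesis S_near : forall (s : dprod F) x, regular s x -> S x (s x) ->
  \forall y \near x, S y (s y).

Definition sub_regular (s : forall x, subsp (S x)) x :=
  regular (fun y => subsp_val (s y)) x.

Fact sub_near s x : sub_regular s x -> \forall y \near x, sub_regular s y.
Proof. exact: regular_near. Qed.
Fact sub_local s t x : (\forall y \near x, s y = t y) ->
  sub_regular s x -> sub_regular t x.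
Proof. by move=> st; apply: regular_local; apply: filterS st => y ->. Qed.
Fact sub_lin a s t x : sub_regular s x -> sub_regular t x ->
  sub_regular (fun y => a *: s y + t y) x.
Proof. exact: regular_lin. Qed.
Fact sub_germ x v : exists2 s, sub_regular s x & s x = v.
Proof.
have [s sx sv] := regular_germ (subsp_val v).
have Sx : S x (s x) by rewrite sv; exact: subsp_valP.
pose t y : subsp (S y) := match pselect (S y (s y)) with
  | left Sy => Subsp Sy | right _ => 0 end.
have tE y : S y (s y) -> subsp_val (t y) = s y by rewrite /t; case: pselect.
exists t; last by apply: subsp_inj; rewrite tE.
by apply: (regular_local _ sx); apply: filterS (S_near sx Sx) => y /tE ->.
Qed.
Fact sub_sep s t x : sub_regular s x -> sub_regular t x -> s x = t x ->
  \forall y \near x, s y = t y.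
Proof.
move=> sx tx st; have e : subsp_val (s x) = subsp_val (t x) by rewrite st.
by apply: filterS (regular_sep sx tx e) => y; exact: subsp_inj.
Qed.
Definition sub_sheaf : sheaf K X :=
  @Sheaf K X (fun x => subsp (S x)) sub_regular sub_near sub_local sub_lin sub_germ sub_sep.
End SubSheaf.

Variable A : cpx K X.

Fact trunc0 n x : (0 <= n -> dif A n x 0 = 0) /\ (0 < n -> (0 : A n x) = 0).
Proof. by split=> // _; exact: hom0. Qed.
Fact truncP n x a (u v : A n x) :
  (0 <= n -> dif A n x u = 0) /\ (0 < n -> u = 0) ->
  (0 <= n -> dif A n x v = 0) /\ (0 < n -> v = 0) ->
  (0 <= n -> dif A n x (a *: u + v) = 0) /\ (0 < n -> a *: u + v = 0).
Proof.
move=> [u1 u2] [v1 v2]; split=> n0; last by rewrite u2 // v2 // scaler0 addr0.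
by rewrite hom_lin u1 // v1 // scaler0 addr0.
Qed.
(** One formula for all degrees of the canonical truncation: everything for n < 0, cocycles for n =
    0, nothing for n > 0. *)
Definition trunc_space n x : subspace (A n x) := Subspace (trunc0 n x) (@truncP n x).

Fact trunc_near n (s : dprod (A n)) x : regular s x -> trunc_space n x (s x) ->
  \forall y \near x, trunc_space n y (s y).
Proof.
move=> sx [s1 s2].
have n1 : \forall y \near x, 0 <= n -> dif A n y (s y) = 0.
  have [n0|n0] := boolP (0 <= n); last by apply: nearW.
  have := regular_sep (hom_reg (dif A n) sx) (regular_cst0 _ x) (s1 n0).
  by apply: filterS.
have n2 : \forall y \near x, 0 < n -> s y = 0.
  have [n0|n0] := boolP (0 < n); last by apply: nearW.
  by have := regular_sep sx (regular_cst0 _ x) (s2 n0); apply: filterS.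
by apply: filterS2 n1 n2.
Qed.
Definition trunc_obj n : sheaf K X := sub_sheaf (@trunc_near n).

Fact trunc_dif_in n x (v : trunc_obj n x) :
  trunc_space (n + 1) x (dif A n x (subsp_val v)).
Proof.
split=> n0; first exact: dif_dif.
by have [+ _] := subsp_valP v; apply; lia.
Qed.
Fact trunc_dif_lin n x : linear (fun v : trunc_obj n x =>
  Subsp (trunc_dif_in v) : trunc_obj (n + 1) x).
Proof. by move=> a u v; apply: subsp_inj; exact: hom_lin. Qed.
Fact trunc_dif_reg n (s : dprod (trunc_obj n)) x : regular s x ->
  regular (fun y => Subsp (trunc_dif_in (s y)) : trunc_obj (n + 1) y) x.
Proof. exact: (@hom_reg _ _ _ _ (dif A n) (fun y => subsp_val (s y)) x). Qed.
Definition trunc_dif n : hom (trunc_obj n) (trunc_obj (n + 1)) :=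
  Hom (@trunc_dif_lin n) (@trunc_dif_reg n).
Fact trunc_dif_dif n x v : trunc_dif (n + 1) x (trunc_dif n x v) = 0.
Proof. by apply: subsp_inj; exact: dif_dif. Qed.
Definition trunc : cpx K X := Cpx trunc_dif_dif.

Definition trunc_incl n : hom (trunc n) (A n) :=
  @Hom _ _ (trunc n) (A n) (fun x v => subsp_val v)
    (fun x a u v => erefl) (fun s x sx => sx).
Definition trunc_to : cpx_hom trunc A :=
  @CpxHom _ _ trunc A trunc_incl (fun n x v => erefl).

Variables (H : sheaf K X) (phi : hom (trunc_obj 0) H).
Hypothesis exA : forall n x (p : A (n + 1) x), n + 1 <> 0 ->
  dif A (n + 1) x p = 0 -> exists u, p = dif A n x u.
Hypothesis phi_surj : forall x v, exists u, phi x u = v.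
Hypothesis phi_ker : forall x u, phi x u = 0 <-> exists v, subsp_val u = dif A (-1) x v.

Definition trunc_aug_map n : hom (trunc n) (deg0 H n) :=
  match n as m return hom (trunc m) (deg0 H m) with
  | Posz 0 => phi
  | Posz m.+1 => zero_hom (trunc (Posz m.+1)) (deg0 H (Posz m.+1))
  | Negz m => zero_hom (trunc (Negz m)) (deg0 H (Negz m))
  end.

Lemma deg0_obj0 n x (v : deg0_obj H n x) : n <> 0 -> v = 0.
Proof.
rewrite /deg0_obj in v *; case: eqP v => // _ v _.
by apply: subsp_inj; exact: (subsp_valP v).
Qed.

Fact trunc_aug_mapP n x v :
  dif (deg0 H) n x (trunc_aug_map n x v) = trunc_aug_map (n + 1) x (dif trunc n x v).
Proof.
have [n1|/eqP n1] := eqVneq (n + 1) 0; last first.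
  by rewrite [RHS]deg0_obj0.
have nE : n = -1 by lia.
by subst n; symmetry; apply/phi_ker; exists (subsp_val v).
Qed.
Definition trunc_aug : cpx_hom trunc (deg0 H) := CpxHom trunc_aug_mapP.

Fact neg_trunc n x (v : A n x) : n < 0 -> trunc_space n x v.
Proof. by move=> n0; split=> ?; exfalso; lia. Qed.

Lemma trunc_to_quasi : quasi_iso trunc_to.
Proof.
move=> n x; split=> [v dv [w]|w dw].
  rewrite /= => vw; have [n0|n0] := ltP n 0.
    by exists (Subsp (neg_trunc w n0)); exact: subsp_inj.
  exists 0; apply: subsp_inj; rewrite [RHS]hom0.
  by have [_] := subsp_valP v; apply; lia.
have [n1|n1] := ltP 0 (n + 1).
  have [u ->] : exists u, w = dif A n x u by apply: exA => //; lia.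
  by exists 0; [exact: hom0|]; exists u; rewrite add0r.
have tw : trunc_space (n + 1) x w by split=> // ?; exfalso; lia.
exists (Subsp tw); first exact: subsp_inj.
by exists 0; rewrite hom0 addr0.
Qed.

Lemma trunc_aug_quasi : quasi_iso trunc_aug.
Proof.
move=> n x; have [n1|/eqP n1] := eqVneq (n + 1) 0.
  have nE : n = -1 by lia.
  subst n; split=> [v dv [w vw]|w _].
    have /phi_ker[u vu] : phi x v = 0 := vw.
    by exists (Subsp (neg_trunc u isT)); exact: subsp_inj.
  have [u uw] := phi_surj w; exists u.
    by apply: subsp_inj; have [+ _] := subsp_valP u; exact.
  by exists 0; rewrite addr0.
split=> [v dv _|w _].
  have /(congr1 (fun u : trunc (n + 1 + 1) x => subsp_val u)) dv' := dv.
  have [n0|n0] := ltP n 0.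
    have [u vu] : exists u, subsp_val v = dif A n x u by exact: exA.
    by exists (Subsp (neg_trunc u n0)); exact: subsp_inj.
  exists 0; apply: subsp_inj; rewrite [RHS]hom0.
  by have [_] := subsp_valP v; apply; lia.
exists 0; first exact: hom0.
by exists 0; rewrite hom0 add0r [w]deg0_obj0.
Qed.

(** A complex with cohomology in degree 0 only need not map to that cohomology; the canonical
    truncation maps to both and is the apex of the roof. *)
Lemma derived_iso_deg0 : derived_iso A (deg0 H).
Proof.
by exists trunc, trunc_to, trunc_aug; split; [exact: trunc_to_quasi|exact: trunc_aug_quasi].
Qed.

End Truncation.

(** * Soft sheaves and composition of direct images *)

Section ShriekSections.
Variables (K : fieldType) (X Y : topologicalType) (f : X -> Y).
Hypothesis cf : continuous f.
Variables (F : sheaf K X) (t : dprod (shriek_sheaf f F)).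

Definition shriek_unfold : dprod F := fun x => subsp_val (t (f x)) x.

Lemma shriek_unfoldE y : subsp_val (t y) = on_fiber f shriek_unfold y.
Proof.
apply: functional_extensionality_dep => x; rewrite /on_fiber /shriek_unfold.
case: asboolP => [->//|nx]; have [_ [s [_ _ _ ->]]] := subsp_valP (t y).
by rewrite /on_fiber asboolF.
Qed.

(** Local representatives of [t] are unique on each fibre, hence agree with the unfolded family, and
    properness over [U] is local on [U]. *)
Lemma shriek_unfold_proper U : open U -> (forall y, U y -> regular t y) ->
  proper_section f U shriek_unfold.
Proof.
move=> oU tr.
have loc y : U y -> exists V s, [/\ open V, V y, proper_section f V s &
    forall x, V (f x) -> shriek_unfold x = s x].
  move=> /tr[V [s [oV Vy sV tV]]]; exists V, s; split=> // x Vx.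
  by rewrite /shriek_unfold tV // /on_fiber asboolT.
split.
  move=> x Ux; have [V [s [oV Vx sV sE]]] := loc _ Ux.
  apply: regular_local (sV.1 _ Vx).
  have : \forall y \near x, V (f y) by apply: cf; exact: open_nbhs_nbhs.
  by apply: filterS => y /sE.
split.
  move=> A cA y Uy ny; have [V [s [oV Vy [_ [scl _]] sE]]] := loc _ Uy.
  have n : ~ (f @` (A `&` [set x | V (f x) /\ s x <> 0])) y.
    move=> [x [Ax [Vx sx]] xy]; apply: ny; exists x => //; split=> //.
    by split; [rewrite xy|rewrite sE].
  apply: filterS2 (scl A cA y Vy n) (open_nbhs_nbhs (conj oV Vy)).
  move=> y' n' Vy' Uy' [x [Ax [Ux sx]] xy]; apply: n' => //.
  have Vx : V (f x) by rewrite xy.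
  by exists x => //; split=> //; split=> //; rewrite -sE.
move=> y Uy; have [V [s [oV Vy [_ [_ sco]] sE]]] := loc _ Uy.
have -> : [set x | U (f x) /\ shriek_unfold x <> 0] `&` f @^-1` [set y] =
    [set x | V (f x) /\ s x <> 0] `&` f @^-1` [set y]; last exact: sco.
apply/seteqP; split=> x [[Vx sx] xy].
  have Vx' : V (f x) by rewrite xy.
  by split=> //; split=> //; rewrite -sE.
by split=> //; split; [rewrite xy|rewrite sE].
Qed.

End ShriekSections.

(* Weaker than flabbiness, but inherited by direct images with proper supports. *)
Definition soft (K : fieldType) (X : topologicalType) (F : sheaf K X) :=
  forall (U B : set X) (s : dprod F), open U -> closed B -> B `<=` U ->
  (forall x, U x -> regular s x) ->
  exists s' : dprod F, [/\ forall x, regular s' x,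
    forall x, nbhs x B -> s' x = s x & forall x, s' x <> 0 -> B x /\ s x <> 0].

Section Soft.
Variables (K : fieldType) (X : topologicalType).

Section Flabby.
Variables (J : sheaf K X) (O : set X) (oO : open O) (s : dprod J).
Hypothesis sr : forall x, O x -> regular s x.

Lemma open_locally_closed : locally_closed O.
Proof. by exists O, setT; split; rewrite ?setIT. Qed.

Let kO := cst_sheaf K open_locally_closed.
Let kT := cst_sheaf K (@locally_closedT X).

Lemma cst_near0 (u : dprod kO) x : regular u x -> ~ O x ->
  \forall y \near x, subsp_val (u y) = 0.
Proof.
move=> ux nOx; apply: filterS ux => y uy; have [Oy|nOy] := pselect (O y).
  by rewrite uy //; exact: (subsp_valP (u x) nOx).
exact: (subsp_valP (u y) nOy).
Qed.

Fact sect_hom_lin x : linear (fun c : kO x => (subsp_val c : K) *: s x).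
Proof. by move=> a u v; rewrite scalerDl scalerA. Qed.
Fact sect_hom_reg (u : dprod kO) x : regular u x ->
  regular (fun y => (subsp_val (u y) : K) *: s y) x.
Proof.
move=> ux; have [Ox|nOx] := pselect (O x).
  apply: regular_local (regularZ (subsp_val (u x) : K) (sr Ox)).
  apply: filterS2 ux (open_nbhs_nbhs (conj oO Ox)) => y uy Oy.
  by rewrite uy.
apply: regular_local (regular_cst0 J x).
by apply: filterS (cst_near0 ux nOx) => y ->; rewrite scale0r.
Qed.
Definition sect_hom : hom kO J := Hom sect_hom_lin sect_hom_reg.

Fact all_space (x : X) (c : K^o) : cst_space K setT x c.
Proof. by move=> []. Qed.
Fact incl_hom_lin x : linear (fun c : kO x =>
  Subsp (@all_space x (subsp_val c)) : kT x).
Proof. by move=> a u v; exact: subsp_inj. Qed.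
Fact incl_hom_reg (u : dprod kO) x : regular u x ->
  regular (fun y => Subsp (@all_space y (subsp_val (u y))) : kT y) x.
Proof.
move=> ux; have [Ox|nOx] := pselect (O x).
  by apply: filterS2 ux (open_nbhs_nbhs (conj oO Ox)) => y uy Oy _; exact: uy.
apply: filterS (cst_near0 ux nOx) => y /= -> _.
by rewrite [RHS](subsp_valP (u x) nOx).
Qed.
Definition incl_hom : hom kO kT := Hom incl_hom_lin incl_hom_reg.

Lemma incl_hom_mono : is_mono incl_hom.
Proof. by move=> x u v uv; apply: subsp_inj; exact: (congr1 (fun w : kT x => subsp_val w) uv). Qed.

(** A section over an open [O] is a morphism from k_O; injectivity extends it along the inclusion of
    k_O in the constant sheaf, and the image of 1 is the global section. *)
Lemma injective_flabby : injective_sheaf J ->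
  exists s' : dprod J, (forall x, regular s' x) /\ forall x, O x -> s' x = s x.
Proof.
move=> /(_ _ _ _ incl_hom_mono sect_hom)[h hE].
exists (fun x => h x (cst_fill _ (1 : K) x)); split=> x.
  apply: (hom_reg h (s := fun x => cst_fill setT (1 : K) x)).
  by apply: nearW => y _ /=; rewrite !asboolT.
move=> Ox; have -> : cst_fill setT (1 : K) x = incl_hom x (cst_fill O (1 : K) x).
  by apply: subsp_inj; rewrite /= !asboolT.
by rewrite hE /= asboolT // scale1r.
Qed.

End Flabby.

(** Flabbiness is applied to the section equal to [s] on the interior of [B] and to 0 on the open
    set [Z]. On the overlap [s] vanishes, so the two agree; prescribing 0 on [Z] is what controls
    the support of the extension. *)
Lemma injective_soft (J : sheaf K X) : injective_sheaf J -> soft J.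
Proof.
move=> injJ U B s oU cB BU sr.
pose Z := [set x | ~ (B x /\ s x <> 0)].
have nZ x : Z x -> nbhs x Z.
  move=> Zx; have [Bx|nBx] := pselect (B x).
    have sx : s x = 0 by apply: contrapT => sx; exact: Zx.
    apply: filterS (regular_sep (sr _ (BU _ Bx)) (regular_cst0 J x) sx).
    by move=> y sy [].
  have : nbhs x (~` B) by apply: open_nbhs_nbhs; split=> //; exact: closed_openC.
  by apply: filterS => y nBy [].
have oZ : open Z by rewrite openE => x /nZ.
pose O := interior B `|` Z.
have oO : open O by apply: openU => //; exact: open_interior.
pose u : dprod J := fun x => if `[< nbhs x B >] then s x else 0.
have ur x : O x -> regular u x.
  have [Bx _|nBx] := pselect (nbhs x B).
    apply: regular_local (sr _ (BU _ (nbhs_singleton Bx))).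
    by apply: filterS (nbhs_interior Bx) => y By; rewrite /u asboolT.
  case=> // /nZ nZx; apply: regular_local (regular_cst0 J x).
  apply: filterS nZx => y Zy; rewrite /u; case: asboolP => // By.
  by symmetry; apply: contrapT => sy; apply: Zy; split=> //; exact: nbhs_singleton.
have [s' [s'r s'O]] := injective_flabby oO ur injJ.
exists s'; split=> // [x Bx|x s'x].
  by rewrite s'O ?/u ?asboolT //; left.
apply: contrapT => Zx; apply: s'x; rewrite s'O; last by right.
by rewrite /u; case: asboolP => // Bx; apply: contrapT => sx; apply: Zx; split=> //; exact: nbhs_singleton.
Qed.

(** Softness is applied to a closed neighbourhood of [x0] inside the domain of a local section and
    inside the band where [g] is within 1 of [g x0]. *)
Lemma soft_germ_extendable (R : realType) (g : X -> R) (F : sheaf K X) :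
  regular_space X -> continuous g -> soft F -> germ_extendable g F.
Proof.
move=> rX cg sF x0 a; have [s sx sa] := regular_germ a.
have := regular_near sx; rewrite /prop_near1 nbhsE => -[U [oU Ux] Ur].
pose N := U `&` [set x | g x0 - 1 < g x] `&` [set x | g x < g x0 + 1].
have l1 : g x0 - 1 < g x0 by lra.
have l2 : g x0 < g x0 + 1 by lra.
have n1 : \forall x \near x0, g x0 - 1 < g x.
  exact: (@cvgr_gt R X (nbhs x0) _ g (g x0) (cg x0)).
have n2 : \forall x \near x0, g x < g x0 + 1.
  exact: (@cvgr_lt R X (nbhs x0) _ g (g x0) (cg x0)).
have NN : nbhs x0 N.
  by apply: filterI => //; apply: filterI => //; exact: open_nbhs_nbhs.
have [A nA AN] := rX x0 N NN.
have [|||s' [s'r s'E s'0]] := sF U (closure A) s oU.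
- exact: closed_closure.
- by move=> x /AN[[]].
- exact: Ur.
exists s'; split=> //.
  exists (`|g x0| + 1) => x xM; apply: contrapT => /s'0[/AN[[_ /= g1] g2] _].
  have := ler_norm (g x0); have := ler_norm (- g x0); rewrite normrN => M1 M2.
  by move: xM; rewrite ler_normr => /orP[] xM; clear -g1 g2 M1 M2 xM; lra.
rewrite s'E //; apply: filterS nA; exact: subset_closure.
Qed.

End Soft.

(** Softness is used upstairs with the closed set f^-1(B). The extension is supported inside the
    support of the unfolded section, which is proper over [U], and this keeps it proper over all of
    [Y]. *)
Lemma soft_shriek (K : fieldType) (X Y : topologicalType) (f : X -> Y)
  (F : sheaf K X) : continuous f -> soft F -> soft (shriek_sheaf f F).
Proof.
move=> cf sF U B t oU cB BU tr.
pose s := shriek_unfold t.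
have [sr [scl sco]] := shriek_unfold_proper cf oU tr.
have ofU : open (f @^-1` U) by apply: open_comp => // x _; exact: cf.
have cfB : closed (f @^-1` B) by move/continuous_closedP: cf; exact.
have [||s' [s'r s'E s'0]] := sF (f @^-1` U) (f @^-1` B) s ofU cfB.
- by move=> x /BU.
- exact: sr.
have s'p : proper_section f setT s'.
  split; first by move=> x _; exact: s'r.
  have ncl x : s' x = 0 -> \forall y \near x, s' y = 0.
    move=> s0; exact: (regular_sep (s'r x) (regular_cst0 F x) s0).
  split.
    move=> A cA y _ ny; have [By|nBy] := pselect (B y); last first.
      have : nbhs y (~` B) by apply: open_nbhs_nbhs; split=> //; exact: closed_openC.
      by apply: filterS => y' nB _ [x [_ [_ /s'0[Bx _]]] xy]; apply: nB; rewrite -xy.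
    pose A' := A `&` [set x | s' x <> 0].
    have cA' : closed A'.
      apply: closedI => //; rewrite -openC openE => x /contrapT /ncl.
      by apply: filterS => z sz; apply.
    have n : ~ (f @` (A' `&` [set x | U (f x) /\ s x <> 0])) y.
      by move=> [x [[Ax sx] _] xy]; apply: ny; exists x.
    apply: filterS2 (scl A' cA' y (BU _ By) n) (open_nbhs_nbhs (conj oU (BU _ By))).
    move=> y' n' Uy' _ [x [Ax [_ sx]] xy]; apply: n' => //.
    have [Bx s0] := s'0 x sx.
    by exists x => //; split=> //; split=> //; exact: BU.
  move=> y _ G PG GS; have [x [[_ s'x] xy]] := filter_ex GS.
  have [By _] := s'0 x s'x; rewrite /= xy in By.
  have sub : [set x | setT (f x) /\ s' x <> 0] `&` f @^-1` [set y] `<=`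
      [set x | U (f x) /\ s x <> 0] `&` f @^-1` [set y].
    by move=> z [[_ /s'0[Bz sz]] zy]; split=> //; split=> //; exact: BU.
  have GS' : G ([set x | U (f x) /\ s x <> 0] `&` f @^-1` [set y]).
    by apply: filterS GS.
  have [z [[[Uz sz] zy] Gz]] := sco y (BU _ By) G PG GS'.
  exists z; split=> //; split=> //; split=> // s'z.
  by have [z' [[[_ nz'] _] z'0]] := Gz _ _ GS (ncl z s'z).
have s'in y : shriek_in f y (on_fiber f s' y).
  by exists setT, s'; split=> //; exact: openT.
exists (fun y => @Subsp _ _ (shriek_space f F y) _ (s'in y)); split.
- by move=> y; exists setT, s'; split=> //; exact: openT.
- move=> y By; apply: subsp_inj; rewrite shriek_unfoldE /=.
  apply: functional_extensionality_dep => x; rewrite /on_fiber.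
  by case: asboolP => // xy; apply: s'E; apply: cf; rewrite xy.
- move=> y ny; have [x xy s'x] : exists2 x, f x = y & s' x <> 0.
    apply: contrapT => nx; apply: ny; apply: subsp_inj.
    apply: functional_extensionality_dep => x; rewrite /= /on_fiber.
    by case: asboolP => // xy; apply: contrapT => s'x; apply: nx; exists x.
  have [Bx sx] := s'0 x s'x; split; first by rewrite -xy.
  by move=> ty; apply: sx; rewrite /s /shriek_unfold xy ty.
Qed.

(** * Direct images along a composite of two lines *)

Section Composition.
Variables (R : realType) (K : fieldType) (X Y W : topologicalType).
Variables (q1 : X -> Y) (g1 : X -> R) (h1 : R * Y -> X).
Variables (q2 : Y -> W) (g2 : Y -> R) (h2 : R * W -> Y).
Hypotheses (L1 : is_line q1 g1 h1) (L2 : is_line q2 g2 h2).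
Variable q : X -> W.
Hypothesis qE : forall x, q x = q2 (q1 x).

(** Closedness composes through the closure of the image in [Y]. For compactness a filter is pushed
    to [Y], where it clusters at some [y], and is then traced back to the fibre of [q1] over [y]. *)
Lemma composition_proper (F : sheaf K X) (U : set W) (t : dprod (shriek_sheaf q1 F)) :
  open U -> proper_section q2 U t -> proper_section q U (shriek_unfold t).
Proof.
move=> oU [tr [tcl tco]]; set s := shriek_unfold t.
have oU2 : open (q2 @^-1` U) by apply: open_comp => // x _; exact: (line_f L2).
have [sr [scl sco]] := shriek_unfold_proper (line_f L1) oU2 tr.
have ts x : s x <> 0 -> t (q1 x) <> 0.
  by move=> sx tx; apply: sx; rewrite /s /shriek_unfold tx.
split; first by move=> x Ux; apply: sr; rewrite /= -qE.
split.
  move=> A cA w Uw nw.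
  pose B := q1 @` (A `&` [set x | (q2 @^-1` U) (q1 x) /\ s x <> 0]).
  have n : ~ (q2 @` (closure B `&` [set y | U (q2 y) /\ t y <> 0])) w.
    move=> [y [By [Uy ty]] yw].
    have [[x [Ax [Ux sx]] xy]|nBy] := pselect (B y).
      by apply: nw; exists x; [split=> //; split=> //; rewrite qE|rewrite qE xy].
    have nB := scl A cA y Uy nBy.
    have nU : nbhs y (q2 @^-1` U) by exact: open_nbhs_nbhs.
    have [z [Bz [nz Uz]]] := By _ (filterI nB nU).
    exact: (nz Uz Bz).
  apply: filterS (tcl (closure B) (@closed_closure _ _) w Uw n) => w' n' Uw' [x [Ax [Ux sx]] xw].
  apply: n' => //; exists (q1 x); last by rewrite -qE.
  split; last by split; [rewrite -qE|exact: ts].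
  by apply: subset_closure; exists x => //; split=> //; split=> //; rewrite /= -qE.
move=> w Uw G PG GS.
have GT : (q1 @ G) ([set y | U (q2 y) /\ t y <> 0] `&` q2 @^-1` [set w]).
  apply: (@filterS _ G _ _ _ _ GS) => x [[Ux sx] xw]; split; last by rewrite /= -qE.
  by split; [rewrite -qE|exact: ts].
have [y [[[Uy ty] yw] Gy]] := tco w Uw (q1 @ G) (fmap_proper_filter _ PG) GT.
(* The traces on the compact support over [y]. They are nonempty because [q1] is closed on the
   support and [y] is a cluster point of the image filter. *)
pose D A := closure A `&` ([set x | (q2 @^-1` U) (q1 x) /\ s x <> 0] `&` q1 @^-1` [set y]).
have D0 A : G A -> D A !=set0.
  move=> GA; apply: contrapT => nD.
  have n : ~ (q1 @` (closure A `&` [set x | (q2 @^-1` U) (q1 x) /\ s x <> 0])) y.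
    by move=> [x [Ax Sx] xy]; apply: nD; exists x.
  have nA := scl (closure A) (@closed_closure _ _) y Uy n.
  have nU : nbhs y (q2 @^-1` U) by exact: open_nbhs_nbhs.
  have GA' : (q1 @ G) (q1 @` (A `&` ([set x | U (q x) /\ s x <> 0] `&` q @^-1` [set w]))).
    by apply: (@filterS _ G _ _ _ _ (filterI GA GS)) => x AS; exists x.
  have [z [[x [Ax [[Ux sx] _]] xz] [nz Uz]]] := Gy _ _ GA' (filterI nA nU).
  apply: nz => //; exists x => //; split; first exact: subset_closure.
  by split=> //; rewrite /= -qE.
have FD : ProperFilter (filter_from [set A | G A] D).
  apply: filter_from_proper; last by move=> A /D0.
  apply: filter_from_filter; first by exists setT; exact: filterT.
  move=> A B GA GB; exists (A `&` B); first exact: filterI.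
  by move=> x [/closureI[Ax Bx] Sx]; split; split.
have [|x [[Sx xy] Dx]] := sco y Uy _ FD.
  by exists setT; [exact: filterT|move=> x []].
exists x; split.
  by split; [split; [rewrite qE; exact: Sx.1|exact: Sx.2]|rewrite /= qE xy].
move=> A N GA nN; have := nN; rewrite nbhsE => -[N' [oN' N'x] N'N].
have [|z [[Az _] N'z]] := Dx (D A) N' _ (open_nbhs_nbhs (conj oN' N'x)).
  by exists A.
have [z' [Az' N'z']] := Az N' (open_nbhs_nbhs (conj oN' N'z)).
by exists z'; split=> //; exact: N'N.
Qed.

Variable F : sheaf K X.

(** Properness for [q] bounds [g1] on the support near a fibre of [q], hence near any fibre of [q1]
    above it, and along a line boundedness suffices. *)
Lemma inner_proper (U : set W) (s : dprod F) : open U -> proper_section q U s ->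
  proper_section q1 (q2 @^-1` U) s.
Proof.
move=> oU sU.
have oU2 : open (q2 @^-1` U) by apply: open_comp => // x _; exact: (line_f L2).
apply: (proper_of_bounded L1) => // [x Ux|y Uy].
  by apply: sU.1; rewrite qE.
have [M sM] := bounded_of_proper (line_g L1) oU sU Uy; exists M.
have nM : \forall y' \near y, forall x, q x = q2 y' -> M <= `|g1 x| -> s x = 0.
  exact: (line_f L2 sM).
by apply: filterS nM => y' My x xy; apply: My; rewrite qE xy.
Qed.

Lemma inner_in (U : set W) (s : dprod F) w y : open U -> U w -> proper_section q U s ->
  shriek_in q1 y (on_fiber q1 (on_fiber q s w) y).
Proof.
move=> oU Uw sU; have [yw|nyw] := pselect (q2 y = w); last first.
  have -> : on_fiber q1 (on_fiber q s w) y = 0; last exact: shriek_in0.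
  apply: functional_extensionality_dep => x; rewrite /on_fiber.
  case: asboolP => // xy; case: asboolP => // xw.
  by case: nyw; rewrite -xy -qE.
exists (q2 @^-1` U), s; split.
- by apply: open_comp => // x _; exact: (line_f L2).
- by rewrite /= yw.
- exact: inner_proper.
- apply: functional_extensionality_dep => x; rewrite /on_fiber.
  by case: asboolP => // xy; rewrite asboolT // qE xy.
Qed.

Fact theta_in0 w (u : shriek_sheaf q F w) y :
  shriek_space q1 F y (on_fiber q1 (subsp_val u) y).
Proof. by have [U [s [oU Uw sU ->]]] := subsp_valP u; exact: inner_in sU. Qed.

(** The comparison of q_! with q2_! q1_!: a family over a fibre of [q] is regrouped by the fibres of
    [q1]. *)
Definition theta0 w (u : shriek_sheaf q F w) : dprod (shriek_sheaf q1 F) :=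
  fun y => Subsp (theta_in0 u y).

Lemma theta0_section (U : set W) (s : dprod F) : open U -> proper_section q U s ->
  exists2 t : dprod (shriek_sheaf q1 F), proper_section q2 U t &
    forall w, U w -> forall u : shriek_sheaf q F w,
      subsp_val u = on_fiber q s w -> theta0 u = on_fiber q2 t w.
Proof.
move=> oU sU.
have oU2 : open (q2 @^-1` U) by apply: open_comp => // x _; exact: (line_f L2).
have sin y : U (q2 y) -> shriek_in q1 y (on_fiber q1 s y).
  by move=> Uy; exists (q2 @^-1` U), s; split=> //; exact: inner_proper.
pose t y : shriek_sheaf q1 F y := match pselect (U (q2 y)) with
  | left Uy => @Subsp _ _ (shriek_space q1 F y) _ (sin y Uy) | right _ => 0 end.
have tE y : U (q2 y) -> subsp_val (t y) = on_fiber q1 s y.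
  by rewrite /t; case: pselect.
exists t; last first.
  move=> w Uw u uE; apply: functional_extensionality_dep => y; apply: subsp_inj.
  rewrite /= uE [X in subsp_val X]/on_fiber; case: asboolP => yw.
    rewrite tE ?yw //; apply: functional_extensionality_dep => x; rewrite /on_fiber.
    by case: asboolP => // xy; rewrite asboolT // qE xy.
  apply: functional_extensionality_dep => x; rewrite /on_fiber.
  case: asboolP => // xy; case: asboolP => // xw.
  by case: yw; rewrite -xy -qE.
apply: (proper_of_bounded L2) => // [y Uy|w Uw].
  by exists (q2 @^-1` U), s; split=> //; exact: inner_proper.
have cg : continuous (fun x => g2 (q1 x)) := continuous_compo (line_f L1) (line_g L2).
have [M sM] := bounded_of_proper cg oU sU Uw; exists M.
apply: filterS2 sM (open_nbhs_nbhs (conj oU Uw)) => w' Mw Uw' y yw My.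
apply: subsp_inj; rewrite tE ?yw //.
apply: functional_extensionality_dep => x; rewrite /on_fiber.
by case: asboolP => // xy; apply: (Mw x); rewrite ?qE xy.
Qed.

Fact theta_in w (u : shriek_sheaf q F w) : shriek_space q2 (shriek_sheaf q1 F) w (theta0 u).
Proof.
have [U [s [oU Uw sU uE]]] := subsp_valP u.
have [t tU tE] := theta0_section oU sU.
by exists U, t; split=> //; exact: tE.
Qed.
Fact theta_lin w : linear (fun u : shriek_sheaf q F w =>
  Subsp (theta_in u) : shriek_sheaf q2 (shriek_sheaf q1 F) w).
Proof.
move=> a u v; apply: subsp_inj; apply: functional_extensionality_dep => y.
apply: subsp_inj; apply: functional_extensionality_dep => x.
rewrite -[RHS]/(a *: on_fiber q1 (subsp_val u) y x + on_fiber q1 (subsp_val v) y x).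
rewrite /= /on_fiber; case: ifP => // _.
by rewrite scaler0 addr0.
Qed.
Fact theta_reg (v : dprod (shriek_sheaf q F)) w : regular v w ->
  regular (fun w => Subsp (theta_in (v w)) : shriek_sheaf q2 (shriek_sheaf q1 F) w) w.
Proof.
move=> [U [s [oU Uw sU vE]]]; have [t tU tE] := theta0_section oU sU.
by exists U, t; split=> // w' Uw'; apply: tE => //; exact: vE.
Qed.
Definition theta : hom (shriek_sheaf q F) (shriek_sheaf q2 (shriek_sheaf q1 F)) :=
  Hom theta_lin theta_reg.

Lemma thetaE w u x : subsp_val (subsp_val (theta w u) (q1 x)) x = subsp_val u x.
Proof. by rewrite /= /on_fiber asboolT. Qed.

Lemma theta_inj w u : theta w u = 0 -> u = 0.
Proof.
move=> u0; apply: subsp_inj; apply: functional_extensionality_dep => x.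
by rewrite -thetaE u0.
Qed.

Lemma theta_surj w v : exists u, theta w u = v.
Proof.
have [U [t [oU Uw tU vE]]] := subsp_valP v.
have sU := composition_proper oU tU.
have uin : shriek_space q F w (on_fiber q (shriek_unfold t) w).
  by exists U, (shriek_unfold t).
exists (Subsp uin); apply: subsp_inj; apply: functional_extensionality_dep => y.
apply: subsp_inj; apply: functional_extensionality_dep => x.
rewrite vE /= [X in subsp_val X]/on_fiber; case: (asboolP (q2 y = w)) => yw.
  rewrite shriek_unfoldE /on_fiber; case: asboolP => // xy.
  by rewrite asboolT // qE xy.
rewrite /on_fiber; case: asboolP => // xy; case: asboolP => // xw.
by case: yw; rewrite -xy -qE.
Qed.

End Composition.

Lemma theta_dif (R : realType) (K : fieldType) (X Y W : topologicalType)
    (q1 : X -> Y) (g1 : X -> R) (h1 : R * Y -> X)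
    (q2 : Y -> W) (g2 : Y -> R) (h2 : R * W -> Y)
    (L1 : is_line q1 g1 h1) (L2 : is_line q2 g2 h2) (q : X -> W)
    (qE : forall x, q x = q2 (q1 x)) (F G : sheaf K X) (d : hom F G) w u :
  shriek_hom q2 (shriek_hom q1 d) w (theta L1 L2 qE F w u) =
  theta L1 L2 qE G w (shriek_hom q d w u).
Proof.
apply: subsp_inj; apply: functional_extensionality_dep => y.
apply: subsp_inj; apply: functional_extensionality_dep => x.
by rewrite /= /hom_section /= /on_fiber; case: ifP => // _; exact: hom0.
Qed.

(** * Injective resolutions *)

Section Complement.
Variables (K : fieldType) (V : lmodType K) (S : subspace V).

Let disj (C : subspace V) := forall v, C v -> S v -> v = 0.

Fact zero_space0 : (0 : V) = 0. Proof. by []. Qed.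
Fact zero_spaceP a (u v : V) : u = 0 -> v = 0 -> a *: u + v = 0.
Proof. by move=> -> ->; rewrite scaler0 addr0. Qed.
Definition zero_space : subspace V := @Subspace _ _ (fun v => v = 0) zero_space0 zero_spaceP.

Lemma subspaceB (C : subspace V) u v : C u -> C v -> C (u - v).
Proof. by move=> Cu Cv; rewrite addrC -scaleN1r; exact: subspaceP. Qed.

Lemma max_disjoint : exists C : subspace V, disj C /\
  forall C' : subspace V, disj C' -> (forall v, C v -> C' v) -> forall v, C' v -> C v.
Proof.
pose T := {C : subspace V | disj C}.
pose le (C C' : T) := `[< forall v, sval C v -> sval C' v >].
have d0 : disj zero_space by [].
have [||A tA|[C dC] mC] := @ZL_preorder T (exist _ _ d0) le.
- by move=> C; apply/asboolP.
- by move=> C D E /asboolP CD /asboolP DE; apply/asboolP => v /CD /DE.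
- pose U v := v = 0 \/ exists2 C, A C & sval C v.
  have U0 : U 0 by left.
  have UP a u v : U u -> U v -> U (a *: u + v).
    move=> [->|[C AC Cu]] [->|[D AD Dv]].
    + by left; rewrite scaler0 addr0.
    + by right; exists D => //; rewrite scaler0 add0r.
    + by right; exists C => //; apply: subspaceP => //; exact: subspace0.
    + have [/asboolP CD|/asboolP DC] := tA C D AC AD.
        by right; exists D => //; apply: subspaceP => //; exact: CD.
      by right; exists C => //; apply: subspaceP => //; exact: DC.
  have dU : disj (Subspace U0 UP).
    by move=> v [//|[C AC Cv]] Sv; exact: (svalP C).
  exists (exist _ _ dU) => C AC; apply/asboolP => v Cv.
  by right; exists C.
exists C; split=> // C' dC' CC' v C'v.
have /asboolP := mC (exist _ _ dC') (introT (asboolP _) CC').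
exact.
Qed.

(** A maximal [C] disjoint from [S] is a complement. Either [C] and [v] together still span a
    subspace disjoint from [S], and then [v] lies in [C]; or some nonzero a v + c lies in [S], where
    a is nonzero, and - c / a is the component of [v] in [C]. *)
Lemma complement : exists r : V -> V,
  [/\ linear r, forall v, r v = 0 <-> S v & forall v, r (r v) = r v].
Proof.
have [C [dC mC]] := max_disjoint.
have dec v : exists c, C c /\ S (v - c).
  pose U u := exists a c, C c /\ u = a *: v + c.
  have U0 : U 0 by exists 0, 0; split; [exact: subspace0|rewrite scale0r addr0].
  have UP a u u' : U u -> U u' -> U (a *: u + u').
    move=> [b [c [Cc ->]]] [b' [c' [Cc' ->]]].
    exists (a * b + b'), (a *: c + c'); split; first exact: subspaceP.
    by rewrite scalerDr scalerA scalerDl addrACA.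
  pose C' := Subspace U0 UP.
  have CC' u : C u -> C' u by move=> Cu; exists 0, u; rewrite scale0r add0r.
  have [dC'|ndC'] := pselect (disj C').
    exists v; split; last by rewrite subrr; exact: subspace0.
    apply: (mC C') => //; exists 1, 0; rewrite scale1r addr0.
    by split=> //; exact: subspace0.
  have [u [[a [c [Cc uE]]] [Su u0]]] : exists u, C' u /\ S u /\ u <> 0.
    apply: contrapT => n; apply: ndC' => u C'u Su; apply: contrapT => u0.
    by apply: n; exists u.
  have a0 : a != 0.
    apply/eqP => a0; apply: u0; apply: dC => //.
    by rewrite uE a0 scale0r add0r.
  exists (- (a^-1 *: c)); split.
    rewrite -scaleNr -[_ *: c]addr0; apply: subspaceP => //; exact: subspace0.
  have -> : v - - (a^-1 *: c) = a^-1 *: u.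
    by rewrite opprK uE scalerDr scalerA mulVf // scale1r.
  by rewrite -[_ *: u]addr0; apply: subspaceP => //; exact: subspace0.
pose r v := projT1 (cid (dec v)).
have rP v : C (r v) /\ S (v - r v) := projT2 (cid (dec v)).
have runiq v c : C c -> S (v - c) -> r v = c.
  move=> Cc Sc; have [Cr Sr] := rP v; apply/eqP; rewrite -subr_eq0; apply/eqP.
  apply: dC; first exact: subspaceB.
  have -> : r v - c = (v - c) - (v - r v) by rewrite opprB [RHS]addrC addrA subrK.
  exact: subspaceB.
exists r; split.
- move=> a u v; have [Cu Su] := rP u; have [Cv Sv] := rP v.
  apply: runiq; first exact: subspaceP.
  have -> : a *: u + v - (a *: r u + r v) = a *: (u - r u) + (v - r v).
    by rewrite scalerBr opprD addrACA.
  exact: subspaceP.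
- move=> v; split=> [rv|Sv]; first by have [_] := rP v; rewrite rv subr0.
  by apply: runiq; [exact: subspace0|rewrite subr0].
- move=> v; apply: runiq; first by have [] := rP v.
  by rewrite subrr; exact: subspace0.
Qed.

End Complement.

(* V / S, realised as the image of a linear map r with kernel S. *)
Section Quotient.
Variables (K : fieldType) (V : lmodType K) (S : subspace V).

Let r := projT1 (cid (complement S)).
Let r_lin : linear r. Proof. by rewrite /r; case: cid => ? []. Qed.
Let r_ker v : r v = 0 <-> S v. Proof. by rewrite /r; case: cid => ? []. Qed.

Let r0 : r 0 = 0. Proof. by apply/r_ker; exact: subspace0. Qed.

Fact quo_space0 : exists v, 0 = r v. Proof. by exists 0; rewrite r0. Qed.
Fact quo_spaceP a u u' : (exists v, u = r v) -> (exists v, u' = r v) ->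
  exists v, a *: u + u' = r v.
Proof. by move=> [v ->] [v' ->]; exists (a *: v + v'); rewrite r_lin. Qed.
Definition quo_space : subspace V :=
  @Subspace _ _ (fun u => exists v, u = r v) quo_space0 quo_spaceP.
Definition quo : lmodType K := subsp quo_space.

Fact quo_pi_in v : quo_space (r v). Proof. by exists v. Qed.
Definition quo_pi (v : V) : quo := Subsp (quo_pi_in v).

Lemma quo_pi_lin : linear quo_pi.
Proof. by move=> a u v; apply: subsp_inj; exact: r_lin. Qed.

Lemma quo_pi0 v : quo_pi v = 0 <-> S v.
Proof.
rewrite -r_ker; split=> [/(congr1 (fun u : quo => subsp_val u))//|rv].
exact: subsp_inj.
Qed.

Lemma quo_pi_surj u : exists v, quo_pi v = u.
Proof. by have [v uv] := subsp_valP u; exists v; exact: subsp_inj. Qed.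

Lemma quo_pi_eq u v : quo_pi u = quo_pi v <-> S (u - v).
Proof.
rewrite -quo_pi0; have -> : quo_pi (u - v) = quo_pi u - quo_pi v.
  by have e := quo_pi_lin (-1) v u; rewrite !scaleN1r in e; rewrite [u - v]addrC e addrC.
by split=> [->|/eqP]; [rewrite subrr|rewrite subr_eq0 => /eqP].
Qed.

End Quotient.

(** With [r] a projection whose kernel is the image of [i], each b - r b has a unique preimage under
    [i], to which [l] is applied. *)
Lemma linear_extension (K : fieldType) (A B V : lmodType K) (i : A -> B) (l : A -> V) :
  linear i -> linear l -> injective i ->
  exists l' : B -> V, linear l' /\ forall a, l' (i a) = l a.
Proof.
move=> ilin llin iinj.
have i0 : i 0 = 0 by have := ilin (-1) 0 0; rewrite scaler0 addr0 scaleN1r addNr.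
have S0 : exists a, 0 = i a by exists 0.
have SP a u v : (exists a, u = i a) -> (exists a, v = i a) -> exists b, a *: u + v = i b.
  by move=> [b ->] [c ->]; exists (a *: b + c); rewrite ilin.
have [r [rlin rker rr]] := complement (@Subspace _ _ (fun u => exists a, u = i a) S0 SP).
have rB u v : r (u - v) = r u - r v.
  by have e := rlin (-1) v u; rewrite !scaleN1r in e; rewrite [u - v]addrC e addrC.
have ex b : exists a, b - r b = i a by apply/rker; rewrite rB rr subrr.
pose p b := projT1 (cid (ex b)).
have pE b : i (p b) = b - r b by rewrite /p; case: cid.
exists (fun b => l (p b)); split=> [a u v|a].
  rewrite -llin; congr l; apply: iinj; rewrite ilin !pE rlin.
  by rewrite scalerBr opprD addrACA.
congr l; apply: iinj; rewrite pE; have -> : r (i a) = 0 by apply/rker; exists a.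
by rewrite subr0.
Qed.

(** * Godement sheaves and their injectivity *)

Section Godement.
Variables (K : fieldType) (X : topologicalType) (V : X -> lmodType K).

Fact null_germ0 (x : X) : \forall y \near x, (0 : dprod V) y = 0.
Proof. exact: nearW. Qed.
Fact null_germP (x : X) a (u v : dprod V) : (\forall y \near x, u y = 0) ->
  (\forall y \near x, v y = 0) -> \forall y \near x, (a *: u + v) y = 0.
Proof.
apply: filterS2 => y uy vy; rewrite -[LHS]/(a *: u y + v y) uy vy.
by rewrite scaler0 addr0.
Qed.
(** Families modulo equality near [x] are the stalks of the sheaf sending U to the product of the
    [V x] over U, as the encoding by stalks requires. *)
Definition null_germ (x : X) : subspace (dprod V) :=
  @Subspace K (dprod V) (fun u => \forall y \near x, u y = 0) (null_germ0 x) (@null_germP x).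

Definition god_germ x (u : dprod V) := quo_pi (null_germ x) u.

Lemma god_germ_eq (x : X) u v : god_germ x u = god_germ x v <-> \forall y \near x, u y = v y.
Proof.
rewrite quo_pi_eq; split; apply: filterS => y.
  by rewrite -[X in X = 0]/(u y - v y) => /eqP; rewrite subr_eq0 => /eqP.
by move=> uv; rewrite -[LHS]/(u y - v y) uv subrr.
Qed.

Definition god_regular (s : forall x, quo (null_germ x)) (x : X) :=
  exists u : dprod V, \forall y \near x, s y = god_germ y u.

Fact god_near s x : god_regular s x -> \forall y \near x, god_regular s y.
Proof. by move=> [u /nbhs_interior]; apply: filterS => y su; exists u. Qed.
Fact god_local s t (x : X) : (\forall y \near x, s y = t y) -> god_regular s x -> god_regular t x.
Proof. by move=> st [u su]; exists u; apply: filterS2 st su => y ->. Qed.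
Fact god_lin a s t x : god_regular s x -> god_regular t x ->
  god_regular (fun y => a *: s y + t y) x.
Proof.
move=> [u su] [v tv]; exists (a *: u + v); apply: filterS2 su tv => y -> ->.
by rewrite /god_germ quo_pi_lin.
Qed.
Fact god_germ_ex x v : exists2 s, god_regular s x & s x = v.
Proof.
have [u uv] := quo_pi_surj v; exists (fun y => god_germ y u) => //.
by exists u; exact: nearW.
Qed.
Fact god_sep s t x : god_regular s x -> god_regular t x -> s x = t x ->
  \forall y \near x, s y = t y.
Proof.
move=> [u su] [v tv]; rewrite (nbhs_singleton su) (nbhs_singleton tv).
move=> /god_germ_eq/nbhs_interior.
by apply: filterS3 su tv => y -> -> uv; exact/god_germ_eq.
Qed.
Definition god : sheaf K X :=
  @Sheaf K X (fun x => quo (null_germ x)) god_regular god_near god_local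
    god_lin god_germ_ex god_sep.

Section Map.
Variables (F : sheaf K X) (l : forall x, F x -> V x).
Hypothesis l_lin : forall x, linear (@l x).

Definition germ_of x (v : F x) : dprod F := projT1 (cid2 (regular_germ v)).
Lemma germ_of_reg x (v : F x) : regular (germ_of v) x.
Proof. by rewrite /germ_of; case: cid2. Qed.
Lemma germ_of_val x (v : F x) : germ_of v x = v.
Proof. by rewrite /germ_of; case: cid2. Qed.

Definition god_fun x (v : F x) : god x := god_germ x (fun y => l (germ_of v y)).

Lemma god_funE x (s : dprod F) : regular s x ->
  god_fun (s x) = god_germ x (fun y => l (s y)).
Proof.
move=> sx; apply/god_germ_eq.
by apply: filterS (regular_sep (germ_of_reg _) sx (germ_of_val _)) => y ->.
Qed.

Fact god_fun_lin x : linear (@god_fun x).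
Proof.
move=> a u v; rewrite -{1}(germ_of_val u) -{1}(germ_of_val v).
rewrite (@god_funE x (fun y => a *: germ_of u y + germ_of v y)); last first.
  by apply: regular_lin; exact: germ_of_reg.
rewrite -[RHS]quo_pi_lin; apply/god_germ_eq; apply: nearW => y.
exact: l_lin.
Qed.
Fact god_fun_reg (s : dprod F) x : regular s x -> regular (fun y => god_fun (s y)) x.
Proof.
move=> sx; exists (fun y => l (s y)).
by apply: filterS (regular_near sx) => y sy; exact: god_funE.
Qed.
Definition god_map : hom F god := Hom god_fun_lin god_fun_reg.

End Map.

(** Evaluating a germ at its base point turns a morphism to [god] into a family of linear maps to
    the [V x], with no continuity condition; each extends separately by linear algebra. *)
Lemma god_injective : injective_sheaf god.
Proof.
move=> F G i imono h.
have evex x (w : god x) : exists u, god_germ x u = w by exact: quo_pi_surj.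
pose ev x (w : god x) : V x := projT1 (cid (evex x w)) x.
have evE x u : ev x (god_germ x u) = u x.
  rewrite /ev; case: cid => /= u' /god_germ_eq; exact: nbhs_singleton.
have ev_lin x : linear (fun v : F x => ev x (h x v)).
  move=> a u v; rewrite hom_lin.
  have [s <-] := evex x (h x u); have [t <-] := evex x (h x v).
  by rewrite -quo_pi_lin !evE.
have lex x : {l : G x -> V x | linear l /\ forall v, l (i x v) = ev x (h x v)}.
  by apply: cid; apply: linear_extension; [exact: hom_lin|exact: ev_lin|exact: imono].
pose l x := projT1 (lex x).
have l_lin x : linear (l x) by rewrite /l; case: (lex x) => ? [].
have lE x v : l x (i x v) = ev x (h x v) by rewrite /l; case: (lex x) => ? [].
exists (god_map l_lin) => x v; have [s sx <-] := regular_germ v.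
rewrite [LHS](@god_funE G l x (fun y => i y (s y))); last exact: hom_reg.
have [u hu] := hom_reg h sx; rewrite (nbhs_singleton hu); apply/god_germ_eq.
by apply: filterS hu => y hy; rewrite lE hy evE.
Qed.

End Godement.

Section Embedding.
Variables (K : fieldType) (X : topologicalType) (F : sheaf K X).

Definition god_unit : hom F (god F) := @god_map K X F F (fun x v => v)
  (fun x a u v => erefl).

Lemma god_unit_mono x v : god_unit x v = 0 -> v = 0.
Proof.
rewrite -(hom0 god_unit x) -(germ_of_val v) => e.
have := e; rewrite [LHS]god_funE; last exact: germ_of_reg.
rewrite [RHS](@god_funE K X F F (fun x v => v) x (fun=> 0)); last exact: regular_cst0.
by move=> /god_germ_eq/nbhs_singleton.
Qed.

End Embedding.

Section Cokernel.
Variables (K : fieldType) (X : topologicalType) (F G : sheaf K X) (f : hom F G).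

Fact im_space0 x : exists u, (0 : G x) = f x u.
Proof. by exists 0; rewrite hom0. Qed.
Fact im_spaceP x a (v v' : G x) : (exists u, v = f x u) -> (exists u, v' = f x u) ->
  exists u, a *: v + v' = f x u.
Proof. by move=> [u ->] [u' ->]; exists (a *: u + u'); rewrite hom_lin. Qed.
Definition im_space x : subspace (G x) :=
  @Subspace _ _ (fun v => exists u, v = f x u) (im_space0 x) (@im_spaceP x).

Definition coker_regular (s : forall x, quo (im_space x)) (x : X) :=
  exists2 t : dprod G, regular t x & \forall y \near x, s y = quo_pi (im_space y) (t y).

Fact coker_near s x : coker_regular s x -> \forall y \near x, coker_regular s y.
Proof.
move=> [t tx /nbhs_interior]; apply: filterS2 (regular_near tx) => y ty st.
by exists t.
Qed.
Fact coker_local s t (x : X) : (\forall y \near x, s y = t y) ->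
  coker_regular s x -> coker_regular t x.
Proof. by move=> st [u ux su]; exists u => //; apply: filterS2 st su => y ->. Qed.
Fact coker_lin a s t x : coker_regular s x -> coker_regular t x ->
  coker_regular (fun y => a *: s y + t y) x.
Proof.
move=> [u ux su] [v vx tv]; exists (fun y => a *: u y + v y); first exact: regular_lin.
by apply: filterS2 su tv => y -> ->; rewrite quo_pi_lin.
Qed.
Fact coker_germ x v : exists2 s, coker_regular s x & s x = v.
Proof.
have [u <-] := quo_pi_surj v; have [t tx <-] := regular_germ u.
exists (fun y => quo_pi (im_space y) (t y)) => //.
by exists t => //; exact: nearW.
Qed.
Fact coker_sep s t x : coker_regular s x -> coker_regular t x -> s x = t x ->
  \forall y \near x, s y = t y.
Proof.
move=> [u ux su] [v vx tv]; rewrite (nbhs_singleton su) (nbhs_singleton tv).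
move=> /quo_pi_eq[w]; have [z zx <-] := regular_germ w => uvz.
apply: filterS3 su tv (regular_sep (regularB ux vx) (hom_reg f zx) uvz).
by move=> y -> -> e; apply/quo_pi_eq; exists (z y).
Qed.
Definition coker : sheaf K X := @Sheaf K X (fun x => quo (im_space x))
  coker_regular coker_near coker_local coker_lin coker_germ coker_sep.

Fact coker_pi_lin x : linear (fun v : G x => quo_pi (im_space x) v : coker x).
Proof. exact: quo_pi_lin. Qed.
Fact coker_pi_reg (s : dprod G) x : regular s x ->
  regular (fun y => quo_pi (im_space y) (s y) : coker y) x.
Proof. by move=> sx; exists s => //; exact: nearW. Qed.
Definition coker_pi : hom G coker := Hom coker_pi_lin coker_pi_reg.

End Cokernel.

Section Resolution.
Variables (K : fieldType) (X : topologicalType) (G : sheaf K X).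

Fixpoint godres_coker n : sheaf K X :=
  if n is m.+1 then coker (god_unit (godres_coker m)) else G.
Definition godres_god n : sheaf K X := god (godres_coker n).

Definition godres_fun n x (v : godres_god n x) : godres_god n.+1 x :=
  god_unit (godres_coker n.+1) x (coker_pi (god_unit (godres_coker n)) x v).
Fact godres_fun_lin n x : linear (@godres_fun n x).
Proof. by move=> a u v; rewrite /godres_fun !hom_lin. Qed.
Fact godres_fun_reg n (s : dprod (godres_god n)) x : regular s x ->
  regular (fun y => godres_fun (s y)) x.
Proof. by move=> sx; do 2 apply: hom_reg. Qed.
Definition godres_hom n : hom (godres_god n) (godres_god n.+1) :=
  Hom (@godres_fun_lin n) (@godres_fun_reg n).

Lemma godres_hom_ker n x v : godres_hom n x v = 0 <-> exists u, v = god_unit (godres_coker n) x u.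
Proof.
split=> [/god_unit_mono/quo_pi0//|vu].
rewrite -[LHS]/(god_unit (godres_coker n.+1) x (coker_pi (god_unit (godres_coker n)) x v)).
have -> : coker_pi (god_unit (godres_coker n)) x v = 0 by exact/quo_pi0.
exact: hom0.
Qed.

Lemma godres_hom_exact n x v : godres_hom n.+1 x v = 0 <-> exists u, v = godres_hom n x u.
Proof.
rewrite godres_hom_ker; split=> [[u ->]|[u ->]]; last by exists (coker_pi _ x u).
by have [w <-] := quo_pi_surj u; exists w.
Qed.

Definition godres_obj (n : int) : sheaf K X :=
  if n is Posz m then godres_god m else zero_sheaf K X.

(** The cast joins [m.+1] to the [m + 1] to which the degree [Posz m + 1] reduces. *)
Definition godres_homk m k (e : m.+1 = k) : hom (godres_god m) (godres_god k) :=
  ecast k (hom (godres_god m) (godres_god k)) e (godres_hom m).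

Definition godres_dif n : hom (godres_obj n) (godres_obj (n + 1)) :=
  match n with
  | Posz m => godres_homk (esym (addn1 m))
  | Negz m => zero_hom (zero_sheaf K X) (godres_obj (Negz m + 1))
  end.

Lemma godres_homk_ker m k (e : m.+1 = k) x v : godres_homk e x v = 0 <-> godres_hom m x v = 0.
Proof. by case: _ / e. Qed.

Lemma godres_homk_exact m k (e : m.+1 = k) l (e' : k.+1 = l) x v :
  godres_homk e' x v = 0 <-> exists u, v = godres_homk e x u.
Proof. by rewrite godres_homk_ker; case: _ / e in e' v *; exact: godres_hom_exact. Qed.

Fact godres_dif_dif n x v : godres_dif (n + 1) x (godres_dif n x v) = 0.
Proof.
case: n v => [m|m] v; last by rewrite [godres_dif (Negz m) x v]/= hom0.
by apply/(godres_homk_exact (esym (addn1 m))); exists v.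
Qed.
Definition godres_cpx : cpx K X := Cpx godres_dif_dif.

Lemma zero_sheaf0 x (v : zero_sheaf K X x) : v = 0.
Proof. by apply: subsp_inj; exact: (subsp_valP v). Qed.

Lemma zero_sheaf_injective : injective_sheaf (zero_sheaf K X).
Proof.
move=> F F' i _ h; exists (zero_hom F' (zero_sheaf K X)) => x v.
by rewrite [RHS]zero_sheaf0.
Qed.

Lemma godres_obj_neg (n : int) x (v : godres_obj n x) : n < 0 -> v = 0.
Proof. by case: n v => // m v _; exact: zero_sheaf0. Qed.

Definition godres_aug n : hom (deg0 G n) (godres_cpx n) :=
  match n as m return hom (deg0 G m) (godres_cpx m) with
  | Posz 0 => god_unit G
  | Posz m.+1 => zero_hom (deg0 G (Posz m.+1)) (godres_cpx (Posz m.+1))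
  | Negz m => zero_hom (deg0 G (Negz m)) (godres_cpx (Negz m))
  end.

Fact godres_augP n x v : dif godres_cpx n x (godres_aug n x v) = godres_aug (n + 1) x (dif (deg0 G) n x v).
Proof.
rewrite [RHS]hom0; case: n v => [[|m]|m] v; [|exact: hom0|exact: hom0].
by apply/godres_homk_ker; apply/godres_hom_ker; exists v.
Qed.
Definition godres_aug_hom : cpx_hom (deg0 G) godres_cpx := CpxHom godres_augP.

Lemma godres_aug_quasi : quasi_iso godres_aug_hom.
Proof.
move=> n x; have [n1|n1] := eqVneq (n + 1) 0.
  have nE : n = -1 by lia.
  subst n; split=> [v _ [w vw]|w /godres_homk_ker/godres_hom_ker[u ->]].
    exists 0; rewrite [RHS]hom0; apply: (@god_unit_mono _ _ G x).
    by rewrite -[LHS]/(godres_aug (-1 + 1) x v) [LHS]vw.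
  exists u => //; exists 0.
  have -> : dif godres_cpx (-1) x 0 = 0 by exact: hom0.
  by rewrite addr0.
have n1' : n + 1 <> 0 by apply/eqP.
split=> [v _ _|w dw].
  by exists 0; rewrite hom0 [v]deg0_obj0.
exists 0; first exact: hom0.
have [n0|n0] := ltP (n + 1) 0.
  by exists 0; rewrite !hom0 addr0 [w]godres_obj_neg.
have {}n0 : 0 <= n by clear -n0 n1'; lia.
case: n n1 n1' n0 w dw => [m|m] // n1 n1' n0 w dw.
have [u wu] := (godres_homk_exact (esym (addn1 m)) (esym (addn1 _)) w).1 dw.
by exists u; rewrite hom0 add0r.
Qed.

(** It ensures that for a sheaf placed in degree 0 [chosen_resolution] is a genuine injective
    resolution. *)
Lemma injective_resolution_deg0 : exists B, injective_resolution (deg0 G) B.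
Proof.
exists godres_cpx; split; last by exists godres_aug_hom; exact: godres_aug_quasi.
  by exists 0 => n n0 x v; exact: godres_obj_neg.
by case=> m; [exact: god_injective|exact: zero_sheaf_injective].
Qed.

End Resolution.

(** * Constant sections of a glued sheaf *)

Section PureTensors.
Variables (K : fieldType) (V W : lmodType K).

Lemma pureDl (v v' : V) (w : W) : pure (v + v') w = pure v w + pure v' w.
Proof.
have -> : pure (v + v') w = tcl [:: (v, w); (v', w)] by apply/tclP; exact: teq_Dl.
by rewrite tclE big_cons big_seq1.
Qed.

Lemma pureDr (v : V) (w w' : W) : pure v (w + w') = pure v w + pure v w'.
Proof.
have -> : pure v (w + w') = tcl [:: (v, w); (v, w')] by apply/tclP; exact: teq_Dr.
by rewrite tclE big_cons big_seq1.
Qed.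

Lemma pureZr a (v : V) (w : W) : pure v (a *: w) = a *: pure v w.
Proof. by rewrite -pureZl; apply/tclP; apply: teq_sym; exact: teq_Z. Qed.

Lemma pure0l (w : W) : pure (0 : V) w = 0.
Proof. by have := pureZl 0 (0 : V) w; rewrite !scale0r. Qed.

Lemma pure0r (v : V) : pure v (0 : W) = 0.
Proof. by have := pureZr 0 v (0 : W); rewrite !scale0r. Qed.

Lemma separating_form (v : V) : v <> 0 -> exists l : V -> K^o, linear l /\ l v = 1.
Proof.
move=> v0; have [|||l [llin lE]] := @linear_extension K K^o V K^o (fun c => c *: v) id.
- by move=> a b c; rewrite scalerDl scalerA.
- by [].
- move=> a b /eqP; rewrite -subr_eq0 -scalerBl scaler_eq0 subr_eq0 => /orP[/eqP//|].
  by move=> /eqP.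
by exists l; split=> //; rewrite -{1}[v]scale1r lE.
Qed.

(** Linear forms equal to 1 on [v] and on [w] multiply to a bilinear form, and the induced form on
    the tensor product takes the value 1. *)
Lemma pure_neq0 (v : V) (w : W) : v <> 0 -> w <> 0 -> pure v w <> 0.
Proof.
move=> v0 w0; have [l [llin lv]] := separating_form v0.
have [m [mlin mw]] : exists m : W -> K^o, linear m /\ m w = 1.
  have [|||m [mlin mE]] := @linear_extension K K^o W K^o (fun c => c *: w) id.
  - by move=> a b c; rewrite scalerDl scalerA.
  - by [].
  - move=> a b /eqP; rewrite -subr_eq0 -scalerBl scaler_eq0 subr_eq0 => /orP[/eqP//|].
    by move=> /eqP.
  by exists m; split=> //; rewrite -{1}[w]scale1r mE.
move=> vw0; pose b v w : K := l v * m w.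
have bl a x x' y : b (a *: x + x') y = a * b x y + b x' y.
  by rewrite /b llin mulrDl mulrA.
have br a x y y' : b x (a *: y + y') = a * b x y + b x y'.
  by rewrite /b mlin mulrDr mulrCA.
have := tens_lift_pure bl br v w; rewrite vw0.
have -> : (0 : tens V W) = tcl [::] by rewrite tclE big_nil.
rewrite (tens_lift_tcl bl br) big_nil /b lv mw mulr1 => /esym/eqP.
by rewrite oner_eq0.
Qed.

Lemma tens_genr (w0 : W) : (forall w, exists c, w = c *: w0) ->
  forall u : tens V W, exists v, u = pure v w0.
Proof.
move=> gen; elim/tensW => l; rewrite tclE.
elim: l => [|[v w] l [v' IH]]; first by exists 0; rewrite big_nil pure0l.
have [c ->] := gen w; exists (c *: v + v').
by rewrite big_cons IH /= pureDl pureZl pureZr.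
Qed.

Lemma tens_genl (v0 : V) : (forall v, exists c, v = c *: v0) ->
  forall u : tens V W, exists w, u = pure v0 w.
Proof.
move=> gen; elim/tensW => l; rewrite tclE.
elim: l => [|[v w] l [w' IH]]; first by exists 0; rewrite big_nil pure0r.
have [c ->] := gen v; exists (c *: w + w').
by rewrite big_cons IH /= pureDr pureZl pureZr.
Qed.

End PureTensors.

Section ConstantFill.
Variables (K : fieldType) (X : topologicalType) (Z : set X).

Lemma cst_fill_out (c : K) x : ~ Z x -> cst_fill Z c x = 0.
Proof. by move=> nZx; apply: subsp_inj; rewrite /= asboolF. Qed.

Lemma cst_fill_gen x (w : cst_stalk K Z x) : exists c, w = c *: cst_fill Z 1 x.
Proof.
exists (subsp_val w); apply: subsp_inj.
rewrite -[RHS]/((subsp_val w : K) * (if `[< Z x >] then 1 else 0)).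
case: asboolP => Zx; first by rewrite mulr1.
by rewrite mulr0 [LHS](subsp_valP w Zx).
Qed.

Lemma cst_fill_neq0 x : Z x -> cst_fill Z (1 : K) x <> 0.
Proof.
move=> Zx /(congr1 (fun u : cst_stalk K Z x => subsp_val u)) /=.
by rewrite asboolT // => /eqP; rewrite oner_eq0.
Qed.

Lemma cst_fill_closed_reg (c : K) (lcZ : locally_closed Z) x : closed Z ->
  regular (cst_fill Z c : dprod (cst_sheaf K lcZ)) x.
Proof.
move=> cZ; have [Zx|nZx] := pselect (Z x).
  by apply: nearW => y Zy /=; rewrite !asboolT.
have : nbhs x (~` Z) by apply: open_nbhs_nbhs; split=> //; exact: closed_openC.
by apply: filterS => y nZy /nZy.
Qed.

End ConstantFill.

Section EsheafCoordinates.
Variables (R : realType) (X : topologicalType).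
Local Notation k := R[i].
Variables (Z : set X) (lcZ : locally_closed Z) (phi : X -> R) (cphi : continuous phi).

Lemma closed_epi : closed (epi phi).
Proof.
have c : continuous (fun p : X * R => p.2 + phi p.1).
  apply: continuous_add; first exact: continuous_snd.
  exact: (continuous_compo (@continuous_fst X R) cphi).
by have /continuous_closedP/(_ _ (@closed_ge R 0)) := c.
Qed.

Definition Efill (c : k) : dprod (Esheaf lcZ cphi) :=
  fun x => pure (cst_fill Z c x.1 : inv_sheaf (@continuous_fst X R) (cst_sheaf k lcZ) x)
    (cst_fill (epi phi) (1 : k) x).

Lemma Efill_reg c x : closed Z -> regular (Efill c) x.
Proof.
move=> cZ; exists [:: ((fun y => cst_fill Z c y.1) :
    dprod (inv_sheaf (@continuous_fst X R) (cst_sheaf k lcZ)),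
   cst_fill (epi phi) (1 : k) : dprod (cst_sheaf k (locally_closed_epi cphi)))].
  move=> p; rewrite inE => /eqP -> /=; split.
    exists (cst_fill Z c : dprod (cst_sheaf k lcZ)); last by apply: filterE.
    exact: cst_fill_closed_reg.
  exact: (@cst_fill_closed_reg k (X * R)%type (epi phi) 1 (locally_closed_epi cphi) x closed_epi).
by apply: filterE => y; rewrite big_seq1.
Qed.

Lemma Egen x (u : Esheaf lcZ cphi x) : exists c, u = c *: Efill 1 x.
Proof.
have [v ->] := tens_genr (@cst_fill_gen k _ (epi phi) x) u.
have [c ->] := cst_fill_gen v; exists c.
by rewrite pureZl.
Qed.

Lemma Efill_out c x : ~ (Z x.1 /\ epi phi x) -> Efill c x = 0.
Proof.
move=> n; rewrite /Efill; have [Zx|nZx] := pselect (Z x.1).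
  by rewrite (@cst_fill_out _ _ (epi phi)) ?pure0r // => ex; apply: n.
by rewrite cst_fill_out // pure0l.
Qed.

Lemma Efill_neq0 x : Z x.1 -> epi phi x -> Efill 1 x <> 0.
Proof. by move=> Zx ex; apply: pure_neq0; exact: cst_fill_neq0. Qed.

End EsheafCoordinates.

Section EcoordTheory.
Variable R : realType.
Local Notation k := R[i].
Local Notation Cplx := (Cplx R).
Variables (Z : set Cplx) (lcZ : locally_closed Z) (phi : Cplx -> R) (cphi : continuous phi).

Let bl (x : Cplx * R) c (v v' : cst_stalk k Z x.1) (w : cst_stalk k (epi phi) x) :
  (subsp_val (c *: v + v') : k) * subsp_val w
    = c * ((subsp_val v : k) * subsp_val w) + (subsp_val v' : k) * subsp_val w.
Proof. by rewrite subsp_val_lin mulrDl mulrA. Qed.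

Let br (x : Cplx * R) c (v : cst_stalk k Z x.1) (w w' : cst_stalk k (epi phi) x) :
  (subsp_val v : k) * subsp_val (c *: w + w')
    = c * ((subsp_val v : k) * subsp_val w) + (subsp_val v : k) * subsp_val w'.
Proof. by rewrite subsp_val_lin mulrDr mulrCA. Qed.

Lemma Ecoord_lin x a (u v : Esheaf lcZ cphi x) :
  Ecoord (a *: u + v) = a * Ecoord u + Ecoord v.
Proof.
elim/tensW: u => l; elim/tensW: v => m.
have -> : a *: tcl l + tcl m = tcl (mapl ( *:%R a) l ++ m).
  by rewrite scale_tcl !tclE big_cat.
rewrite /Ecoord !(tens_lift_tcl (@bl x) (@br x)) big_cat big_map mulr_sumr /=.
congr (_ + _); apply: eq_bigr => -[v w] _ /=.
exact: (esym (mulrA a (subsp_val v : k) (subsp_val w : k))).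
Qed.

Lemma Ecoord0 x : Ecoord (0 : Esheaf lcZ cphi x) = 0.
Proof.
by have := Ecoord_lin (-1) (0 : Esheaf lcZ cphi x) 0; rewrite scaler0 addr0 mulN1r addNr.
Qed.

Lemma EcoordZ x a (u : Esheaf lcZ cphi x) : Ecoord (a *: u) = a * Ecoord u.
Proof. by rewrite -[a *: u]addr0 Ecoord_lin Ecoord0 addr0. Qed.

Lemma Ecoord_fill x c : Z x.1 ->
  Ecoord (Efill lcZ cphi c x) = if 0 <= x.2 + phi x.1 then c else 0.
Proof.
move=> Zx; rewrite /Efill Ecoord_pure /= asboolT //.
have -> : `[< epi phi x >] = (0 <= x.2 + phi x.1) by exact: asboolb.
by case: ifP; rewrite ?mulr1 ?mulr0.
Qed.

Lemma Ecoord_inj x (u v : Esheaf lcZ cphi x) : Z x.1 -> Ecoord u = Ecoord v -> u = v.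
Proof.
move=> Zx; have [a ->] := Egen u; have [b ->] := Egen v.
rewrite !EcoordZ Ecoord_fill //; case: ifP => [_|ne]; first by rewrite !mulr1 => ->.
by move=> _; rewrite Efill_out ?scaler0 // => -[_ e]; rewrite /epi /= ne in e.
Qed.

End EcoordTheory.

Section GermRestr.
Variable R : realType.
Local Notation k := R[i].
Local Notation Cplx := (Cplx R).
Variables (F : sheaf k (Cplx * R)%type) (Z : set Cplx) (lcZ : locally_closed Z).

Lemma germ_restr_inj x (u v : F x) : Z x.1 ->
  germ_restr lcZ u = germ_restr lcZ v -> u = v.
Proof.
move=> Zx uv; apply/eqP; rewrite -subr_eq0; apply/eqP; apply: contrapT => uv0.
apply: (@pure_neq0 _ _ _ (u - v) (cst_fill (fst @^-1` Z) (1 : k) x) uv0).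
  exact: cst_fill_neq0.
rewrite pureDl -scaleN1r pureZl scaleN1r.
by apply/eqP; rewrite subr_eq0; apply/eqP.
Qed.

Lemma germ_restr_surj x (u : restr F lcZ x) : exists v, germ_restr lcZ v = u.
Proof.
have [v ->] := tens_genr (@cst_fill_gen k _ (fst @^-1` Z) x) u.
by exists v.
Qed.

Lemma germ_restr_lin x : linear (fun v : F x => germ_restr lcZ v).
Proof. move=> a u v; rewrite /germ_restr pureDl; congr (_ + _); exact: pureZl. Qed.

Lemma germ_restr_reg (s : dprod F) x : closed Z -> regular s x ->
  regular (fun y => germ_restr lcZ (s y)) x.
Proof.
move=> cZ sx.
exists [:: (s, cst_fill (fst @^-1` Z) (1 : k) :
   dprod (cst_sheaf k (locally_closed_preimage (@continuous_fst Cplx R) lcZ)))].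
  move=> p; rewrite inE => /eqP -> /=; split=> //.
  have cZ' : closed (fst @^-1` Z : set (Cplx * R)).
    by have /continuous_closedP := @continuous_fst Cplx R; apply.
  exact: (@cst_fill_closed_reg k (Cplx * R)%type _ 1
    (locally_closed_preimage (@continuous_fst Cplx R) lcZ) x cZ').
by apply: filterE => y; rewrite big_seq1.
Qed.

End GermRestr.

(* Trivial monodromy turns F into a quotient of the constant sheaf k^N: in the
   j-th chart the constant section v reads chart j *m v. *)
Section GluingSections.
Variable R : realType.
Local Notation k := R[i].
Local Notation Cplx := (Cplx R).
Variables (C : {fset R[i]}) (theta0 : R) (r : R[i] -> nat) (N : nat).
Variables (sigma : 'Z_4 -> 'M[R[i]]_N) (F : sheaf k (Cplx * R)%type).
Hypothesis gF : is_gluing C theta0 r sigma F.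
Variable chart : 'Z_4 -> 'M[R[i]]_N.
Hypothesis chart_unit : forall j, chart j \in unitmx.
Hypothesis chartS : forall j : 'Z_4, chart (j + 1) = sigma j *m chart j.

Local Notation c_ a := (row_exponent C theta0 r (nat_of_ord a)).
Let alive (x : Cplx * R) (a : 'I_N) := 0 <= x.2 + qphase (c_ a) x.1.

(** A row alive at [x] only involves coordinates alive at [x]; so setting dead rows to 0 commutes
    with [sigma], and the formula in one chart implies the formula in the next. *)
Hypothesis alive_sigma : forall (j : 'Z_4) (x : Cplx * R) a b, sector theta0 j x.1 ->
  sector theta0 (j + 1 : 'Z_4)%R x.1 -> sigma j a b != 0 -> alive x a -> alive x b.
Hypothesis closed_sector : forall j : nat, closed (sector theta0 j).
Hypothesis sector_chain : forall z : Cplx, exists2 i : 'Z_4, sector theta0 i z &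
  forall P : 'Z_4 -> Prop, P i ->
    (forall j : 'Z_4, sector theta0 j z -> sector theta0 (j + 1 : 'Z_4)%R z -> P j -> P (j + 1)) ->
    forall j : 'Z_4, sector theta0 j z -> P j.

Definition gluing_ker (x : Cplx * R) (v : 'cV[k]_N) := forall (j : 'Z_4) (a : 'I_N),
  sector theta0 j x.1 -> 0 <= x.2 + qphase (c_ a) x.1 -> (chart j *m v) a 0 = 0.

(** The germ [tau v x] is characterised by its coordinates in all charts at [x]: those of
    [chart j *m v], with 0 in the dead rows. It is built in one sector by inverting [alpha], and
    [sector_chain] carries the characterisation to the other sectors at [x]. *)
Lemma gluing_sections : exists tau : 'cV[k]_N -> dprod F, [/\ linear tau,
  forall v x, regular (tau v) x, forall v x, tau v x = 0 <-> gluing_ker x v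
  & forall x f, exists v, tau v x = f].
Proof.
have [alpha [aiso aglue]] := gF.
pose lc j := locally_closed_sector theta0 j.
pose co (j : 'Z_4) (x : Cplx * R) (f : F x) (a : 'I_N) : k :=
  Ecoord (alpha j x (germ_restr (lc j) f) a).
have co_lin j x b (f f' : F x) a : co j x (b *: f + f') a = b * co j x f a + co j x f' a.
  by rewrite /co germ_restr_lin hom_lin -Ecoord_lin.
have co_inj (j : 'Z_4) (x : Cplx * R) (f f' : F x) : sector theta0 j x.1 ->
    (forall a, co j x f a = co j x f' a) -> f = f'.
  move=> jx e; apply: (germ_restr_inj (lcZ := lc j)) => //.
  apply: (bij_inj (aiso j x)); apply: functional_extensionality_dep => a.
  exact: Ecoord_inj (e a).
have co_dead (j : 'Z_4) (x : Cplx * R) (f : F x) a : sector theta0 j x.1 -> ~~ alive x a -> co j x f a = 0.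
  move=> jx nal; rewrite /co; have [b ->] := Egen (alpha j x (germ_restr (lc j) f) a).
  by rewrite EcoordZ Ecoord_fill // -/(alive x a) (negbTE nal) mulr0.
pose char (x : Cplx * R) (v : 'cV[k]_N) (f : F x) := forall j : 'Z_4, sector theta0 j x.1 -> forall a,
  co j x f a = if alive x a then (chart j *m v) a 0 else 0.
have char_step (x : Cplx * R) : exists2 i : 'Z_4, sector theta0 i x.1 & forall (v : 'cV[k]_N) (f : F x),
    (forall a, co i x f a = if alive x a then (chart i *m v) a 0 else 0) -> char x v f.
  have [i ix chain] := sector_chain x.1; exists i => // v f fi j jx.
  apply: (chain (fun j => forall a, co j x f a = if alive x a then (chart j *m v) a 0 else 0)) => //.
  move=> {}j {}jx j1x fj a; rewrite /co aglue //; rewrite -/(alive x a).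
  case: ifP => // ax; rewrite chartS -mulmxA mxE; apply: eq_bigr => b _.
  have [->|sab] := eqVneq (sigma j a b) 0; first by rewrite !mul0r.
  by rewrite -[Ecoord _]/(co j x f b) fj (alive_sigma jx j1x sab ax).
have char_uniq (x : Cplx * R) (v : 'cV[k]_N) (f f' : F x) : char x v f -> char x v f' -> f = f'.
  have [i ix _] := sector_chain x.1.
  by move=> /(_ i ix) cf /(_ i ix) cf'; apply: (co_inj i) => // a; rewrite cf cf'.
pose model j (v : 'cV[k]_N) : dprod (local_model C theta0 r N j) := fun x a =>
  Efill (lc j) (@continuous_qphase R (c_ a)) ((chart j *m v) a 0) x.
have model_co (j : 'Z_4) (v : 'cV[k]_N) (x : Cplx * R) a : sector theta0 j x.1 ->
    Ecoord (model j v x a) = if alive x a then (chart j *m v) a 0 else 0.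
  by move=> jx; rewrite Ecoord_fill.
have model_reg j (v : 'cV[k]_N) x : regular (model j v) x.
  by move=> a; apply: Efill_reg; exact: closed_sector.
have char_ex (x : Cplx * R) (v : 'cV[k]_N) : {f : F x | char x v f}.
  apply: cid; have [i ix step] := char_step x.
  have [binv _ bK] := aiso i x.
  have [f fE] := germ_restr_surj (binv (model i v x)).
  by exists f; apply: step => a; rewrite /co fE bK model_co.
pose tau (v : 'cV[k]_N) : dprod F := fun x => projT1 (char_ex x v).
have tauP v x : char x v (tau v x) := projT2 (char_ex x v).
exists tau; split.
- move=> b u v; apply: functional_extensionality_dep => x.
  apply: (char_uniq x (b *: u + v)) => // j jx a.
  rewrite -[(b *: tau u + tau v) x]/(b *: tau u x + tau v x) co_lin !tauP //.
  by case: ifP => // _; rewrite ?mulr0 ?addr0 // mulmxDr -scalemxAr !mxE.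
(* A section through the germ agrees with the constant model in every chart at [x], hence near [x];
   a closed sector missing [x] is also missed near [x]. By [char_uniq] this section is [tau v] near
   [x]. *)
- move=> v x; have [s sx sE] := regular_germ (tau v x).
  pose Q (j : 'Z_4) : set (Cplx * R) := fun y => sector theta0 j y.1 -> forall a,
      co j y (s y) a = if alive y a then (chart j *m v) a 0 else 0.
  have : \forall y \near x, forall j, Q j y.
    apply: (@filter_forall _ _ Q (nbhs x)) => j; have [jx|njx] := pselect (sector theta0 j x.1).
      have rs : regular (fun y => alpha j y (germ_restr (lc j) (s y))) x.
        by apply: hom_reg; apply: germ_restr_reg => //; exact: closed_sector.
      have e : alpha j x (germ_restr (lc j) (s x)) = model j v x.
        apply: functional_extensionality_dep => a; apply: Ecoord_inj => //.
        by rewrite model_co // sE; exact: tauP.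
      apply: (@filterS _ (nbhs x) _ _ _ _ (regular_sep rs (model_reg j v x) e)) => y ye jy a.
      by rewrite /co ye model_co.
    have : nbhs x (fst @^-1` (~` sector theta0 j)).
      apply: (@continuous_fst Cplx R x); apply: open_nbhs_nbhs; split=> //.
      by apply: closed_openC; exact: closed_sector.
    by move=> nx; apply: (@filterS _ (nbhs x) _ _ _ _ nx) => y ny /ny.
  move=> cs; apply: (regular_local _ sx); apply: (@filterS _ (nbhs x) _ _ _ _ cs) => y cy.
  exact: (char_uniq y v).
- move=> v x; split=> [t0 j a jx ax|kv].
    have := tauP v x j jx a; rewrite t0 /alive ax => <-.
    have := co_lin j x (-1) (0 : F x) 0 a; rewrite scaler0 addr0 mulN1r addNr.
    exact.
  have [i ix _] := sector_chain x.1; apply: (co_inj i) => // a.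
  have -> : co i x 0 a = 0.
    by have := co_lin i x (-1) (0 : F x) 0 a; rewrite scaler0 addr0 mulN1r addNr.
  by rewrite tauP //; case: ifP => // ax; exact: kv.
(* One invertible chart determines a preimage; the dead coordinates of [f] vanish anyway. *)
- move=> x f; have [i ix step] := char_step x.
  exists (invmx (chart i) *m \col_a co i x f a).
  apply: (char_uniq x (invmx (chart i) *m \col_a co i x f a)) => //.
  apply: step => a; rewrite mulmxA mulmxV // mul1mx mxE.
  by case: ifPn => // nax; rewrite co_dead.
Qed.

End GluingSections.

(** * Geometry of the quadratic phases *)

Section Quadrants.
Variable R : realType.

(** Closed half-lines, so that 0 has both signs, as boundary points lie in both adjacent closed
    sectors. *)
Definition pos (b : bool) (x : R) := 0 <= (if b then x else - x).

Lemma pos_total b x : pos b x \/ pos (~~ b) x.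
Proof. by rewrite /pos; case: b => /=; case: (leP 0 x) => ?; [left|right|right|left]; lra. Qed.

Lemma pos_both b x : pos b x -> pos (~~ b) x -> x = 0.
Proof. by rewrite /pos; case: b => /= ? ?; lra. Qed.

Lemma pos_ex x : exists b, pos b x.
Proof. by have [?|?] := pos_total true x; [exists true|exists false]. Qed.

Lemma pos_mul b x y : pos b x -> pos b y -> 0 <= x * y.
Proof. by rewrite /pos; case: b => x0 y0; first exact: mulr_ge0; rewrite -mulrNN mulr_ge0. Qed.

Lemma posN b x : pos (~~ b) (- x) <-> pos b x.
Proof. by rewrite /pos; case: b => /=; rewrite ?opprK. Qed.

Lemma pos_mulN b x y : pos b x -> pos (~~ b) y -> x * y <= 0.
Proof. by rewrite -[y]opprK posN => bx bY; have := pos_mul bx bY; rewrite mulrN; lra. Qed.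

Lemma pos_scale b c x : 0 < c -> pos b x -> pos b (c * x).
Proof. by rewrite /pos; case: b => c0 x0; rewrite -?mulrN; apply: mulr_ge0 => //; exact: ltW. Qed.

(* The height of c = rho cis(argC): in rotated coordinates z = x + i y and
   w = w1 + i w2, the point (z, s + Re(z w)) lies over the support of c iff
   0 <= height rho s x y w1 w2. *)
Definition height (rho s x y w1 w2 : R) := s + x * w1 - y * w2 - rho / 2 * (x ^+ 2 - y ^+ 2).
(* its maximum over x *)
Definition height_x (rho s y w1 w2 : R) := s + w1 ^+ 2 / (2 * rho) - y * w2 + rho / 2 * y ^+ 2.
(* its critical value in (x, y) *)
Definition height_c (rho s w1 w2 : R) := s + (w1 ^+ 2 - w2 ^+ 2) / (2 * rho).

Section Heights.
Variables (rho s w1 w2 : R).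
Hypothesis rho0 : 0 < rho.

Let rn0 : rho != 0. Proof. by rewrite gt_eqF. Qed.

(** The height is concave in x with maximum at w1 / rho, and the hypothesis places [x'] between [x]
    and the maximiser. *)
Lemma height_mono x x' y : 0 <= (x' - x) * (w1 - rho * x') ->
  height rho s x y w1 w2 <= height rho s x' y w1 w2.
Proof.
move=> le; rewrite -subr_ge0 /height.
have -> : s + x' * w1 - y * w2 - rho / 2 * (x' ^+ 2 - y ^+ 2) -
    (s + x * w1 - y * w2 - rho / 2 * (x ^+ 2 - y ^+ 2)) =
    (x' - x) * (w1 - rho * x') + rho / 2 * (x' - x) ^+ 2 by field.
by rewrite addr_ge0 // mulr_ge0 ?sqr_ge0 // divr_ge0 // ltW.
Qed.

Lemma height_le_x x y : height rho s x y w1 w2 <= height_x rho s y w1 w2.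
Proof.
rewrite -subr_ge0 /height /height_x.
have -> : s + w1 ^+ 2 / (2 * rho) - y * w2 + rho / 2 * y ^+ 2 -
    (s + x * w1 - y * w2 - rho / 2 * (x ^+ 2 - y ^+ 2)) =
    rho / 2 * (x - w1 / rho) ^+ 2 by field.
by rewrite mulr_ge0 ?sqr_ge0 // divr_ge0 // ltW.
Qed.

Lemma height_argmax y : height rho s (w1 / rho) y w1 w2 = height_x rho s y w1 w2.
Proof. by rewrite /height /height_x; field. Qed.

(** Here the function is convex with minimum at w2 / rho, and the hypothesis says that [y] lies
    beyond [t], away from the minimiser. *)
Lemma height_x_mono y t : 0 <= (y - t) * (rho * t - w2) ->
  height_x rho s t w1 w2 <= height_x rho s y w1 w2.
Proof.
move=> le; rewrite -subr_ge0 /height_x.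
have -> : s + w1 ^+ 2 / (2 * rho) - y * w2 + rho / 2 * y ^+ 2 -
    (s + w1 ^+ 2 / (2 * rho) - t * w2 + rho / 2 * t ^+ 2) =
    (y - t) * (rho * t - w2) + rho / 2 * (y - t) ^+ 2 by field.
by rewrite addr_ge0 // mulr_ge0 ?sqr_ge0 // divr_ge0 // ltW.
Qed.

Lemma height_c_le y : height_c rho s w1 w2 <= height_x rho s y w1 w2.
Proof.
rewrite -subr_ge0 /height_c /height_x.
have -> : s + w1 ^+ 2 / (2 * rho) - y * w2 + rho / 2 * y ^+ 2 -
    (s + (w1 ^+ 2 - w2 ^+ 2) / (2 * rho)) = rho / 2 * (y - w2 / rho) ^+ 2 by field.
by rewrite mulr_ge0 ?sqr_ge0 // divr_ge0 // ltW.
Qed.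

Lemma height_x_argmin : height_x rho s (w2 / rho) w1 w2 = height_c rho s w1 w2.
Proof. by rewrite /height_x /height_c; field. Qed.

End Heights.

(** On the axis x = 0 a larger rho survives longer, on y = 0 a smaller one: the alternation of upper
    and lower triangular matrices. *)
Lemma height_x0_le rho rho' s y w1 w2 : rho <= rho' ->
  height rho s 0 y w1 w2 <= height rho' s 0 y w1 w2.
Proof. by move=> le; rewrite /height; have := sqr_ge0 y; nra. Qed.

Lemma height_y0_le rho rho' s x w1 w2 : rho' <= rho ->
  height rho s x 0 w1 w2 <= height rho' s x 0 w1 w2.
Proof. by move=> le; rewrite /height; have := sqr_ge0 x; nra. Qed.

(** Lowering rho raises w1^2 / (2 rho), and moving y from 0 to the side opposite to [w2] adds the
    two nonnegative terms - y w2 and rho' y^2 / 2. *)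
Lemma height_x_pos rho rho' s y w1 w2 : 0 < rho' -> rho' <= rho -> y * w2 <= 0 ->
  0 <= height_x rho s 0 w1 w2 -> 0 <= height_x rho' s y w1 w2.
Proof.
move=> r0 rr yw; rewrite /height_x mul0r expr0n /= mulr0 subr0 addr0 => le.
have : w1 ^+ 2 / (2 * rho) <= w1 ^+ 2 / (2 * rho').
  apply: ler_wpM2l; first exact: sqr_ge0.
  by rewrite lef_pV2 ?posrE ?mulr_gt0 //; [rewrite ler_pM2l|lra].
have : 0 <= rho' / 2 * y ^+ 2 by rewrite mulr_ge0 ?sqr_ge0 // divr_ge0 // ltW.
by lra.
Qed.

(** As |x| >= 1, multiplying the bound by rho |x| / 2 shows that the quadratic term exceeds all the
    others; the summand 1 provides the strict margin rho / 2. *)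
Lemma height_bound rho (B x s y w1 w2 : R) : 0 < rho -> 0 <= B ->
  `|s| <= B -> `|y| <= B -> `|w1| <= B -> `|w2| <= B ->
  1 + 2 * (2 * B + B ^+ 2 + rho * B ^+ 2) / rho <= `|x| ->
  height rho s x y w1 w2 < 0.
Proof.
move=> r0 B0 sB yB w1B w2B xM.
have x1 : 1 <= `|x|.
  apply: le_trans xM; rewrite lerDl divr_ge0 ?(ltW r0) //.
  have := sqr_ge0 B; have := mulr_ge0 (ltW r0) (sqr_ge0 B); lra.
have q1 : rho + 2 * (2 * B + B ^+ 2 + rho * B ^+ 2) <= rho * `|x|.
  have -> : rho + 2 * (2 * B + B ^+ 2 + rho * B ^+ 2) =
     rho * (1 + 2 * (2 * B + B ^+ 2 + rho * B ^+ 2) / rho) by field; rewrite gt_eqF.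
  by rewrite ler_pM2l.
have e1 : x * w1 <= `|x| * B.
  by apply: le_trans (ler_norm _) _; rewrite normrM ler_wpM2l.
have e2 : - (y * w2) <= B ^+ 2.
  rewrite -mulNr; apply: le_trans (ler_norm _) _.
  by rewrite normrM normrN expr2 ler_pM.
have e3 : y ^+ 2 <= B ^+ 2.
  by rewrite -[y ^+ 2]ger0_norm ?sqr_ge0 // normrX ler_pXn2r ?nnegrE.
have e4 : x ^+ 2 = `|x| ^+ 2 by rewrite real_normK // num_real.
have e5 : s <= B by exact: le_trans (ler_norm _) _.
have e6 : rho / 2 * y ^+ 2 <= rho / 2 * B ^+ 2 by rewrite ler_pM2l // divr_gt0.
rewrite /height mulrBr e4; set X := `|x| in x1 q1 e1 *.
have rB : 0 <= rho * B ^+ 2 by rewrite mulr_ge0 ?sqr_ge0 // ltW.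
have B2 := sqr_ge0 B.
have q2 : X * (rho + 2 * (2 * B + B ^+ 2 + rho * B ^+ 2)) <= X * (rho * X).
  by rewrite ler_wpM2l //; lra.
have q3 : B + B ^+ 2 + rho * B ^+ 2 <= X * (B + B ^+ 2 + rho * B ^+ 2).
  by rewrite ler_peMl //; lra.
have q4 : rho <= X * rho by rewrite ler_peMl // ltW.
have -> : rho / 2 * X ^+ 2 = X * (rho * X) / 2 by field.
have := rB; rewrite !mulrDr in q2 q3 *; lra.
Qed.

Variables (N : nat) (k : fieldType).
Variable rho : 'I_N -> R.
Hypothesis rho0 : forall a, 0 < rho a.
Variable ch : bool -> bool -> 'M[k]_N.
Hypothesis ch_unit : forall e d, ch e d \in unitmx.
(* The charts on either side of the line x = 0, resp. y = 0, differ by a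
   matrix that is upper, resp. lower, triangular for the order of the rho a. *)
Hypothesis ch_x : forall e d (v : 'cV[k]_N) a,
  (forall b, rho a <= rho b -> (ch e d *m v) b 0 = 0) -> (ch (~~ e) d *m v) a 0 = 0.
Hypothesis ch_y : forall e d (v : 'cV[k]_N) a,
  (forall b, rho b <= rho a -> (ch e d *m v) b 0 = 0) -> (ch e (~~ d) *m v) a 0 = 0.

Definition ker_xy (s x y w1 w2 : R) (v : 'cV[k]_N) := forall e d, pos e x -> pos d y ->
  forall a, 0 <= height (rho a) s x y w1 w2 -> (ch e d *m v) a 0 = 0.

Definition ker_y (s y w1 w2 : R) v := forall x, ker_xy s x y w1 w2 v.

Definition ker_c (s w1 w2 : R) (v : 'cV[k]_N) := forall e d, pos e w1 -> pos d w2 ->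
  forall a, 0 <= height_c (rho a) s w1 w2 -> (ch e d *m v) a 0 = 0.

Lemma ch_coord e d (u : 'cV[k]_N) : exists v, ch e d *m v = u.
Proof. by exists (invmx (ch e d) *m u); rewrite mulmxA mulmxV // mul1mx. Qed.

(** Several quadrants meet only on the axes, where the order of the heights matches the
    triangularity in [ch_x] and [ch_y]; so one quadrant decides. *)
Lemma ker_xy1 s x y w1 w2 v e d : pos e x -> pos d y ->
  (forall a, 0 <= height (rho a) s x y w1 w2 -> (ch e d *m v) a 0 = 0) ->
  ker_xy s x y w1 w2 v.
Proof.
move=> ex dy ka.
have kd e' : pos e' x -> forall a, 0 <= height (rho a) s x y w1 w2 ->
    (ch e' d *m v) a 0 = 0.
  move=> e'x a ha; have [->|ne] := eqVneq e' e; first exact: ka.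
  have E : e' = ~~ e by case: (e) (e') ne => [] [].
  rewrite E in e'x *; have x0 := pos_both ex e'x; subst x.
  apply: ch_x => b ab; apply: ka; apply: le_trans ha _.
  exact: height_x0_le.
move=> e' d' e'x d'y a ha; have [->|ne] := eqVneq d' d; first exact: kd.
have E : d' = ~~ d by case: (d) (d') ne => [] [].
rewrite E in d'y *; have y0 := pos_both dy d'y; subst y.
apply: ch_y => b ab; apply: kd => //; apply: le_trans ha _.
exact: height_y0_le.
Qed.

(** On the side opposite to [w1] every height is below its value at x = 0, where [ch_x] changes to
    the chart of that side. *)
Lemma ker_xy_far s x y w1 w2 v e d : pos e w1 -> pos d y ->
  (forall b, 0 <= height (rho b) s 0 y w1 w2 -> (ch e d *m v) b 0 = 0) ->
  pos (~~ e) x -> ker_xy s x y w1 w2 v.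
Proof.
move=> ew dy kb ex; apply: (ker_xy1 ex dy) => a ha.
apply: ch_x => b ab; apply: kb; apply: le_trans ha _.
apply: le_trans (height_x0_le _ _ _ _ ab).
apply: height_mono => //; rewrite mulr0 subr0 sub0r mulNr oppr_ge0.
by rewrite mulrC; exact: pos_mulN ew ex.
Qed.

(** The maximiser w1 / rho_a has the sign of [w1], so the rows are tested at their maxima within one
    chart; the other side is covered by [ker_xy_far]. *)
Lemma ker_yP s y w1 w2 v e d : pos e w1 -> pos d y ->
  ker_y s y w1 w2 v <->
  forall a, 0 <= height_x (rho a) s y w1 w2 -> (ch e d *m v) a 0 = 0.
Proof.
move=> ew dy; split=> [kv a ha|ka x].
  apply: (kv (w1 / rho a)) => //; last by rewrite height_argmax.
  by rewrite mulrC; apply: pos_scale ew; rewrite invr_gt0.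
have [ex|ex] := pos_total e x.
  by apply: (ker_xy1 ex dy) => a ha; apply: ka; apply: le_trans ha _; exact: height_le_x.
apply: (ker_xy_far ew dy _ ex) => b hb; apply: ka; apply: le_trans hb _.
exact: height_le_x.
Qed.

(* Along a horizontal line the supports are intervals; k1 collects the
   coordinates whose support lies, towards the side of w1, beyond x'. *)
Lemma ker_xy_split_signed s x' y w1 w2 v e : pos e w1 -> ker_xy s x' y w1 w2 v ->
  exists k1 k2, [/\ v = k1 + k2,
    forall x, pos e (x' - x) -> ker_xy s x y w1 w2 k1 &
    forall x, pos e (x - x') -> ker_xy s x y w1 w2 k2].
Proof.
move=> ew kv; have [d dy] := pos_ex y.
(* If [x'] lies on the side opposite to [w1], all heights decrease beyond it, so [v] itself serves
   as [k1]. *)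
have [ex'|ex'] := pos_total e x'; last first.
  exists v, 0; split; [by rewrite addr0| |]; last first.
    by move=> x _ e' d' _ _ a _; rewrite mulmx0 mxE.
  move=> x xx'.
  have ex : pos (~~ e) x by move: ex' xx'; rewrite /pos; case: (e) => /=; lra.
  apply: (ker_xy1 ex dy) => a ha; apply: (kv (~~ e) d ex' dy).
  apply: le_trans ha _; apply: height_mono => //; apply: (pos_mul xx').
  have := pos_scale (rho0 a) ex'; move: ew; rewrite /pos; case: (e) => /=; lra.
pose u := ch e d *m v.
pose near a := `[< pos e (w1 - rho a * x') >].
have [k1 k1E] := ch_coord e d (\col_a (if near a then u a 0 else 0)).
exists k1, (v - k1); split.
- by rewrite addrC subrK.
- have k1a x a : pos e x -> pos e (x' - x) -> 0 <= height (rho a) s x y w1 w2 ->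
      (ch e d *m k1) a 0 = 0.
    move=> ex xx' ha; rewrite k1E mxE /near; case: asboolP => // na.
    apply: (kv e d ex' dy); apply: le_trans ha _; apply: height_mono => //.
    exact: pos_mul xx' na.
  move=> x xx'; have [ex|ex] := pos_total e x.
    by apply: (ker_xy1 ex dy) => a; exact: k1a.
  apply: (ker_xy_far ew dy _ ex) => b; apply: k1a; last by rewrite subr0.
  by rewrite /pos; case: (e); rewrite ?oppr0.
- move=> x xx'.
  have ex : pos e x by move: ex' xx'; rewrite /pos; case: (e) => /=; lra.
  apply: (ker_xy1 ex dy) => a ha.
  have -> : (ch e d *m (v - k1)) a 0 = u a 0 - (if near a then u a 0 else 0).
    by rewrite mulmxBr k1E mxE -/u; congr (_ + _); rewrite mxE; congr (- _); rewrite mxE.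
  rewrite /near.
  case: asboolP => na; first by rewrite subrr.
  rewrite subr0; apply: (kv e d ex' dy); apply: le_trans ha _.
  apply: height_mono => //; rewrite -mulrNN opprB; apply: (pos_mul xx').
  rewrite opprB; have [//|] := pos_total e (rho a * x' - w1).
  by rewrite -posN opprB negbK.
Qed.

Lemma ker_xy_split s x' y w1 w2 v : ker_xy s x' y w1 w2 v ->
  exists k1 k2, [/\ v = k1 + k2,
    forall x, x <= x' -> ker_xy s x y w1 w2 k1 &
    forall x, x' <= x -> ker_xy s x y w1 w2 k2].
Proof.
move=> kv; have [[] ew] := pos_ex w1.
  have [k1 [k2 [vE k1P k2P]]] := ker_xy_split_signed ew kv.
  by exists k1, k2; split=> // x xx'; [apply: k1P|apply: k2P]; rewrite /pos subr_ge0.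
have [k1 [k2 [vE k1P k2P]]] := ker_xy_split_signed ew kv.
exists k2, k1; split; first by rewrite addrC.
  by move=> x xx'; apply: k2P; rewrite /pos opprB subr_ge0.
by move=> x xx'; apply: k1P; rewrite /pos opprB subr_ge0.
Qed.

(** If row a is alive at y = 0, then at a [y] opposite to [w2] all rows of smaller rho are alive,
    and these are what [ch_y] needs to change the chart. *)
Lemma ker_y_opposite s y w1 w2 v e d a : pos e w1 -> pos d w2 -> pos (~~ d) y ->
  ker_y s y w1 w2 v -> 0 <= height_x (rho a) s 0 w1 w2 -> (ch e d *m v) a 0 = 0.
Proof.
move=> ew dw dy kv ha; rewrite -[d]negbK; apply: ch_y => b ab.
apply: (ker_yP s w2 v ew dy).1 => //; apply: height_x_pos ha => //.
by rewrite mulrC; exact: pos_mulN dw dy.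
Qed.

(** The critical value is the minimum of [height_x] over y: a row alive for it is alive at every y,
    and [ker_y_opposite] brings the conclusion to the quadrant of the dual variable. *)
Lemma ker_y_ker_c s y w1 w2 v : ker_y s y w1 w2 v -> ker_c s w1 w2 v.
Proof.
move=> kv e d ew dw a ha; have [dy|dy] := pos_total d y.
  by apply: (ker_yP s w2 v ew dy).1 => //; apply: le_trans ha _; exact: height_c_le.
by apply: (ker_y_opposite ew dw dy kv); apply: le_trans ha _; exact: height_c_le.
Qed.

(** Split [v] into its coordinates in the chart of the dual variable. The a-th one dies at the
    minimiser w2 / rho_a, where the height of row a equals its critical value. *)
Lemma ker_c_sum s w1 w2 v : ker_c s w1 w2 v ->
  exists f : 'I_N -> 'cV[k]_N, v = \sum_a f a /\
    forall a, ker_y s (w2 / rho a) w1 w2 (f a).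
Proof.
move=> kv; have [e ew] := pos_ex w1; have [d dw] := pos_ex w2.
pose u := ch e d *m v.
exists (fun a => invmx (ch e d) *m \col_b (if b == a then u a 0 else 0)); split.
  rewrite -mulmx_sumr; have -> : \sum_a \col_b (if b == a then u a 0 else 0) = u.
    apply/colP => b; rewrite summxE (bigD1 b) //= mxE eqxx big1 ?addr0 // => a ab.
    by rewrite mxE eq_sym (negbTE ab).
  by rewrite /u mulmxA mulVmx // mul1mx.
move=> a; have dy : pos d (w2 / rho a).
  by rewrite mulrC; apply: pos_scale dw; rewrite invr_gt0.
apply/(ker_yP _ _ _ ew dy) => b hb; rewrite mulmxA mulmxV // mul1mx mxE.
case: eqP => // ba; subst b; rewrite height_x_argmin // in hb.
exact: kv ew dw a hb.
Qed.

(* Dually to ker_xy_split, coordinates vanish on complements of intervals of y. *)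
Lemma ker_y_cap s t w1 w2 : exists e d : bool, pos e w1 /\ pos d t /\
  forall a, 0 <= height_x (rho a) s t w1 w2 ->
    (forall y v, y <= t -> ker_y s y w1 w2 v -> (ch e d *m v) a 0 = 0) \/
    (forall y v, t <= y -> ker_y s y w1 w2 v -> (ch e d *m v) a 0 = 0).
Proof.
have [e ew] := pos_ex w1; have [d0 dw] := pos_ex w2.
suff [d [dt H]] : exists d, pos d t /\ forall a, 0 <= height_x (rho a) s t w1 w2 ->
    (forall y v, pos d0 (t - y) -> ker_y s y w1 w2 v -> (ch e d *m v) a 0 = 0) \/
    (forall y v, pos d0 (y - t) -> ker_y s y w1 w2 v -> (ch e d *m v) a 0 = 0).
  exists e, d; split=> //; split=> // a /H.
  case: (d0) => -[] H'; [left|right|right|left] => y v ty;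
    by apply: H'; rewrite /pos ?opprB subr_ge0.
have [dt|dt] := pos_total d0 t; last first.
  exists (~~ d0); split=> // a ha; left => y v ty kv.
  have dy : pos (~~ d0) y by move: dt ty; rewrite /pos; case: (d0) => /=; lra.
  apply: (ker_yP s w2 v ew dy).1 => //; apply: le_trans ha _.
  apply: height_x_mono => //; rewrite -mulrNN !opprB; apply: (pos_mul ty).
  have := pos_scale (rho0 a) dt; move: dw; rewrite /pos; case: (d0) => /=; lra.
(* A row alive at [t] stays alive on the whole side of [t] away from its minimiser w2 / rho_a. *)
exists d0; split=> // a ha.
have [right_|left_] := pos_total d0 (rho a * t - w2).
  right => y v ty kv.
  have dy : pos d0 y by move: dt ty; rewrite /pos; case: (d0) => /=; lra.
  apply: (ker_yP s w2 v ew dy).1 => //; apply: le_trans ha _.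
  by apply: height_x_mono => //; exact: pos_mul ty right_.
left => y v ty kv.
have mono y' : pos d0 (t - y') -> 0 <= height_x (rho a) s y' w1 w2.
  move=> ty'; apply: le_trans ha _; apply: height_x_mono => //.
  rewrite -mulrNN !opprB; apply: (pos_mul ty').
  by move: left_; rewrite -posN opprB negbK.
have [dy|dy] := pos_total d0 y.
  by apply: (ker_yP s w2 v ew dy).1 => //; exact: mono.
apply: (ker_y_opposite ew dw dy kv); apply: mono.
by rewrite subr0.
Qed.

End Quadrants.

(** * Sectors and exponents in rotated coordinates *)

Section Coordinates.
Variable R : realType.
Local Notation Cplx := (Cplx R).

Definition crd1 (th : R) (z : R[i]) : R := complex.Re (cis (- th) * z).
Definition crd2 (th : R) (z : R[i]) : R := complex.Im (cis (- th) * z).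

(* The sectors j = 1, 2, 3, 4 are the four quadrants of the rotated plane. *)
Definition quad1 (j : nat) := (j < 2)%N.
Definition quad2 (j : nat) := (0 < j < 3)%N.
Definition quad (e d : bool) : 'Z_4 :=
  inord (if e then (if d then 1 else 0) else (if d then 2 else 3)).

Lemma quad1E e d : quad1 (quad e d) = e.
Proof. by rewrite /quad1 /quad inordK; case: e d => [] []. Qed.
Lemma quad2E e d : quad2 (quad e d) = d.
Proof. by rewrite /quad2 /quad inordK; case: e d => [] []. Qed.
Lemma quadK (j : 'Z_4) : quad (quad1 j) (quad2 j) = j.
Proof.
by apply/val_inj; rewrite /quad /= inordK; case: j => [[|[|[|[|]]]]].
Qed.

Lemma Re_cis (t : R) (z : R[i]) :
  complex.Re (cis (- t) * z) = cos t * complex.Re z + sin t * complex.Im z.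
Proof. by case: z => a b; rewrite /cis cosN sinN /= mulNr opprK. Qed.

Lemma sector_pos (th : R) (j : 'Z_4) (z : Cplx) : sector th j z <->
  pos (quad1 j) (crd1 th z) /\ pos (quad2 j) (crd2 th z).
Proof.
rewrite sectorE /setI /=.
have E t : complex.Re (cis (- (th + t)) * z) =
    cos t * crd1 th z + sin t * crd2 th z.
  by rewrite opprD addrC cisD -mulrA Re_cis.
rewrite !E /pos /quad1 /quad2; case: j => -[|[|[|[|//]]]] _ /=.
- have -> : ((0%:R - 1) * (pi / 2) : R) = - (pi / 2) by rewrite sub0r mulN1r.
  rewrite cosN sinN cos_pihalf sin_pihalf !mul0r cos0 sin0.
  by split=> -[h1 h2]; split; lra.
- rewrite subrr !mul0r cos0 sin0 !mul1r cos_pihalf sin_pihalf.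
  by split=> -[h1 h2]; split; lra.
- have -> : ((2%:R - 1) * (pi / 2) : R) = pi / 2 by field.
  have -> : (2%:R * (pi / 2) : R) = pi by field.
  rewrite cospi sinpi cos_pihalf sin_pihalf.
  by split=> -[h1 h2]; split; lra.
- have -> : ((3%:R - 1) * (pi / 2) : R) = pi by field.
  have -> : (3%:R * (pi / 2) : R) = pi / 2 + pi by field.
  rewrite cosDpi sinDpi cospi sinpi cos_pihalf sin_pihalf.
  by split=> -[h1 h2]; split; lra.
Qed.

Lemma closed_sector (th : R) (j : nat) : closed (sector th j).
Proof.
rewrite sectorE.
have cl (w : R[i]) : closed [set z : Cplx | 0 <= complex.Re (w * z)].
  have c : continuous (fun z : Cplx => complex.Re (w * (z : R[i])) : R).
    apply: (@continuous_ReM R Cplx (fun=> w) id); first exact: cst_continuous.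
    exact: continuous_idC.
  by have /continuous_closedP/(_ _ (@closed_ge R 0)) := c.
exact: closedI.
Qed.

(** A point lies in one sector, in two adjacent ones or, at the origin, in all four; in each case
    these are consecutive from a suitable start. *)
Lemma sector_chain (th : R) (z : Cplx) : exists2 i : 'Z_4, sector th i z &
  forall P : 'Z_4 -> Prop, P i ->
    (forall j : 'Z_4, sector th j z -> sector th (j + 1 : 'Z_4)%R z -> P j -> P (j + 1)) ->
    forall j : 'Z_4, sector th j z -> P j.
Proof.
have S (j : 'Z_4) := sector_pos th j z.
pose x := crd1 th z; pose y := crd2 th z.
have s0 : sector th (0 : 'Z_4)%R z <-> (0 <= x /\ 0 <= - y) by rewrite S.
have s1 : sector th (1 : 'Z_4)%R z <-> (0 <= x /\ 0 <= y) by rewrite S.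
have s2 : sector th (2 : 'Z_4)%R z <-> (0 <= - x /\ 0 <= y) by rewrite S.
have s3 : sector th (3 : 'Z_4)%R z <-> (0 <= - x /\ 0 <= - y) by rewrite S.
have a0 : (0 + 1 : 'Z_4) = 1 by exact/val_inj.
have a1 : (1 + 1 : 'Z_4) = 2 by exact/val_inj.
have a2 : (2 + 1 : 'Z_4) = 3 by exact/val_inj.
have a3 : (3 + 1 : 'Z_4) = 0 by exact/val_inj.
have all4 (Q : 'Z_4 -> Prop) : Q 0 -> Q 1 -> Q 2 -> Q 3 -> forall j, Q j.
  move=> q0 q1 q2 q3 [[|[|[|[|//]]]] i].
  - by move: q0; congr Q; exact/val_inj.
  - by move: q1; congr Q; exact/val_inj.
  - by move: q2; congr Q; exact/val_inj.
  - by move: q3; congr Q; exact/val_inj.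
have step (i j : 'Z_4) (P : 'Z_4 -> Prop) : i + 1 = j ->
    (forall j : 'Z_4, sector th j z -> sector th (j + 1 : 'Z_4)%R z -> P j -> P (j + 1)) ->
    sector th i z -> sector th j z -> P i -> P j.
  by move=> <- H; exact: H.
case: (ltgtP x 0) => hx; case: (ltgtP y 0) => hy.
- exists 3; first by apply/s3; lra.
  move=> P Pi H; apply: all4 => //; rewrite ?s0 ?s1 ?s2; lra.
- exists 2; first by apply/s2; lra.
  move=> P Pi H; apply: all4 => //; rewrite ?s0 ?s1 ?s3; lra.
- have z2 : sector th (2 : 'Z_4)%R z by apply/s2; lra.
  exists 2 => // P Pi H; apply: all4 => //; rewrite ?s0 ?s1; try lra.
  by move=> z3; exact: (step _ _ _ a2 H z2 z3 Pi).
- exists 0; first by apply/s0; lra.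
  move=> P Pi H; apply: all4 => //; rewrite ?s1 ?s2 ?s3; lra.
- exists 1; first by apply/s1; lra.
  move=> P Pi H; apply: all4 => //; rewrite ?s0 ?s2 ?s3; lra.
- have z0 : sector th (0 : 'Z_4)%R z by apply/s0; lra.
  exists 0 => // P Pi H; apply: all4 => //; rewrite ?s2 ?s3; try lra.
  by move=> z1; exact: (step _ _ _ a0 H z0 z1 Pi).
- have z3 : sector th (3 : 'Z_4)%R z by apply/s3; lra.
  exists 3 => // P Pi H; apply: all4 => //; rewrite ?s1 ?s2; try lra.
  by move=> z0; exact: (step _ _ _ a3 H z3 z0 Pi).
- have z1 : sector th (1 : 'Z_4)%R z by apply/s1; lra.
  exists 1 => // P Pi H; apply: all4 => //; rewrite ?s0 ?s3; try lra.
  by move=> z2; exact: (step _ _ _ a1 H z1 z2 Pi).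
- have z0 : sector th (0 : 'Z_4)%R z by apply/s0; lra.
  have z1 : sector th (1 : 'Z_4)%R z by apply/s1; lra.
  have z2 : sector th (2 : 'Z_4)%R z by apply/s2; lra.
  have z3 : sector th (3 : 'Z_4)%R z by apply/s3; lra.
  exists 0 => // P P0 H.
  have P1 := step _ _ _ a0 H z0 z1 P0.
  have P2 := step _ _ _ a1 H z1 z2 P1.
  have P3 := step _ _ _ a2 H z2 z3 P2.
  exact: all4.
Qed.

End Coordinates.

(** * Inverses of triangular matrices *)

Section InverseTriangular.
Variables (k : fieldType) (N : nat) (S : 'M[k]_N) (le : rel 'I_N).
Hypothesis le_trans : forall a b c, le a b -> le b c -> le a c.
Hypothesis S_unit : S \in unitmx.
Hypothesis S_tri : forall a b, S a b != 0 -> le a b.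

Lemma tri_coord (v : 'cV[k]_N) a :
  (forall b, le a b -> v b 0 = 0) -> (S *m v) a 0 = 0.
Proof.
move=> va; rewrite mxE big1 // => b _.
have [->|/S_tri ab] := eqVneq (S a b) 0; first by rewrite mul0r.
by rewrite va ?mulr0.
Qed.

(** The vectors vanishing in the rows above [a] form the image of [E], which [S] maps into itself,
    and onto itself by comparison of ranks; so a vector that [S] sends there lies there. The second
    alternative stands in for reflexivity of [le]. *)
Lemma inv_tri_coord (v : 'cV[k]_N) a :
  (forall b, le a b -> (S *m v) b 0 = 0) -> v a 0 = 0 \/ ~~ le a a.
Proof.
move=> Sv; have [aa|] := boolP (le a a); last by right.
left; pose E : 'M[k]_N := \matrix_(i, j) ((i == j) && ~~ le a i)%:R.
have Ec (u : 'cV[k]_N) i : (E *m u) i 0 = if le a i then 0 else u i 0.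
  rewrite mxE (bigD1 i) //= big1 ?addr0; last first.
    by move=> j ij; rewrite mxE eq_sym (negbTE ij) mul0r.
  by rewrite mxE eqxx; case: (le a i); rewrite ?mul0r ?mul1r.
have ESE : E *m S *m E = S *m E.
  have col_mulmx (A B : 'M[k]_N) i j : (A *m B) i j = (A *m col j B) i 0.
    by rewrite [LHS]mxE [RHS]mxE; apply: eq_bigr => m _; rewrite [in RHS]mxE.
  apply/matrixP => i j; rewrite -mulmxA col_mulmx Ec mxE; case: ifP => // ai.
  rewrite col_mulmx (tri_coord (a := i)) // => b ib; rewrite !mxE.
  by rewrite (le_trans ai ib) andbF.
have sub : ((S *m E)^T <= E^T)%MS by rewrite -ESE -mulmxA trmx_mul submxMl.
have rk : \rank (S *m E)^T = \rank E^T.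
  by rewrite trmx_mul mxrankMfree // row_free_unit unitmx_tr.
have /submxP[D ED] : (E^T <= (S *m E)^T)%MS.
  by rewrite -(mxrank_leqif_sup sub) rk.
have {}ED : E = S *m E *m D^T by rewrite -[LHS]trmxK ED trmx_mul trmxK.
have vE : v = E *m (D^T *m (S *m v)).
  have ESv : E *m (S *m v) = S *m v.
    by apply/colP => i; rewrite Ec; case: ifP => // ai; rewrite Sv.
  have : S *m v = S *m (E *m (D^T *m (S *m v))).
    by rewrite -{1}ESv {1}ED !mulmxA.
  by move=> /(congr1 (mulmx (invmx S))); rewrite !mulKmx.
by rewrite vE Ec aa.
Qed.

End InverseTriangular.

(** * Exponents and dual exponents in rotated coordinates *)

Section Exponents.
Variables (R : realType).
Local Notation Cplx := (Cplx R).
Variables (C : {fset R[i]}) (argC : R) (r : R[i] -> nat) (N : nat).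
Variable sigma : 'Z_4 -> 'M[R[i]]_N.
Hypothesis C_arg : forall c, c \in C -> has_arg c argC.
Let theta0 : R := - (argC / 2).
Let theta0hat : R := pi - theta0.
Let nginv (c : R[i]) : R[i] := - c^-1.
Let Chat := [fset - c^-1 | c in C]%fset.
Let rhat := fun chat : R[i] => r (- chat^-1).

Definition modulus (c : R[i]) : R := complex.Re (c * cis (- argC)).

Lemma cisNK (t : R) : cis t * cis (- t) = 1.
Proof. by rewrite -cisD subrr cis0. Qed.

Lemma modulusE c : c \in C -> c = ((modulus c)%:C)%C * cis argC /\ 0 < modulus c.
Proof.
move=> /C_arg[rho rho0 ->].
have E : (rho%:C)%C * cis argC * cis (- argC) = (rho%:C)%C.
  by rewrite -mulrA cisNK mulr1.
by rewrite /modulus E.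
Qed.

Lemma cis_theta0 : cis (- theta0) * cis (- theta0) = cis argC.
Proof. by rewrite -cisD /theta0 opprK; congr cis; field. Qed.

Lemma cisNpi : cis (- pi : R) = -1.
Proof.
by apply/eqP; rewrite /cis cosN sinN cospi sinpi oppr0 eq_complex /= oppr0 !eqxx.
Qed.

Lemma cis_theta0hat : cis (- theta0hat) * cis (- theta0hat) = cis (- argC).
Proof.
have -> : - theta0hat = - pi + theta0 by rewrite /theta0hat opprB addrC.
rewrite !cisD cisNpi mulrACA -cisD mulrNN mulr1 mul1r; congr cis.
by rewrite /theta0; field.
Qed.

(** The real factor [m] may have any sign: it is positive for C and equals - 1 / [modulus c] for the
    dual exponents. *)
Lemma qphase_rot (c : R[i]) (z : Cplx) (m th : R) u :
  c = (m%:C)%C * u -> cis (- th) * cis (- th) = u ->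
  qphase c z = - (m / 2 * (crd1 th z ^+ 2 - crd2 th z ^+ 2)).
Proof.
move=> -> <-; rewrite /qphase /crd1 /crd2; congr (- _).
have -> : (m%:C)%C * (cis (- th) * cis (- th)) / 2 * (z : R[i]) ^+ 2 =
   ((m / 2)%:C)%C * (cis (- th) * z) ^+ 2.
  have -> : ((m / 2)%:C)%C = (m%:C)%C / 2 :> R[i] by rewrite rmorphM fmorphV rmorph_nat.
  by rewrite exprMn expr2; ring.
by case: (cis (- th) * (z : R[i])) => a b; rewrite expr2 /=; ring.
Qed.

Lemma qphaseE c (z : Cplx) : c \in C -> qphase c z =
  - (modulus c / 2 * (crd1 theta0 z ^+ 2 - crd2 theta0 z ^+ 2)).
Proof. by move=> /modulusE[cE _]; exact: qphase_rot cE cis_theta0. Qed.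

Lemma nginvE c : c \in C -> - c^-1 = ((- (modulus c)^-1)%:C)%C * cis (- argC).
Proof.
move=> /modulusE[cE m0]; rewrite {1}cE invfM.
have -> : (cis argC)^-1 = cis (- argC).
  exact: mulr1_eq (cisNK argC).
by rewrite -fmorphV rmorphN mulNr.
Qed.

End Exponents.

Section Numbering.
Variables (R : realType).
Local Notation Cplx := (Cplx R).
Variables (C : {fset R[i]}) (argC : R) (r : R[i] -> nat) (N : nat).
Variable sigma : 'Z_4 -> 'M[R[i]]_N.
Hypothesis C_arg : forall c, c \in C -> has_arg c argC.
Let theta0 : R := - (argC / 2).
Let theta0hat : R := pi - theta0.
Let nginv (c : R[i]) : R[i] := - c^-1.
Let Chat := [fset - c^-1 | c in C]%fset.
Let rhat := fun chat : R[i] => r (- chat^-1).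

Lemma nginvK : involutive nginv.
Proof. by move=> c; rewrite /nginv invrN opprK invrK. Qed.

Lemma Chat_mem c : (c \in Chat) = (nginv c \in C).
Proof.
apply/imfsetP/idP => [[d dC ->]|cC]; first by rewrite -/(nginv d) nginvK.
by exists (nginv c) => //; rewrite -/(nginv (nginv c)) nginvK.
Qed.

Lemma modulus_inj c d : c \in C -> d \in C -> modulus argC c = modulus argC d -> c = d.
Proof.
move=> cC dC e; have [-> _] := modulusE C_arg cC; have [-> _] := modulusE C_arg dC.
by rewrite e.
Qed.

Lemma Re_ray z : has_arg z theta0 -> exists2 t : R, 0 < t &
  forall c, c \in C -> complex.Re (c / 2 * z ^+ 2) = modulus argC c * t.
Proof.
move=> za; have [t0 t_gt zE] := za; exists (t0 ^+ 2 / 2).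
  by rewrite divr_gt0 ?exprn_gt0.
move=> c cC; apply: oppr_inj; rewrite -[LHS]/(qphase c z) (qphaseE C_arg _ cC).
have -> : crd1 (- (argC / 2)) z = t0 by rewrite /crd1 zE mulrCA -cisD addNr cis0 mulr1.
have -> : crd2 (- (argC / 2)) z = 0 by rewrite /crd2 zE mulrCA -cisD addNr cis0 mulr1.
by rewrite expr0n /= subr0; congr (- _); field.
Qed.

Lemma qphase_hatE c (z : Cplx) : c \in C -> qphase (nginv c) z =
  (crd1 theta0hat z ^+ 2 - crd2 theta0hat z ^+ 2) / (2 * modulus argC c).
Proof.
move=> cC; rewrite (qphase_rot z (nginvE C_arg cC) (cis_theta0hat argC)) -/theta0hat.
have [_ m0] := modulusE C_arg cC; field.
by rewrite gt_eqF.
Qed.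

Lemma Re_ray_hat z : has_arg z theta0hat -> exists2 t : R, 0 < t &
  forall c, c \in C -> complex.Re (nginv c / 2 * z ^+ 2) = - (modulus argC c)^-1 * t.
Proof.
move=> za; have [t0 t_gt zE] := za; exists (t0 ^+ 2 / 2).
  by rewrite divr_gt0 ?exprn_gt0.
move=> c cC; apply: oppr_inj; rewrite -[LHS]/(qphase (nginv c) z) (qphase_hatE _ cC).
have -> : crd1 theta0hat z = t0 by rewrite /crd1 zE mulrCA -cisD addNr cis0 mulr1.
have -> : crd2 theta0hat z = 0 by rewrite /crd2 zE mulrCA -cisD addNr cis0 mulr1.
have [_ m0] := modulusE C_arg cC.
by rewrite expr0n /= subr0; field; rewrite gt_eqF.
Qed.

Lemma generic_C : generic C theta0.
Proof.
move=> c d cC dC /eqP cd z /Re_ray[t t0 zE]; rewrite !zE // => /(mulIf (lt0r_neq0 t0)).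
by move=> e; apply: cd; exact: modulus_inj.
Qed.

Lemma generic_Chat : generic Chat theta0hat.
Proof.
move=> c d; rewrite !Chat_mem => cC dC /eqP cd z /Re_ray_hat[t t0 zE].
rewrite -(nginvK c) -(nginvK d) !zE // => /(mulIf (lt0r_neq0 t0))/oppr_inj/invr_inj e.
by apply: cd; rewrite -(nginvK c) -(nginvK d); congr nginv; exact: modulus_inj.
Qed.

Let s := numbering C theta0.

Lemma numbering_mem c : (c \in s) = (c \in C).
Proof. exact/perm_mem/perm_numbering. Qed.

Lemma has_arg_cis (t : R) : has_arg (cis t) t.
Proof. by exists 1 => //; rewrite mul1r. Qed.

Lemma numbering_modulus c d : c \in C -> d \in C -> (index c s < index d s)%N ->
  modulus argC c < modulus argC d.
Proof.
move=> cC dC lt; have [t t0 zE] := Re_ray (has_arg_cis theta0).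
have tr : transitive (fun c d : R[i] => complex.Re (c / 2 * cis theta0 ^+ 2) < complex.Re (d / 2 * cis theta0 ^+ 2)).
  by move=> x y z; exact: lt_trans.
have := sorted_ltn_index tr (numbering_sorted generic_C (has_arg_cis theta0)).
move=> /(_ c d); rewrite -/s !numbering_mem => /(_ cC dC lt).
by rewrite !zE // ltr_pM2r.
Qed.

(** Along the dual ray the real parts are ordered by - 1 / modulus, which increases with the
    modulus. Two strictly sorted lists with the same members coincide, so the block structure is
    unchanged. *)
Lemma numbering_Chat : numbering Chat theta0hat = map nginv s.
Proof.
have [t t0 zE] := Re_ray_hat (has_arg_cis theta0hat).
have [t' t'0 zE'] := Re_ray (has_arg_cis theta0).
pose le (c d : R[i]) := complex.Re (c / 2 * cis theta0hat ^+ 2) < complex.Re (d / 2 * cis theta0hat ^+ 2).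
apply: (@irr_sorted_eq _ le).
- by move=> x y z; exact: lt_trans.
- by move=> x; rewrite /le ltxx.
- exact: (numbering_sorted generic_Chat (has_arg_cis theta0hat)).
- rewrite sorted_map.
  have := numbering_sorted generic_C (has_arg_cis theta0); rewrite -/s.
  have sC : {subset s <= C} by move=> c; rewrite numbering_mem.
  apply: (@sub_in_sorted _ [in C]); last by apply/allP.
  move=> c d cC dC /=; rewrite /le !zE // !zE' // !mulNr ltrN2 !ltr_pM2r //.
  have [_ c0] := modulusE C_arg cC; have [_ d0] := modulusE C_arg dC.
  by rewrite ltf_pV2.
- move=> c; rewrite (perm_mem (perm_numbering Chat theta0hat)) Chat_mem.
  by rewrite -numbering_mem -{2}(nginvK c) mem_map //; exact: (inv_inj nginvK).
Qed.

Lemma row_exponents_hat : row_exponents Chat theta0hat rhat = map nginv (row_exponents C theta0 r).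
Proof.
rewrite /row_exponents numbering_Chat map_flatten -!map_comp; congr flatten.
apply: eq_map => c /=; rewrite map_nseq /rhat -/(nginv c) -[- (nginv c)^-1]/(nginv (nginv c)).
by rewrite nginvK.
Qed.

Lemma row_exponent_hat a : row_exponent Chat theta0hat rhat a = nginv (row_exponent C theta0 r a).
Proof.
rewrite /row_exponent row_exponents_hat.
have [lt|ge] := ltnP a (size (row_exponents C theta0 r)); first by rewrite (nth_map 0).
(* Beyond the last row both exponents are the default 0, which [nginv] fixes since 0^-1 = 0. *)
by rewrite !nth_default ?size_map // /nginv invr0 oppr0.
Qed.

Lemma block_index_hat a : block_index Chat theta0hat rhat a = block_index C theta0 r a.
Proof.
rewrite /block_index row_exponent_hat numbering_Chat index_map //.
exact: (inv_inj nginvK).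
Qed.

Hypothesis gd : gluing_data C theta0 r sigma.

Lemma gluing_data_hat : gluing_data Chat theta0hat rhat sigma.
Proof.
split.
- by move=> c; rewrite Chat_mem => /(gluing_pos gd).
- rewrite (gluing_size gd) -(size_row_exponents C theta0 r).
  by rewrite -(size_row_exponents Chat theta0hat rhat) row_exponents_hat size_map.
- by move=> j a b oj; rewrite !block_index_hat; exact: (gluing_upper gd).
- by move=> j a b oj; rewrite !block_index_hat; exact: (gluing_lower gd).
- exact: (gluing_monodromy gd).
Qed.

Let c_ (a : 'I_N) := row_exponent C theta0 r a.

Lemma row_exponent_mem a : c_ a \in C.
Proof.
have lt : (a < size (row_exponents C theta0 r))%N.
  by rewrite size_row_exponents -(gluing_size gd).
have /flattenP[_ /mapP[c cs ->]] := mem_nth 0 lt.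
by rewrite mem_nseq => /andP[_ /eqP e]; rewrite /c_ /row_exponent e -numbering_mem.
Qed.

Definition row_modulus (a : 'I_N) : R := modulus argC (c_ a).

Lemma row_modulus_gt0 a : 0 < row_modulus a.
Proof. by have [] := modulusE C_arg (row_exponent_mem a). Qed.

Lemma block_modulus (a b : 'I_N) : (block_index C theta0 r a <= block_index C theta0 r b)%N ->
  row_modulus a <= row_modulus b.
Proof.
rewrite leq_eqVlt => /orP[/eqP e|lt].
  rewrite /row_modulus; suff -> : c_ a = c_ b by [].
  have aC := row_exponent_mem a; have bC := row_exponent_mem b.
  by move: aC bC; rewrite -!numbering_mem => aC bC; have := congr1 (nth 0 s) e; rewrite !nth_index.
by apply/ltW/numbering_modulus => //; exact: row_exponent_mem.
Qed.

Lemma sigma_odd (j : 'Z_4) a b : odd j -> sigma j a b != 0 -> row_modulus a <= row_modulus b.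
Proof.
move=> oj sab; apply: block_modulus; rewrite leqNgt; apply/negP => lt.
by move/eqP: sab; apply; exact: (gluing_upper gd).
Qed.

Lemma sigma_even (j : 'Z_4) a b : ~~ odd j -> sigma j a b != 0 -> row_modulus b <= row_modulus a.
Proof.
move=> oj sab; apply: block_modulus; rewrite leqNgt; apply/negP => lt.
by move/eqP: sab; apply; exact: (gluing_lower gd).
Qed.

Definition chart (j : 'Z_4) : 'M[R[i]]_N := nth 1%:M
  [:: sigma 3%:R *m sigma 2%:R *m sigma 1%:R; 1%:M; sigma 1%:R; sigma 2%:R *m sigma 1%:R] j.

Lemma Z4_cases (P : 'Z_4 -> Prop) : P 0 -> P 1 -> P 2%:R -> P 3%:R -> forall j, P j.
Proof.
move=> q0 q1 q2 q3 [[|[|[|[|//]]]] i].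
- by have -> : Ordinal i = 0 :> 'Z_4 by exact/val_inj.
- by have -> : Ordinal i = 1 :> 'Z_4 by exact/val_inj.
- by have -> : Ordinal i = 2%:R :> 'Z_4 by exact/val_inj.
- by have -> : Ordinal i = 3%:R :> 'Z_4 by exact/val_inj.
Qed.

(** The list defining [chart] starts at 0, that is at the fourth sector; only the passage from 0 to
    1 uses the monodromy. *)
Lemma chartS (j : 'Z_4) : chart (j + 1) = sigma j *m chart j.
Proof.
have e4 : (4%:R : 'Z_4) = 0 by exact/val_inj.
move: j; apply: Z4_cases.
- by rewrite add0r /chart /= -[in RHS]e4 !mulmxA (gluing_monodromy gd).
- by rewrite -[1 + 1]/(2%:R : 'Z_4) /chart /= mulmx1.
- have -> : (2%:R + 1 : 'Z_4) = 3%:R by exact/val_inj.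
  by rewrite /chart.
- have -> : (3%:R + 1 : 'Z_4) = 0 by exact/val_inj.
  by rewrite /chart /= mulmxA.
Qed.

Lemma sigma_unit j : sigma j \in unitmx.
Proof.
have : sigma 4%:R *m sigma 3%:R *m sigma 2%:R *m sigma 1%:R \in unitmx.
  by rewrite (gluing_monodromy gd) unitmx1.
rewrite !unitmx_mul => /andP[/andP[/andP[u4 u3] u2] u1].
have e4 : (0 : 'Z_4) = 4%:R by exact/val_inj.
by move: j; apply: Z4_cases; [rewrite e4; exact: u4|exact: u1|exact: u2|exact: u3].
Qed.

Lemma chart_unit j : chart j \in unitmx.
Proof.
by move: j; apply: Z4_cases; rewrite /chart /= ?unitmx_mul ?unitmx1 ?sigma_unit.
Qed.

Definition qchart (e d : bool) := chart (quad e d).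

Lemma qchart_unit e d : qchart e d \in unitmx.
Proof. exact: chart_unit. Qed.

Lemma qchart_step (j : 'Z_4) e d e' d' : quad e d = j -> quad e' d' = j + 1 ->
  qchart e' d' = sigma j *m qchart e d.
Proof. by rewrite /qchart => -> ->; exact: chartS. Qed.

Let upper (a b : 'I_N) := row_modulus a <= row_modulus b.
Let lower (a b : 'I_N) := row_modulus b <= row_modulus a.

(** Crossing the ray forwards uses the shape of sigma_j, crossing it backwards that of its inverse;
    both are needed, since the sign changes of [qchart_x] and [qchart_y] go in either direction. *)
Lemma tri_step (le : rel 'I_N) (j : 'Z_4) e d e' d' (v : 'cV[R[i]]_N) a :
  (forall a b c, le a b -> le b c -> le a c) -> (forall a, le a a) ->
  (forall a b, sigma j a b != 0 -> le a b) ->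
  quad e d = j -> quad e' d' = j + 1 ->
  ((forall b, le a b -> (qchart e d *m v) b 0 = 0) -> (qchart e' d' *m v) a 0 = 0) /\
  ((forall b, le a b -> (qchart e' d' *m v) b 0 = 0) -> (qchart e d *m v) a 0 = 0).
Proof.
move=> tr rf tri jE j1E; have E := qchart_step jE j1E; split => kb.
  by rewrite E -mulmxA; apply: (tri_coord tri).
have [] := inv_tri_coord tr (sigma_unit j) tri (v := qchart e d *m v) (a := a).
- by move=> b ab; rewrite mulmxA -E; exact: kb.
- by [].
- by rewrite rf.
Qed.

Lemma quadP e d (j : 'Z_4) :
  (if e then (if d then 1 else 0) else (if d then 2 else 3))%N = j -> quad e d = j.
Proof. by move=> jE; rewrite /quad jE inord_val. Qed.

Lemma qchart_x e d (v : 'cV[R[i]]_N) a :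
  (forall b, row_modulus a <= row_modulus b -> (qchart e d *m v) b 0 = 0) ->
  (qchart (~~ e) d *m v) a 0 = 0.
Proof.
have tr a' b' c' : upper a' b' -> upper b' c' -> upper a' c' by exact: le_trans.
have rf a' : upper a' a' by exact: lexx.
have o1 : odd (1%:R : 'Z_4) by [].
have o3 : odd (3%:R : 'Z_4) by [].
have [p1 q1] := tri_step v a tr rf (fun a b => @sigma_odd 1%:R a b o1)
  (@quadP true true 1%:R erefl) (@quadP false true (1%:R + 1) erefl).
have [p3 q3] := tri_step v a tr rf (fun a b => @sigma_odd 3%:R a b o3)
  (@quadP false false 3%:R erefl) (@quadP true false (3%:R + 1) erefl).
by case: e; case: d.
Qed.

Lemma qchart_y e d (v : 'cV[R[i]]_N) a :
  (forall b, row_modulus b <= row_modulus a -> (qchart e d *m v) b 0 = 0) ->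
  (qchart e (~~ d) *m v) a 0 = 0.
Proof.
have tr a' b' c' : lower a' b' -> lower b' c' -> lower a' c'.
  by move=> h1 h2; exact: le_trans h2 h1.
have rf a' : lower a' a' by exact: lexx.
have o0 : ~~ odd (0%:R : 'Z_4) by [].
have o2 : ~~ odd (2%:R : 'Z_4) by [].
have [p0 q0] := tri_step v a tr rf (fun a b => @sigma_even 0%:R a b o0)
  (@quadP true false 0%:R erefl) (@quadP true true (0%:R + 1) erefl).
have [p2 q2] := tri_step v a tr rf (fun a b => @sigma_even 2%:R a b o2)
  (@quadP false true 2%:R erefl) (@quadP false false (2%:R + 1) erefl).
by case: e; case: d.
Qed.

Lemma sector_ray (th : R) (j : 'Z_4) (z : Cplx) : sector th j z ->
  sector th (j + 1 : 'Z_4)%R z -> if odd j then crd1 th z = 0 else crd2 th z = 0.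
Proof.
rewrite !sector_pos; move: j; apply: Z4_cases; rewrite /pos => /= -[h1 h2] [h3 h4]; lra.
Qed.

(** On the ray between two sectors one coordinate vanishes, and the phases are ordered by modulus in
    the direction in which sigma_j is triangular. *)
Lemma alive_sigma (j : 'Z_4) (x : Cplx * R) a b : sector theta0 j x.1 ->
  sector theta0 (j + 1 : 'Z_4)%R x.1 -> sigma j a b != 0 ->
  0 <= x.2 + qphase (c_ a) x.1 -> 0 <= x.2 + qphase (c_ b) x.1.
Proof.
move=> jx j1x sab; have := sector_ray jx j1x.
rewrite !(qphaseE C_arg _ (row_exponent_mem _)) -/theta0 -!/(row_modulus _).
case: ifP => oj ->; rewrite expr0n /= ?sub0r ?subr0 => ax.
  have := sigma_odd oj sab; have := sqr_ge0 (crd2 theta0 x.1); nra.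
have := sigma_even (negbT oj) sab; have := sqr_ge0 (crd1 theta0 x.1); nra.
Qed.

Lemma alive_sigma_hat (j : 'Z_4) (x : Cplx * R) a b : sector theta0hat j x.1 ->
  sector theta0hat (j + 1 : 'Z_4)%R x.1 -> sigma j a b != 0 ->
  0 <= x.2 + qphase (row_exponent Chat theta0hat rhat a) x.1 ->
  0 <= x.2 + qphase (row_exponent Chat theta0hat rhat b) x.1.
Proof.
move=> jx j1x sab; have := sector_ray jx j1x.
rewrite !row_exponent_hat !(qphase_hatE _ (row_exponent_mem _)) -!/(row_modulus _).
have inv_le (m m' t : R) : 0 < m -> m <= m' -> 0 <= t -> t / (2 * m') <= t / (2 * m).
  move=> m0 mm t0; apply: ler_wpM2l => //.
  by rewrite lef_pV2 ?posrE ?mulr_gt0 //; [rewrite ler_pM2l|lra].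
case: ifP => oj ->; rewrite expr0n /= ?sub0r ?subr0 => ax.
  have := inv_le _ _ _ (row_modulus_gt0 a) (sigma_odd oj sab) (sqr_ge0 (crd2 theta0hat x.1)).
  by move: ax; rewrite !mulNr; lra.
have := inv_le _ _ _ (row_modulus_gt0 b) (sigma_even (negbT oj) sab) (sqr_ge0 (crd1 theta0hat x.1)).
by lra.
Qed.

End Numbering.

(** * The fibrations underlying the transform *)

Section Lines.
Variable R : realType.
Local Notation Cplx := (Cplx R).

Lemma continuous_crd1 (th : R) : continuous (fun z : Cplx => crd1 th z).
Proof.
apply: (@continuous_ReM R Cplx (fun=> cis (- th)) id); first exact: cst_continuous.
exact: continuous_idC.
Qed.

Lemma crd2E (th : R) z : crd2 th z = crd1 (th + pi / 2) z.
Proof.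
rewrite /crd1 /crd2 opprD addrC cisD -mulrA Re_cis cos_pihalf sin_pihalf.
by rewrite mul0r add0r mul1r.
Qed.

Lemma continuous_crd2 (th : R) : continuous (fun z : Cplx => crd2 th z).
Proof. by under eq_fun do rewrite crd2E; exact: continuous_crd1. Qed.

Lemma continuous_RC : continuous (fun x : R => (x%:C)%C : Cplx).
Proof.
move=> x; apply/(@cvgrPdist_lt _ _ _ _ (nbhs_filter x)) => e e0.
have [e1 e10 eE] : exists2 e1 : R, 0 < e1 & e = (e1%:C)%C.
  case: e e0 => a b; rewrite ltcE /= => /andP[/eqP -> a0]; by exists a.
rewrite eE; have : \forall y \near x, `|x - y| < e1.
  have c : (fun y : R => y) @ x --> x by exact: cvg_id.
  by have /cvgrPdist_lt := c; apply.
apply: filterS => y xy.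
have -> : (x%:C)%C - (y%:C)%C = ((x - y)%:C)%C :> R[i] by rewrite rmorphB.
by rewrite normc_def /= expr0n addr0 sqrtr_sqr ltcR.
Qed.

Definition from_crd (th x y : R) : Cplx := cis th * ((x%:C)%C + 'i%C * (y%:C)%C).

Lemma crd1_from th x y : crd1 th (from_crd th x y) = x.
Proof. by rewrite /crd1 /from_crd mulrA [_ * cis th]mulrC cisNK mul1r /=; ring. Qed.

Lemma crd2_from th x y : crd2 th (from_crd th x y) = y.
Proof. by rewrite /crd2 /from_crd mulrA [_ * cis th]mulrC cisNK mul1r /=; ring. Qed.

Lemma from_crdK th (z : Cplx) : from_crd th (crd1 th z) (crd2 th z) = z.
Proof.
rewrite /from_crd /crd1 /crd2; set u := cis (- th) * (z : R[i]).
have -> : (complex.Re u)%:C%C + 'i%C * (complex.Im u)%:C%C = u.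
  by case: u => a b; apply/eqP; rewrite eq_complex /=; apply/andP; split; apply/eqP; ring.
by rewrite /u mulrA cisNK mul1r.
Qed.

Lemma continuous_from_crd (X : topologicalType) (th : R) (x y : X -> R) :
  continuous x -> continuous y -> continuous (fun p => from_crd th (x p) (y p)).
Proof.
move=> cx cy.
have c1 : continuous (fun p => ((x p)%:C)%C : Cplx) := continuous_compo cx continuous_RC.
have c2 : continuous (fun p => ((y p)%:C)%C : Cplx) := continuous_compo cy continuous_RC.
have ci : continuous (fun p : X => 'i%C : Cplx) by exact: cst_continuous.
have c3 : continuous (fun p => ('i%C * ((y p)%:C)%C : R[i]) : Cplx).
  exact: continuous_mulC ci c2.
have c4 : continuous (fun p => (((x p)%:C)%C + 'i%C * ((y p)%:C)%C : R[i]) : Cplx).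
  move=> p; exact: (@cvgD R[i] Cplx X _ (nbhs_filter p) _ _ _ _ (c1 p) (c3 p)).
have ct : continuous (fun p : X => cis th : Cplx) by exact: cst_continuous.
exact: continuous_mulC ct c4.
Qed.

Lemma line_conv_mu (X : topologicalType) : is_line (@conv_mu R X) (fun p => p.2)
  (fun p : R * (X * R) => (p.2.1, p.2.2 - p.1, p.1)).
Proof.
have c1 : continuous (fun p : X * R * R => p.1.1).
  exact: continuous_compo (@continuous_fst _ _) (@continuous_fst _ _).
have c2 : continuous (fun p : X * R * R => p.1.2).
  exact: continuous_compo (@continuous_fst _ _) (@continuous_snd _ _).
have c3 : continuous (fun p : X * R * R => p.2) := @continuous_snd _ _.
have d1 : continuous (fun p : R * (X * R) => p.2.1).
  exact: continuous_compo (@continuous_snd _ _) (@continuous_fst _ _).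
have d2 : continuous (fun p : R * (X * R) => p.2.2).
  exact: continuous_compo (@continuous_snd _ _) (@continuous_snd _ _).
have d3 : continuous (fun p : R * (X * R) => p.1) := @continuous_fst _ _.
split=> //.
- by apply: continuous_pair => //; exact: continuous_add.
- apply: continuous_pair => //; apply: continuous_pair => //.
  by apply: continuous_add => //; exact: continuousNR.
- by move=> [t [x s]]; rewrite /conv_mu /= subrK.
- by move=> [[x s] t] /=; rewrite addrK.
Qed.

(** Forgets only the coordinate of z along which the heights are concave; the other one is the line
    left for [line_snd]. *)
Definition to_row (th : R) (p : Cplx * Cplx * R) : R * (Cplx * R) :=
  (crd2 th p.1.1, (p.1.2, p.2)).

Lemma line_to_row (th : R) : is_line (to_row th) (fun p => crd1 th p.1.1)
  (fun p : R * (R * (Cplx * R)) => (from_crd th p.1 p.2.1, p.2.2.1, p.2.2.2)).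
Proof.
have cz : continuous (fun p : Cplx * Cplx * R => p.1.1).
  exact: continuous_compo (@continuous_fst _ _) (@continuous_fst _ _).
have cw : continuous (fun p : Cplx * Cplx * R => p.1.2).
  exact: continuous_compo (@continuous_fst _ _) (@continuous_snd _ _).
have cs : continuous (fun p : Cplx * Cplx * R => p.2) := @continuous_snd _ _.
have d1 : continuous (fun p : R * (R * (Cplx * R)) => p.1) := @continuous_fst _ _.
have d2 : continuous (fun p : R * (R * (Cplx * R)) => p.2.1).
  exact: continuous_compo (@continuous_snd _ _) (@continuous_fst _ _).
have d22 : continuous (fun p : R * (R * (Cplx * R)) => p.2.2).
  exact: continuous_compo (@continuous_snd _ _) (@continuous_snd _ _).
have d3 : continuous (fun p : R * (R * (Cplx * R)) => p.2.2.1).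
  exact: continuous_compo d22 (@continuous_fst _ _).
have d4 : continuous (fun p : R * (R * (Cplx * R)) => p.2.2.2).
  exact: continuous_compo d22 (@continuous_snd _ _).
split.
- apply: continuous_pair; first exact: continuous_compo cz (@continuous_crd2 th).
  exact: continuous_pair.
- exact: continuous_compo cz (@continuous_crd1 th).
- have c0 := @continuous_from_crd _ th _ _ d1 d2.
  exact: (continuous_pair (continuous_pair c0 d3) d4).
- by move=> [x [y [w s]]]; rewrite /to_row /= crd2_from.
- by move=> [x [y [w s]]]; rewrite /= crd1_from.
- by move=> [[z w] s]; rewrite /to_row /= from_crdK.
Qed.

Lemma line_snd (W : topologicalType) :
  is_line (fun p : R * W => p.2) (fun p : R * W => p.1) id.
Proof.
split=> //; [exact: continuous_snd|exact: continuous_fst|by move=> p; exact: cvg_id|by case].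
Qed.

(** The two rotation angles add up to pi, which produces the sign; this is the origin of pi -
    theta0. *)
Lemma Re_mul_crd (th : R) (z w : R[i]) : complex.Re (z * w) =
  - (crd1 th z * crd1 (pi - th) w - crd2 th z * crd2 (pi - th) w).
Proof.
rewrite /crd1 /crd2; set u := cis (- th) * z; set v := cis (- (pi - th)) * w.
have -> : z * w = - (u * v).
  rewrite /u /v mulrACA -cisD.
  have -> : - th + - (pi - th) = - pi :> R by rewrite opprB addrA addNr add0r.
  by rewrite cisNpi mulN1r opprK.
by case: u => a b; case: v => c d.
Qed.

End Lines.

(** * Computation of the transform *)

Section TopDegree.
Variables (R : realType) (K : fieldType) (X W : topologicalType).
Variables (f : X -> W) (g : X -> R) (h : R * W -> X).
Hypothesis L : is_line f g h.
Variables (V : lmodType K) (Ker : X -> V -> Prop) (P : cpx K X).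
Variable e : V -> dprod (P 0).
Hypothesis rP : resolves Ker e.
Hypothesis geP : forall n, germ_extendable g (P n).
Hypothesis ker_cap : forall x0 v,
  sum_ker Ker (fun x => f x = f x0 /\ g x <= g x0) v ->
  sum_ker Ker (fun x => f x = f x0 /\ g x0 <= g x) v -> Ker x0 v.

Variables (D : cpx K W) (th : forall n, hom (D n) (shriek_cpx f P n)).
Hypothesis th_dif : forall n w u, dif (shriek_cpx f P) n w (th n w u) = th (n + 1) w (dif D n w u).
Hypothesis th_inj : forall n w u, th n w u = 0 -> u = 0.
Hypothesis th_surj : forall n w v, exists u, th n w u = v.

Variables (H : sheaf K W) (tau : V -> dprod H).
Hypothesis tau_lin : linear tau.
Hypothesis tau_reg : forall v w, regular (tau v) w.
Hypothesis tau_ker : forall v w, tau v w = 0 <-> fiber_sum f Ker w v.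
Hypothesis tau_surj : forall w u, exists v, tau v w = u.

Let A := shift1 D.

Lemma th_eq n w u v : th n w u = th n w v -> u = v.
Proof.
move=> uv; apply/eqP; rewrite -subr_eq0; apply/eqP; apply: (@th_inj n).
by rewrite homB uv subrr.
Qed.

Lemma shift_dif0 n w (u : A n w) : dif A n w u = 0 <-> dif D (n + 1) w u = 0.
Proof.
rewrite -[dif A n w u]/(- dif D (n + 1) w u).
by split=> [/eqP|->]; [rewrite oppr_eq0 => /eqP|rewrite oppr0].
Qed.

Lemma shift_im n w (p : A (n + 1) w) : (exists u, p = dif D (n + 1) w u) ->
  exists u, p = dif A n w u.
Proof. by move=> [u ->]; exists (- u); rewrite [RHS]/= homN opprK. Qed.

Lemma shift_exact n w (p : A (n + 1) w) : n + 1 <> 0 ->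
  dif A (n + 1) w p = 0 -> exists u, p = dif A n w u.
Proof.
move=> n1 /shift_dif0 dp; apply: shift_im.
have [||u pu] := shriek_exact_off1 L rP geP ker_cap (p := th _ w p).
- by lia.
- by rewrite th_dif dp hom0.
have [u' uE] := th_surj u; exists u'; apply: th_eq.
by rewrite pu -uE th_dif.
Qed.

Lemma trunc_closed w (u : trunc_obj A 0 w) :
  dif (shriek_cpx f P) (0 + 1) w (th (0 + 1) w (subsp_val u)) = 0.
Proof.
have [+ _] := subsp_valP u => /(_ isT)/shift_dif0 du.
by rewrite th_dif du hom0.
Qed.

Definition top_vec w (u : trunc_obj A 0 w) : V :=
  projT1 (cid (prim_ex L rP geP (trunc_closed u))).

Lemma top_vecP w u : prim g e (th (0 + 1) w (subsp_val u)) (@top_vec w u).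
Proof. by rewrite /top_vec; case: cid. Qed.

Definition top_fun w (u : trunc_obj A 0 w) : H w := tau (top_vec u) w.

(** The vector of a primitive is unique up to [fiber_sum], which is the kernel of [tau]; so the
    chosen [top_vec] may be replaced by any other. *)
Lemma top_funE w (u : trunc_obj A 0 w) v :
  prim g e (th (0 + 1) w (subsp_val u)) v -> top_fun u = tau v w.
Proof.
move=> uv; apply/eqP; rewrite -subr_eq0; apply/eqP.
have t0 := (tau_ker (top_vec u - v) w).2 (prim_uniq L rP (top_vecP u) uv).
have tB := tau_lin (-1) v (top_vec u); rewrite !scaleN1r in tB.
by rewrite [top_vec u - v]addrC tB in t0; rewrite addrC.
Qed.

Fact top_lin w : linear (@top_fun w).
Proof.
move=> a u v; rewrite (@top_funE w _ (a *: top_vec u + top_vec v)).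
  by rewrite tau_lin.
have -> : th (0 + 1) w (subsp_val (a *: u + v)) =
    a *: th (0 + 1) w (subsp_val u) + th (0 + 1) w (subsp_val v) by exact: hom_lin.
by apply: (prim_lin rP); exact: top_vecP.
Qed.

Fact top_reg (s : dprod (trunc_obj A 0)) w : regular s w ->
  regular (fun w => top_fun (s w)) w.
Proof.
move=> sw; have ts := hom_reg (th (0 + 1)) (s := fun w => subsp_val (s w)) sw.
apply: (regular_local _ (tau_reg (top_vec (s w)) w)).
apply: filterS (prim_near L rP ts (top_vecP (s w))) => y yv.
by rewrite (top_funE yv).
Qed.

Definition top_hom : hom (trunc_obj A 0) H := Hom top_lin top_reg.

(** Sending a cocycle to [tau] of its class is onto by [prim_surj] and kills exactly the
    coboundaries by [prim_im]; the other degrees are exact by [shriek_exact_off1]. *)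
Lemma derived_iso_line : derived_iso A (deg0 H).
Proof.
apply: (@derived_iso_deg0 _ _ A H top_hom); first exact: shift_exact.
- move=> w y; have [v <-] := tau_surj y.
  have [c dc cv] := prim_surj L rP geP w v.
  have [u uc] := th_surj c.
  have du : dif D (0 + 1) w u = 0.
    by apply: (@th_inj (0 + 1 + 1)); rewrite -th_dif uc.
  have tu : trunc_space A 0 w u by split=> // _; exact/shift_dif0.
  by exists (Subsp tu); apply: top_funE; rewrite uc.
- move=> w u; rewrite -[top_hom w u]/(tau (top_vec u) w) tau_ker.
  rewrite -(prim_im L rP (top_vecP u)); split=> [[c uc]|[c uc]].
    have [c' cE] := th_surj c; apply: (@shift_im (-1)); exists c'.
    by apply: (@th_eq (0 + 1)); rewrite uc -cE th_dif.
  exists (th 0 w (- c)); rewrite th_dif; congr (th _ _ _).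
  by rewrite uc homN.
Qed.

End TopDegree.

Section Resolutions.
Variables (K : fieldType) (X : topologicalType) (V : lmodType K).

Lemma resolves_ext (Ker Ker' : X -> V -> Prop) (P : cpx K X) (e : V -> dprod (P 0)) :
  (forall x v, Ker x v <-> Ker' x v) -> resolves Ker e -> resolves Ker' e.
Proof. by move=> KK [h1 h2 h3 h4 h5 h6 h7]; split=> // v x; rewrite -KK. Qed.

Lemma resolves_deg0 (Ker : X -> V -> Prop) (G : sheaf K X) (tau : V -> dprod G) :
  linear tau -> (forall v x, regular (tau v) x) ->
  (forall v x, tau v x = 0 <-> Ker x v) -> (forall x u, exists v, tau v x = u) ->
  resolves Ker (tau : V -> dprod (deg0 G 0)).
Proof.
move=> tlin treg tker tsurj; split=> //.
- by move=> v x; rewrite tker.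
- move=> x p _; have [v <-] := tsurj x p; exists v, 0.
  by rewrite [dif _ _ _ _]hom0 addr0.
- move=> n x p n1 _; exists 0; rewrite hom0; exact: deg0_obj0.
Qed.

(** Whichever branch [chosen_resolution] takes, the terms are soft: injective sheaves are soft, and
    otherwise the complex is unchanged and must satisfy the second alternative. *)
Lemma chosen_resolves (Ker : X -> V -> Prop) (P : cpx K X) (e : V -> dprod (P 0)) :
  resolves Ker e -> (exists B, injective_resolution P B) \/ (forall n, soft (P n)) ->
  (exists e' : V -> dprod (chosen_resolution P 0), resolves Ker e') /\
  forall n, soft (chosen_resolution P n).
Proof.
move=> rP cases; rewrite /chosen_resolution; case: pselect => [ex|nex].
  case: (cid ex) => /= B [_ inj [f qf]]; split; last first.
    by move=> n; exact: injective_soft.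
  by eexists; exact: (res_quasi rP qf).
case: cases => // sP; split=> //.
by exists e.
Qed.

End Resolutions.

Lemma sum_shift_ge0 (R : realDomainType) (a b a' b' c : R) :
  a + b = a' + b' -> b' <= b -> 0 <= a + c -> 0 <= a' + c.
Proof. by move=> ? ? ?; lra. Qed.

(** * Convolution with the kernel of the transform *)

Section Convolution.
Variable R : realType.
Local Notation k := R[i].
Local Notation Cplx := (Cplx R).
Local Notation Cplx2 := (Cplx * Cplx)%type.
Variables (F : sheaf k (Cplx * R)%type) (V : lmodType k) (tau : V -> dprod F).
Variable kerF : Cplx * R -> V -> Prop.
Hypothesis tau_lin : linear tau.
Hypothesis tau_reg : forall v x, regular (tau v) x.
Hypothesis tau_ker : forall v x, tau v x = 0 <-> kerF x v.
Hypothesis tau_surj : forall x u, exists v, tau v x = u.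
Hypothesis kerF_mono : forall z (t t' : R) v, t' <= t -> kerF (z, t) v -> kerF (z, t') v.
Hypothesis kerF_low : forall z0 : Cplx, exists M : R, \forall z \near z0,
  forall t, t <= M -> forall v, kerF (z, t) v.

Let Ephase := Esheaf (@locally_closedT Cplx2) (@continuous_laplace_phase R).
Let E1 := Efill (@locally_closedT Cplx2) (@continuous_laplace_phase R) (1 : k).
Let pF := inv_sheaf (@continuous_laplace_p R) F.
Let G := tens_sheaf (inv_sheaf (@continuous_q1 R Cplx2) Ephase)
  (inv_sheaf (@continuous_q2 R Cplx2) pF).

Definition conv_ker (p : Cplx2 * R * R) v :=
  0 <= p.1.2 + laplace_phase p.1.1 -> kerF (p.1.1.1, p.2) v.

Definition conv_sect (v : V) : dprod G := fun p =>
  pure (E1 (conv_q1 p) : inv_sheaf (@continuous_q1 R Cplx2) Ephase p)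
    (tau v (laplace_p (conv_q2 p)) : inv_sheaf (@continuous_q2 R Cplx2) pF p).

Lemma tau_linE a u v x : tau (a *: u + v) x = a *: tau u x + tau v x.
Proof. by rewrite tau_lin. Qed.

Lemma conv_sect_lin : linear conv_sect.
Proof.
move=> a u v; apply: functional_extensionality_dep => p.
by rewrite /conv_sect tau_linE pureDr pureZr.
Qed.

Lemma conv_sect_reg v p : regular (conv_sect v) p.
Proof.
pose s1 : dprod (inv_sheaf (@continuous_q1 R Cplx2) Ephase) := fun p => E1 (conv_q1 p).
pose s2 : dprod (inv_sheaf (@continuous_q2 R Cplx2) pF) :=
  fun p => tau v (laplace_p (conv_q2 p)).
exists [:: (s1, s2)].
  move=> q; rewrite inE => /eqP ->; split.
    exists E1; last by apply: filterE.
    by apply: Efill_reg; exact: closedT.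
  exists (fun x => tau v (laplace_p x) : pF x); last by apply: filterE.
  by exists (tau v); [exact: tau_reg|apply: filterE].
by apply: filterE => q; rewrite big_seq1.
Qed.

Lemma conv_sect_ker v p : conv_sect v p = 0 <-> conv_ker p v.
Proof.
rewrite /conv_ker; split=> [v0 ph|kv].
  apply/tau_ker; apply: contrapT => tv.
  by apply: (pure_neq0 _ tv v0); exact: Efill_neq0.
have [ph|nph] := boolP (0 <= p.1.2 + laplace_phase p.1.1).
  have /tau_ker tv := kv ph.
  by rewrite /conv_sect [tau v _]tv pure0r.
rewrite /conv_sect; have -> : E1 (conv_q1 p) = 0; last exact: pure0l.
by apply: Efill_out => -[_ ph]; move/negP: nph; apply.
Qed.

Lemma conv_sect_surj p u : exists v, conv_sect v p = u.
Proof.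
have [x ->] := tens_genl (@Egen R Cplx2 _ _ _ _ (conv_q1 p)) u.
by have [v <-] := tau_surj x; exists v.
Qed.

(** On a fibre t1 + t2 is fixed: for large t2 the exponential factor is dead, for very negative t2
    the factor from [F] is. *)
Lemma conv_near (y0 : Cplx2 * R) : exists M : R, \forall y \near y0,
  forall p, conv_mu p = y -> M <= `|p.2| -> forall v, conv_ker p v.
Proof.
have [M nM] := kerF_low y0.1.1.
pose a := y0.2 + laplace_phase y0.1.
have c : continuous (fun y : Cplx2 * R => y.2 + laplace_phase y.1).
  apply: continuous_add; first exact: continuous_snd.
  exact: (continuous_compo (@continuous_fst _ _) (@continuous_laplace_phase R)).
have a1 : a < a + 1 by lra.
have n1 : \forall y \near y0, y.2 + laplace_phase y.1 < a + 1.
  exact: (@cvgr_lt R _ (nbhs y0) _ (fun y : Cplx2 * R => y.2 + laplace_phase y.1) a (c y0)).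
have cz : continuous (fun y : Cplx2 * R => y.1.1).
  exact: continuous_compo (@continuous_fst _ _) (@continuous_fst _ _).
have n2 : \forall y \near y0, forall t, t <= M -> forall v, kerF (y.1.1, t) v.
  exact: (cz y0 _ nM).
exists (`|M| + `|a| + 1).
have := ler_norm a; have := ler_norm (- M); rewrite normrN => m1 m2.
have m3 := normr_ge0 a; have m4 := normr_ge0 M.
apply: (@filterS2 _ (nbhs y0) _ _ _ _ _ n1 n2) => y ya yM p py pM v ph.
have p1 : p.1.1 = y.1 by rewrite -py.
have p2 : p.1.2 + p.2 = y.2 by rewrite -py.
rewrite p1; apply: yM; move: pM; rewrite ler_normr => /orP[] pM.
  by exfalso; move: ph ya; rewrite p1 -p2; lra.
by lra.
Qed.

(** On the line t1 + t2 = s the exponential factor is alive for t2 up to s + [laplace_phase], and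
    the subspaces of [F] shrink as t2 grows. The intersection is therefore the subspace at that end
    point. *)
Lemma conv_resolves :
  (exists e : V -> dprod (conv Ephase pF 0),
    resolves (fun y v => kerF (y.1.1, y.2 + laplace_phase y.1) v) e) /\
  forall n, soft (conv Ephase pF n).
Proof.
have rG := resolves_deg0 conv_sect_lin conv_sect_reg conv_sect_ker conv_sect_surj.
have [[e re] sI] := chosen_resolves rG (or_introl (injective_resolution_deg0 G)).
have L := line_conv_mu R Cplx2.
split; last by move=> n; apply: soft_shriek (sI n); exact: (line_f L).
have geI n : germ_extendable (fun p : Cplx2 * R * R => p.2) (chosen_resolution (deg0 G) n).
  by apply: soft_germ_extendable (sI n); [exact: uniform_regular|exact: (line_g L)].
have split_ker (p0 : Cplx2 * R * R) v : conv_ker p0 v -> exists k1 k2, [/\ v = k1 + k2,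
    forall p, conv_mu p = conv_mu p0 -> p.2 <= p0.2 -> conv_ker p k1
  & forall p, conv_mu p = conv_mu p0 -> p0.2 <= p.2 -> conv_ker p k2].
  have ker00 p : conv_ker p 0 by exact: (ker0 rG).
  move=> kv; have [ph|nph] := boolP (0 <= p0.1.2 + laplace_phase p0.1.1).
    exists v, 0; split; [by rewrite addr0| |by []].
    move=> p pp le _; have -> : p.1.1 = p0.1.1 by have := congr1 fst pp.
    exact: kerF_mono le (kv ph).
  exists 0, v; split; [by rewrite add0r|by []|].
  move=> p pp le; rewrite /conv_ker.
  have -> : p.1.1 = p0.1.1 by have := congr1 fst pp.
  have := congr1 snd pp; rewrite /= => pE ph; exfalso.
  by move/negP: nph; apply; exact: sum_shift_ge0 pE le ph.
have [e' re'] := resolves_shriek L re geI conv_near split_ker.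
exists e'; apply: resolves_ext re' => y v; split=> [kv|kv p py ph].
  (* The extreme point, at which the exponential factor is still alive. *)
  pose p : Cplx2 * R * R := (y.1, - laplace_phase y.1, y.2 + laplace_phase y.1).
  apply: (kv p); last by rewrite /p /= addNr.
  by rewrite /conv_mu /p /=; case: (y) => a b /=; congr pair; ring.
have p1 : p.1.1 = y.1 by rewrite -py.
have p2 : p.1.2 + p.2 = y.2 by rewrite -py.
rewrite p1; apply: kerF_mono kv; rewrite p1 in ph.
by rewrite -p2 addrAC lerDr.
Qed.

End Convolution.

(** * The subspaces of the three successive direct images *)

Section Main.
Variables (R : realType) (C : {fset R[i]}) (argC : R) (r : R[i] -> nat) (N : nat).
Variable sigma : 'Z_4 -> 'M[R[i]]_N.
Local Notation k := R[i].
Local Notation Cplx := (Cplx R).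
Local Notation Cplx2 := (Cplx * Cplx)%type.
Hypothesis C_arg : forall c, c \in C -> has_arg c argC.
Let theta0 : R := - (argC / 2).
Hypothesis gd : gluing_data C theta0 r sigma.
Let Chat := [fset - c^-1 | c in C]%fset.
Let theta0hat : R := pi - theta0.
Let rhat := fun chat : R[i] => r (- chat^-1).
Let rho : 'I_N -> R := fun a => row_modulus C argC r a.
Let ch := qchart sigma.

Let rho_gt0 a : 0 < rho a. Proof. exact: row_modulus_gt0 C_arg gd a. Qed.
Let ch_unit e d : ch e d \in unitmx. Proof. exact: qchart_unit gd e d. Qed.
Let ch_x e d (v : 'cV[k]_N) a :
  (forall b, rho a <= rho b -> (ch e d *m v) b 0 = 0) -> (ch (~~ e) d *m v) a 0 = 0.
Proof. exact: (qchart_x C_arg gd). Qed.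
Let ch_y e d (v : 'cV[k]_N) a :
  (forall b, rho b <= rho a -> (ch e d *m v) b 0 = 0) -> (ch e (~~ d) *m v) a 0 = 0.
Proof. exact: (qchart_y C_arg gd). Qed.

Variables F Fhat : sheaf k (Cplx * R)%type.
Hypothesis gF : is_gluing C theta0 r sigma F.
Hypothesis gFhat : is_gluing Chat theta0hat rhat sigma Fhat.

Let kerF := gluing_ker C theta0 r (chart sigma).

Lemma kerF_mono z (t t' : R) v : t' <= t -> kerF (z, t) v -> kerF (z, t') v.
Proof. by move=> tt kv j a jz ha; apply: kv => //=; apply: le_trans ha _; rewrite lerD2r. Qed.

Lemma kerF_low (z0 : Cplx) : exists M : R, \forall z \near z0,
  forall t, t <= M -> forall v, kerF (z, t) v.
Proof.
pose m : R := \sum_(a < N) (`|qphase (row_exponent C theta0 r a) z0| + 1).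
have mP (a : 'I_N) : qphase (row_exponent C theta0 r a) z0 + 1 <= m.
  rewrite /m (bigD1 a) //= -[leLHS]addr0 lerD //; first by rewrite lerD2r ler_norm.
  by apply: sumr_ge0 => b _; rewrite addr_ge0.
pose Q (a : 'I_N) : set Cplx := fun z => qphase (row_exponent C theta0 r a) z < m.
have nQ : \forall z \near z0, forall a, Q a z.
  apply: (@filter_forall _ _ Q (nbhs z0)) => a; have lt : qphase (row_exponent C theta0 r a) z0 < m.
    by have := mP a; lra.
  exact: (@cvgr_lt R Cplx (nbhs z0) _ (qphase (row_exponent C theta0 r a)) _
    (@continuous_qphase R (row_exponent C theta0 r a) z0)).
exists (- m); apply: filterS nQ => z Qz t tm v j a _ /= ha.
by exfalso; have := Qz a; rewrite /Q; lra.
Qed.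

Let kerT (p : Cplx2 * R) (v : 'cV[k]_N) := ker_xy rho ch p.2 (crd1 theta0 p.1.1)
  (crd2 theta0 p.1.1) (crd1 theta0hat p.1.2) (crd2 theta0hat p.1.2) v.

Lemma kerT_E (p : Cplx2 * R) (v : 'cV[k]_N) : kerF (p.1.1, p.2 + laplace_phase p.1) v <-> kerT p v.
Proof.
have hE (a : 'I_N) : p.2 + laplace_phase p.1 + qphase (row_exponent C theta0 r a) p.1.1 =
    height (rho a) p.2 (crd1 theta0 p.1.1) (crd2 theta0 p.1.1)
      (crd1 theta0hat p.1.2) (crd2 theta0hat p.1.2).
  rewrite (qphaseE C_arg _ (row_exponent_mem gd a)) /laplace_phase.
  rewrite (Re_mul_crd theta0) -/theta0 -/theta0hat -[modulus argC _]/(rho a) /height.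
  ring.
split=> [kv e d ex dy a ha|kv j a /sector_pos[jx jy] /= ha].
  apply: (kv (quad e d) a); first by apply/sector_pos; rewrite quad1E quad2E.
  by rewrite /= hE.
by rewrite -[j]quadK; apply: (kv (quad1 j) (quad2 j)) => //; rewrite -hE.
Qed.

Let kerhat := gluing_ker Chat theta0hat rhat (chart sigma).

Lemma kerhat_E (x : Cplx * R) (v : 'cV[k]_N) : kerhat x v <->
  ker_c rho ch x.2 (crd1 theta0hat x.1) (crd2 theta0hat x.1) v.
Proof.
have hE (a : 'I_N) : x.2 + qphase (row_exponent Chat theta0hat rhat a) x.1 =
    height_c (rho a) x.2 (crd1 theta0hat x.1) (crd2 theta0hat x.1).
  by rewrite (row_exponent_hat r C_arg) (qphase_hatE C_arg _ (row_exponent_mem gd a)).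
split=> [kv e d ex dy a ha|kv j a /sector_pos[jx jy] ha].
  apply: (kv (quad e d) a); first by apply/sector_pos; rewrite quad1E quad2E.
  by rewrite hE.
by rewrite -[j]quadK; apply: (kv (quad1 j) (quad2 j)) => //; rewrite -hE.
Qed.

(** The remaining coordinates stay below some [B] near [y0], and beyond the bound of [height_bound]
    every row is dead; summing over rows makes the bound uniform. *)
Lemma kerT_bounded (y0 : R * (Cplx * R)) : exists M : R, \forall y \near y0,
  forall p, to_row theta0 p = y -> M <= `|crd1 theta0 p.1.1| -> forall v, kerT p v.
Proof.
pose f1 (y : R * (Cplx * R)) := y.1.
pose f2 (y : R * (Cplx * R)) := crd1 theta0hat y.2.1.
pose f3 (y : R * (Cplx * R)) := crd2 theta0hat y.2.1.
pose f4 (y : R * (Cplx * R)) := y.2.2.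
have cw : continuous (fun y : R * (Cplx * R) => y.2.1).
  exact: continuous_compo (@continuous_snd _ _) (@continuous_fst _ _).
have c1 : continuous f1 := @continuous_fst _ _.
have c2 : continuous f2 := continuous_compo cw (@continuous_crd1 R theta0hat).
have c3 : continuous f3 := continuous_compo cw (@continuous_crd2 R theta0hat).
have c4 : continuous f4 := continuous_compo (@continuous_snd _ _) (@continuous_snd _ _).
pose B := `|f1 y0| + `|f2 y0| + `|f3 y0| + `|f4 y0| + 1.
have B0 : 0 <= B by rewrite /B !addr_ge0.
have bd (f : R * (Cplx * R) -> R) : continuous f -> `|f y0| < B ->
    \forall y \near y0, `|f y| < B.
  move=> cf; have cn : continuous (fun y => `|f y|) :=
    continuous_compo cf (@norm_continuous R R^o).
  exact: (@cvgr_lt R _ (nbhs y0) _ (fun y => `|f y|) _ (cn y0)).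
have [a1 a2 a3 a4] : [/\ `|f1 y0| < B, `|f2 y0| < B, `|f3 y0| < B & `|f4 y0| < B].
  have := normr_ge0 (f1 y0); have := normr_ge0 (f2 y0); have := normr_ge0 (f3 y0).
  by have := normr_ge0 (f4 y0); rewrite /B => *; split; lra.
pose m (a : 'I_N) := 1 + 2 * (2 * B + B ^+ 2 + rho a * B ^+ 2) / rho a.
have m0 a : 0 <= m a.
  have q0 := sqr_ge0 B; have q1 := mulr_ge0 (ltW (rho_gt0 a)) q0.
  by rewrite /m addr_ge0 // divr_ge0 ?(ltW (rho_gt0 a)) //; lra.
have mP a : m a <= \sum_b m b.
  by rewrite (bigD1 a) //= lerDl; apply: sumr_ge0.
exists (\sum_b m b).
apply: (@filterS3 _ (nbhs y0) _ _ _ _ _ _ (bd _ c1 a1) (bd _ c2 a2)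
  (@filterI _ (nbhs y0) _ _ _ (bd _ c3 a3) (bd _ c4 a4))).
move=> y b1 b2 [b3 b4] p py pM v e d _ _ a ha; exfalso.
suff : height (rho a) p.2 (crd1 theta0 p.1.1) (crd2 theta0 p.1.1)
    (crd1 theta0hat p.1.2) (crd2 theta0hat p.1.2) < 0 by rewrite ltNge ha.
have e1 : crd2 theta0 p.1.1 = f1 y by rewrite -py.
have e2 : p.1.2 = y.2.1 by rewrite -py.
have e4 : p.2 = f4 y by rewrite -py.
rewrite e1 e2 e4; apply: (@height_bound _ (rho a) B) => //; try exact: ltW.
exact: le_trans (mP a) pM.
Qed.

Let kerY (y : R * (Cplx * R)) (v : 'cV[k]_N) := ker_y rho ch y.2.2 y.1
  (crd1 theta0hat y.2.1) (crd2 theta0hat y.2.1) v.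

Lemma kerY_E (y : R * (Cplx * R)) (v : 'cV[k]_N) :
  (forall p, to_row theta0 p = y -> kerT p v) <-> kerY y v.
Proof.
split=> [kv x|kv p py]; last by subst y; exact: kv.
have := kv (from_crd theta0 x y.1, y.2.1, y.2.2).
rewrite /kerT /= crd1_from crd2_from; apply.
by rewrite /to_row /= crd2_from; case: (y) => a [b c].
Qed.

(** It suffices to test the rows alive at [y0], and by [ker_y_cap] each of these vanishes on all
    summands from one of the two sides. *)
Lemma kerY_cap (y0 : R * (Cplx * R)) (v : 'cV[k]_N) :
  sum_ker kerY (fun y => y.2 = y0.2 /\ y.1 <= y0.1) v ->
  sum_ker kerY (fun y => y.2 = y0.2 /\ y0.1 <= y.1) v -> kerY y0 v.
Proof.
move=> sl sr.
have [e [d [ew [dy H]]]] := ker_y_cap rho_gt0 ch_x ch_y y0.2.2 y0.1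
  (crd1 theta0hat y0.2.1) (crd2 theta0hat y0.2.1).
apply/(ker_yP rho_gt0 ch_x ch_y _ _ _ ew dy) => a /H[Hl|Hr].
  elim: sl => [|y u v' [y2 y1] ku _ IH]; first by rewrite mulmx0 mxE.
  rewrite mulmxDr mxE IH addr0; apply: (Hl y.1) => //.
  by move: ku; rewrite /kerY y2.
elim: sr => [|y u v' [y2 y1] ku _ IH]; first by rewrite mulmx0 mxE.
rewrite mulmxDr mxE IH addr0; apply: (Hr y.1) => //.
by move: ku; rewrite /kerY y2.
Qed.

Lemma kerY_sum (x : Cplx * R) (v : 'cV[k]_N) :
  fiber_sum (fun y : R * (Cplx * R) => y.2) kerY x v <-> kerhat x v.
Proof.
rewrite kerhat_E; split.
  elim=> [|y u v' y2 ku _ IH] e d ew dw a ha; first by rewrite mulmx0 mxE.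
  rewrite mulmxDr mxE (IH e d ew dw a ha) addr0.
  apply: (ker_y_ker_c rho_gt0 ch_x ch_y (s := x.2) (y := y.1)) ha => //.
  by move: ku; rewrite /kerY y2.
move=> /(ker_c_sum rho_gt0 ch_unit ch_x ch_y)[f [-> kf]].
elim: (index_enum _) => [|a l IH]; first by rewrite big_nil; exact: sum_ker0.
rewrite big_cons; apply: (sum_kerD (x := (crd2 theta0hat x.1 / rho a, x))) IH => //.
exact: kf.
Qed.

Lemma laplace_gluing : derived_iso (laplace F) (deg0 Fhat).
Proof.
have cS := chartS gd; have cU := chart_unit gd.
have [tau [tlin treg tker tsurj]] := gluing_sections gF cU cS
  (alive_sigma C_arg gd) (@closed_sector R theta0) (@sector_chain R theta0).
have [tauh [hlin hreg hker hsurj]] := gluing_sections gFhat cU cS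
  (alive_sigma_hat C_arg gd) (@closed_sector R theta0hat) (@sector_chain R theta0hat).
have [[e0 r0] s0] := conv_resolves tlin treg tker tsurj kerF_mono kerF_low.
have r1 := resolves_ext kerT_E r0.
(* The convolution complex has soft terms, so no injective resolution of it has to be produced. *)
have [[e2 r2] s2] := chosen_resolves r1 (or_intror s0).
set J := chosen_resolution _ in e2 r2 s2.
have L1 := line_to_row theta0; have L2 := @line_snd R (Cplx * R)%type.
have ge1 n : germ_extendable (fun p : Cplx2 * R => crd1 theta0 p.1.1) (J n).
  by apply: soft_germ_extendable (s2 n); [exact: uniform_regular|exact: (line_g L1)].
have split1 (p0 : Cplx2 * R) (v : 'cV[k]_N) : kerT p0 v -> exists k1 k2, [/\ v = k1 + k2,
    forall p, to_row theta0 p = to_row theta0 p0 ->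
      crd1 theta0 p.1.1 <= crd1 theta0 p0.1.1 -> kerT p k1
  & forall p, to_row theta0 p = to_row theta0 p0 ->
      crd1 theta0 p0.1.1 <= crd1 theta0 p.1.1 -> kerT p k2].
  move=> /(ker_xy_split rho_gt0 ch_unit ch_x ch_y)[k1 [k2 [vE k1P k2P]]].
  exists k1, k2; split=> // p pp le;
    have d1 : crd2 theta0 p.1.1 = crd2 theta0 p0.1.1 := congr1 fst pp;
    have d2 : p.1.2 = p0.1.2 := congr1 (fun y => y.2.1) pp;
    have d3 : p.2 = p0.2 := congr1 (fun y => y.2.2) pp;
    rewrite /kerT d1 d2 d3; [exact: k1P|exact: k2P].
have [e3 r3'] := resolves_shriek L1 r2 ge1 kerT_bounded split1.
have r3 := resolves_ext kerY_E r3'.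
have s3 n : soft (shriek_cpx (to_row theta0) J n).
  by apply: soft_shriek (s2 n); exact: (line_f L1).
have ge3 n : germ_extendable (fun y : R * (Cplx * R) => y.1) (shriek_cpx (to_row theta0) J n).
  by apply: soft_germ_extendable (s3 n); [exact: uniform_regular|exact: (line_g L2)].
(* [laplace_q] is the composite of the two lines, so its direct image is compared through [theta]
   with two successive ones of the same complex, without a second resolution. *)
have qE x : laplace_q x = (to_row theta0 x).2 by [].
have tdif n w u := theta_dif L1 L2 qE (dif J n) (w := w) u.
have tinj n w u := @theta_inj _ _ _ _ _ _ _ _ _ _ _ L1 L2 _ qE (J n) w u.
have tsurj' n w v := @theta_surj _ _ _ _ _ _ _ _ _ _ _ L1 L2 _ qE (J n) w v.
have hker' v w : tauh v w = 0 <-> fiber_sum (fun y : R * (Cplx * R) => y.2) kerY w v.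
  by rewrite hker kerY_sum.
exact: (@derived_iso_line _ _ _ _ _ _ _ L2 _ _ _ _ r3 ge3 kerY_cap
  (shriek_cpx (@laplace_q R) J) (fun n => theta L1 L2 qE (J n)) tdif tinj tsurj'
  Fhat tauh hlin hreg hker' hsurj).
Qed.

End Main.

Theorem theorem10p1 (R : realType) (C : {fset R[i]}) (argC : R)
    (r : R[i] -> nat) (N : nat) (sigma : 'Z_4 -> 'M[R[i]]_N) :
  C != fset0 ->
  (forall c, c \in C -> has_arg c argC) ->
  let theta0 := - (argC / 2) in
  - (pi / 2) <= theta0 < pi / 2 ->
  gluing_data C theta0 r sigma ->
  let Chat := [fset - c^-1 | c in C]%fset in
  let theta0hat := pi - theta0 in
  let rhat := fun chat : R[i] => r (- chat^-1) in
  [/\ generic C theta0, generic Chat theta0hat,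
      gluing_data Chat theta0hat rhat sigma
    & forall F Fhat : sheaf R[i] (Cplx R * R)%type,
        is_gluing C theta0 r sigma F ->
        is_gluing Chat theta0hat rhat sigma Fhat ->
        derived_iso (laplace F) (deg0 Fhat)].
Proof.
move=> _ C_arg theta0 _ gd Chat theta0hat rhat; split.
- exact: (generic_C C_arg).
- exact: (generic_Chat C_arg).
- exact: (gluing_data_hat C_arg gd).
- by move=> F Fhat gF gFhat; exact: (laplace_gluing C_arg gd gF gFhat).
Qed.
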